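(* Let $(X_1,Y_1),(X_2,Y_2),\ldots$ be i.i.d. copies of a pair $(X,Y)$ of real random variables. If $\mathbb{E}[X^8]<\infty$ and $\mathbb{E}[Y^8]<\infty$ and $X$ and $Y$ are not almost surely constant, then, as $n\to\infty$, $$\sqrt n\,\big((\widehat{\rho_{l1}},\widehat{\rho_{l2}})-(\rho_{l1},\rho_{l2})\big)\ \to\ \mathcal N_2(0,\Sigma^* )\quad\text{in distribution},$$ where $\rho_{l1}=\rho_{\mathrm{Pear}}(X,Y)$ and $\rho_{l2}=\rho_{\mathrm{Pear}}(\breve X^2,\breve Y^2)$ with $\breve X=(X-\mathbb{E}[X])/\mathrm{sd}(X)$ and $\breve Y=(Y-\mathbb{E}[Y])/\mathrm{sd}(Y)$, and $\widehat{\rho_{l1}},\widehat{\rho_{l2}}$ are their moment estimators based on $(X_1,Y_1),\ldots,(X_n,Y_n)$ (defined in the context). For the asymptotic covariance matrix we have $\Sigma^*=M\,\Sigma_m\,M^\top$ for a $12\times 12$ covariance matrix $\Sigma_m$ of moments and a $2\times 12$ matrix $M=BA$ arising from the delta method, given as follows. Put $e_{kl}=\mathbb{E}[\breve X^k\breve Y^l]$ and $c_{kl,sr}=\mathrm{Cov}(\breve X^k\breve Y^l,\breve X^s\breve Y^r)$. The matrix $\Sigma_m=(c_{kl,sr})$ has $kl$ and $sr$ ranging, in this order, through $10,01,20,02,11,30,03,21,12,40,04,22$; $$A=\begin{pmatrix} 0&0&1&0&0&0&0&0&0&0&0&0\\ 0&0&0&1&0&0&0&0&0&0&0&0\\ 0&0&0&0&1&0&0&0&0&0&0&0\\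 -4e_{30}&0&-2e_{40}&0&0&0&0&0&0&1&0&0\\ 0&-4e_{03}&0&-2e_{04}&0&0&0&0&0&0&1&0\\ -2e_{12}&-2e_{21}&-e_{22}&-e_{22}&0&0&0&0&0&0&0&1 \end{pmatrix},$$ $$B=\begin{pmatrix} -\frac{\rho_{l1}}{2}&-\frac{\rho_{l1}}{2}&1&0&0&0\\ 0&0&0&-\frac{\rho_{l2}}{2(e_{40}-1)}&-\frac{\rho_{l2}}{2(e_{04}-1)}&\frac{1}{((e_{40}-1)(e_{04}-1))^{1/2}} \end{pmatrix}.$$
   Context: $\rho_{\mathrm{Pear}}(S,T)=\mathrm{Cov}(S,T)/(\mathrm{sd}(S)\,\mathrm{sd}(T))$ is the Pearson correlation coefficient, and $\mathrm{sd}$ denotes the standard deviation. Estimators: $\widehat{\rho_{l1}}$ is the sample (Pearson) correlation of $(X_1,Y_1),\ldots,(X_n,Y_n)$, i.e. $\widehat{\rho_{l1}}=s_{xy}/(s_xs_y)$ with $\bar X=\frac1n\sum_i X_i$, $\bar Y=\frac1n\sum_i Y_i$, $s_{xy}=\frac1n\sum_i X_iY_i-\bar X\bar Y$, $s_x^2=\frac1n\sum_i X_i^2-\bar X^2$, $s_y^2=\frac1n\sum_i Y_i^2-\bar Y^2$. $\widehat{\rho_{l2}}$ is the sample correlation of the squares of the empirically standardized observations: with $\breve X_i=(X_i-\bar X)/s_x$, $\breve Y_i=(Y_i-\bar Y)/s_y$ and $\breve m_{kl}=\frac1n\sum_{i=1}^n\breve X_i^k\breve Y_i^l$, $$\widehat{\rho_{l2}}=\frac{\breve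 m_{22}-1}{\big((\breve m_{40}-1)(\breve m_{04}-1)\big)^{1/2}}.$$
   Formalization: The formal theorem also assumes that the squares of the standardized X and Y are not almost surely constant; otherwise (e.g. X = ±1 with probability 1/2 each) ρ_l2, the matrix B and Σ* are undefined because e_40 − 1 or e_04 − 1 is zero. *)

(* Defs.v *)
From HB Require Import structures.
From mathcomp Require Import all_boot all_order all_algebra finmap.
From mathcomp Require Import all_classical all_reals all_analysis.

Set Implicit Arguments.
Unset Strict Implicit.
Unset Printing Implicit Defensive.

Import Order.TTheory GRing.Theory Num.Theory.
Import numFieldNormedType.Exports.

Local Open Scope classical_set_scope.
Local Open Scope ring_scope.

Section moments.
Context {d} {T : measurableType d} {R : realType} (P : probability T R).
Implicit Types X Y : T -> R.

Definition ae_constant X : Prop := exists c : R, {ae P, forall w, X w = c}.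

(* [fine] sends infinite expectations to 0; mean, cov and sd carry their usual
   meaning when the moments involved are finite. *)
Definition mean X : R := fine 'E_P[X].

Definition cov X Y : R := fine (covariance P X Y).

Definition sd X : R := Num.sqrt (fine 'V_P[X]).

(* The coefficient is undefined when sd X = 0 or sd Y = 0; because x / 0 = 0,
   the value is then 0. *)
Definition pearson X Y : R := cov X Y / (sd X * sd Y).

Definition standardize X : T -> R := fun w => (X w - mean X) / sd X.

Definition std_monomial X Y (k l : nat) : T -> R :=
  fun w => standardize X w ^+ k * standardize Y w ^+ l.

Definition std_moment X Y (k l : nat) : R := mean (std_monomial X Y k l).

Definition rho_l1 X Y : R := pearson X Y.

Definition rho_l2 X Y : R :=
  pearson (fun w => standardize X w ^+ 2) (fun w => standardize Y w ^+ 2).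

End moments.

(* The sample of size n is x 0, ..., x n.-1; all divisions by a zero sample
   standard deviation (or by n = 0) give 0. *)
Section estimators.
Context {R : realType} (n : nat).
Implicit Types x y : nat -> R.

Definition smean x : R := n%:R^-1 * \sum_(i < n) x i.

Definition scov x y : R := smean (fun i => x i * y i) - smean x * smean y.

Definition ssd x : R := Num.sqrt (smean (fun i => x i ^+ 2) - smean x ^+ 2).

Definition sstandardize x : nat -> R := fun i => (x i - smean x) / ssd x.

Definition sstd_moment x y (k l : nat) : R :=
  smean (fun i => sstandardize x i ^+ k * sstandardize y i ^+ l).

Definition rho_l1_hat x y : R := scov x y / (ssd x * ssd y).

Definition rho_l2_hat x y : R :=
  (sstd_moment x y 2 2 - 1) /
  Num.sqrt ((sstd_moment x y 4 0 - 1) * (sstd_moment x y 0 4 - 1)).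

End estimators.

Section asymptotic_covariance.
Context {d} {T : measurableType d} {R : realType} (P : probability T R).
Variables X Y : T -> R.

Definition mx_of_rows (m n : nat) (s : seq (seq R)) : 'M[R]_(m, n) :=
  \matrix_(i < m, j < n) nth 0 (nth [::] s i) j.

Definition moment_index (i : 'I_12) : nat * nat :=
  nth (0, 0)%N
    [:: (1, 0); (0, 1); (2, 0); (0, 2); (1, 1); (3, 0); (0, 3); (2, 1); (1, 2);
        (4, 0); (0, 4); (2, 2)]%N i.

Definition Sigma_m : 'M[R]_12 :=
  \matrix_(i, j)
    cov P (std_monomial P X Y (moment_index i).1 (moment_index i).2)
          (std_monomial P X Y (moment_index j).1 (moment_index j).2).

Local Notation e := (std_moment P X Y).

Definition mxA : 'M[R]_(6, 12) := mx_of_rows 6 12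
  [:: [:: 0; 0; 1; 0; 0; 0; 0; 0; 0; 0; 0; 0];
      [:: 0; 0; 0; 1; 0; 0; 0; 0; 0; 0; 0; 0];
      [:: 0; 0; 0; 0; 1; 0; 0; 0; 0; 0; 0; 0];
      [:: - 4 * e 3 0; 0; - 2 * e 4 0; 0; 0; 0; 0; 0; 0; 1; 0; 0];
      [:: 0; - 4 * e 0 3; 0; - 2 * e 0 4; 0; 0; 0; 0; 0; 0; 1; 0];
      [:: - 2 * e 1 2; - 2 * e 2 1; - e 2 2; - e 2 2; 0; 0; 0; 0; 0; 0; 0; 1]].

Definition mxB : 'M[R]_(2, 6) := mx_of_rows 2 6
  [:: [:: - (rho_l1 P X Y / 2); - (rho_l1 P X Y / 2); 1; 0; 0; 0];
      [:: 0; 0; 0;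
          - (rho_l2 P X Y / (2 * (e 4 0 - 1)));
          - (rho_l2 P X Y / (2 * (e 0 4 - 1)));
          1 / Num.sqrt ((e 4 0 - 1) * (e 0 4 - 1))]].

Definition mxM : 'M[R]_(2, 12) := mxB *m mxA.

Definition Sigma_star : 'M[R]_2 := mxM *m Sigma_m *m mxM^T.

End asymptotic_covariance.

Section random_vectors.
Context {d d'} {T : measurableType d} {T' : measurableType d'} {R : realType}.

Definition mutually_independent (P : probability T R) (Z : nat -> T -> T') : Prop :=
  forall (J : {fset nat}) (B : nat -> set T'),
    (forall i, measurable (B i)) ->
    P (\bigcap_(i in [set` J]) (Z i @^-1` B i)) =
      (\prod_(i <- J) P (Z i @^-1` B i))%E.

Definition iid_copies {d0} {T0 : measurableType d0} (P0 : probability T0 R)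
    (Z0 : T0 -> T') (P : probability T R) (Z : nat -> T -> T') : Prop :=
  mutually_independent P Z /\
  forall (i : nat) (B : set T'), measurable B ->
    pushforward P (Z i) B = pushforward P0 Z0 B.

End random_vectors.

Definition cvg_in_distribution2 {d} {T : measurableType d} {R : realType}
    (P : probability T R) (Z : nat -> T -> R * R)
    (nu : probability (R * R)%type R) : Prop :=
  forall f : R * R -> R, continuous f -> (exists M : R, forall x, `|f x| <= M) ->
    'E_P[fun w => f (Z n w)]%E @[n --> \oo] --> (\int[nu]_x (f x)%:E)%E.

(* nu is the law of m + L (U, V)^T, with U, V independent standard normal and
   L L^T = Sigma; in particular Sigma may be singular. *)
Definition is_normal2 {R : realType} (m : 'cV[R]_2) (Sigma : 'M[R]_2)
    (nu : probability (R * R)%type R) : Prop :=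
  exists2 L : 'M[R]_2, L *m L^T = Sigma &
    forall B : set (R * R)%type, measurable B ->
      nu B = (normal_prob 0 1 \x normal_prob 0 1)%E
        [set z | B (m 0 0 + L 0 0 * z.1 + L 0 1 * z.2,
                    m 1 0 + L 1 0 * z.1 + L 1 1 * z.2)].

(* Main.v *)
(* The estimators do not change when the observations are standardized by the
   true means and standard deviations, so they are smooth functions of the
   empirical moments of the standardized pair.  The delta method is an algebra
   of expansions [A_n = a + alpha_n / sqrt n + o_P(1 / sqrt n)] with tight
   [alpha_n]: it is stable under sums, products and smooth functions, and gives
   both errors as the linear forms [M] in the twelve normalized centered moments,
   up to [o_P(1)].  For a fixed linear combination of these, which is a normalized
   sum of i.i.d. centered square integrable variables, [E cos (S_n / sqrt n + c)]
   tends to [exp (- s2 / 2) cos c], by independence and second order Taylor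
   expansion; the Gaussian value of this integral comes from Stein's identity.
   Convergence for trigonometric polynomials extends to bounded continuous
   functions: by tightness it is enough to approximate uniformly on a box
   with a bounded trigonometric polynomial, and Bernstein polynomials in
   [(1 + sin (x / K)) / 2] do this. *)
Require Import Defs.
From mathcomp Require Import all_boot all_order all_algebra finmap.
From mathcomp Require Import all_classical all_reals all_analysis.
From mathcomp Require Import measurable_realfun.
From mathcomp Require Import ring lra.

Set Implicit Arguments.
Unset Strict Implicit.
Unset Printing Implicit Defensive.

Import Order.TTheory GRing.Theory Num.Theory.
Import numFieldNormedType.Exports.

Local Open Scope classical_set_scope.
Local Open Scope ring_scope.

(** * Trigonometric inequalities *)

Section trig_inequalities.
Context {R : realType}.
Implicit Types x a b : R.

(** Several obstacles shape the development. A cosine with arbitrary phase [c] carries both the real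
    and the imaginary part of a characteristic function, and cosines of [t1 * z.1 + t2 * z.2 + c]
    reduce joint convergence to one-dimensional sums. The summands have only second moments, since
    eighth moments of the data are second moments of monomials of degree four; so the Taylor
    remainder is kept as the minimum of a square and a cube, and dominated convergence replaces a
    third moment. The estimators contain quotients and roots with default values at degenerate
    samples; their measurability is never established, and integrals of bounded functions of them
    are compared by monotonicity of the integral alone. The limit law has to be exhibited: it is the
    image of a product of standard normal laws under a triangular root of [Sigma_star], which may be
    singular. Non-constancy of the squared standardized variables enters as positivity of
    [e 4 0 - 1] and [e 0 4 - 1], which makes root and quotient differentiable at the limit. *)

Lemma increment_le (f df : R -> R) (m x : R) : 0 <= x ->
  (forall y, is_derive y (1 : R) f (df y)) ->
  (forall y, 0 <= y -> y <= x -> `|df y| <= m) -> `|f x - f 0| <= m * x.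
Proof.
move=> x0 fdf dfm; have [|c] := @MVT_segment _ f df 0 x x0.
  by apply: derivable_within_continuous => y _; exact: ex_derive.
rewrite in_itv/= => /andP[c0 cx] ->.
by rewrite normrM subr0 (ger0_norm x0) ler_wpM2r// dfm.
Qed.

Lemma sin_abs_le x : `|sin x| <= `|x|.
Proof.
wlog x0 : x / 0 <= x.
  move=> H; have [/H//|x0] := lerP 0 x.
  by rewrite -normrN -sinN -(normrN x) H// oppr_ge0 ltW.
rewrite (ger0_norm x0) -[leRHS]mul1r -[sin x]subr0 -sin0.
by apply: increment_le => // y _ _; exact: cos_max.
Qed.

Lemma cos_half x : 1 - cos x = 2 * sin (x / 2) ^+ 2.
Proof.
rewrite {1}(_ : x = (x / 2) *+ 2); last by rewrite -mulr_natr divfK.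
by rewrite cos_mulr2n sin2cos2; ring.
Qed.

Lemma cos_sub1_le x : `|cos x - 1| <= x ^+ 2 / 2.
Proof.
rewrite distrC cos_half ger0_norm; last by rewrite mulr_ge0// sqr_ge0.
have := sin_abs_le (x / 2); rewrite -(@ler_sqr _ _ `|x/2|) ?nnegrE//.
by rewrite !real_normK ?num_real// exprMn exprVn; lra.
Qed.

(** Each bound of this chain is the mean value estimate applied to the previous one, so the constant
    1/2 is inherited from [cos_sub1_le] in place of the sharp 1/6. *)
Lemma sin_sub_id_le3 x : `|sin x - x| <= `|x| ^+ 3 / 2.
Proof.
wlog x0 : x / 0 <= x.
  move=> H; have [/H//|x0] := lerP 0 x.
  have -> : sin x - x = - (sin (- x) - (- x)) by rewrite sinN; ring.
  by rewrite normrN -(normrN x) H// oppr_ge0 ltW.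
rewrite (ger0_norm x0) (_ : x ^+ 3 / 2 = (x ^+ 2 / 2) * x); last by ring.
rewrite (_ : sin x - x = (sin x - x) - (sin 0 - 0)); last by rewrite sin0; ring.
apply: (@increment_le (fun y => sin y - y) (fun y => cos y - 1)) => // y y0 yx.
by rewrite (le_trans (cos_sub1_le y))// ler_pM2r// ler_sqr.
Qed.

(** The two bounds feed the minimum that stands in for a third moment in the limit theorem. *)
Lemma sin_sub_id_le x :
  `|sin x - x| <= x ^+ 2 /\ `|sin x - x| <= `|x| ^+ 3.
Proof.
have x3 := sin_sub_id_le3 x; have x0 : 0 <= `|x| ^+ 3 by rewrite exprn_ge0.
split; last lra.
have : `|sin x - x| <= 2 * `|x|.
  by rewrite (le_trans (ler_normB _ _))//; have := sin_abs_le x; lra.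
rewrite -(real_normK (num_real x)).
move: x3; set s := `|sin x - x|; set a := `|x| => x3 x1.
have a0 : 0 <= a by rewrite normr_ge0.
have s0 : 0 <= s by rewrite normr_ge0.
(* The quadratic bound is a geometric mean: [s] is at most [a ^+ 3 / 2] and at most [2 * a], and
   these multiply to [a ^+ 4]. *)
rewrite -(@ler_sqr _ s) ?nnegrE ?exprn_ge0// expr2.
by rewrite (le_trans (ler_pM s0 s0 x3 x1))//; rewrite le_eqVlt; apply/orP; left; apply/eqP; field.
Qed.

Lemma cos_taylor2_le4 x : `|cos x - 1 + x ^+ 2 / 2| <= x ^+ 4 / 2.
Proof.
wlog x0 : x / 0 <= x.
  move=> H; have [/H//|x0] := lerP 0 x.
  by rewrite -cosN -(sqrrN x) (_ : x ^+ 4 = (- x) ^+ 4) ?H ?oppr_ge0 ?ltW//; ring.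
rewrite (_ : x ^+ 4 / 2 = (x ^+ 3 / 2) * x); last by ring.
rewrite (_ : cos x - 1 + x ^+ 2 / 2 = (cos x - 1 + x ^+ 2 / 2) - (cos 0 - 1 + 0 ^+ 2 / 2)); last first.
  by rewrite cos0; ring.
apply: (@increment_le (fun y => cos y - 1 + y ^+ 2 / 2) (fun y => y - sin y)) => //.
  move=> y; apply: is_derive_eq; rewrite !scaler1 /GRing.scale/=.
  by field.
move=> y y0 yx; rewrite distrC (le_trans (sin_sub_id_le3 y))// ler_pM2r//.
by rewrite ger0_norm// lerXn2r.
Qed.

Lemma cos_taylor2_le x : `|cos x - 1 + x ^+ 2 / 2| <= x ^+ 2 /\
  `|cos x - 1 + x ^+ 2 / 2| <= `|x| ^+ 3.
Proof.
have x2 : `|cos x - 1 + x ^+ 2 / 2| <= x ^+ 2.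
  rewrite (le_trans (ler_normD _ _))//.
  have := cos_sub1_le x; rewrite (@ger0_norm _ (_ ^+ 2 / 2)).
    lra.
  by rewrite mulr_ge0// sqr_ge0.
(* From 1 on the quadratic bound lies below the cube; below 1 the quartic bound does. *)
split=> //; have [x1|x1] := lerP 1 `|x|.
  by rewrite (le_trans x2)// -(real_normK (num_real x)) ler_weXn2l.
rewrite (le_trans (cos_taylor2_le4 x))// (_ : x ^+ 4 = `|x| ^+ 4).
  have : `|x| ^+ 4 <= `|x| ^+ 3 by rewrite ler_wiXn2l// ltW.
  have : 0 <= `|x| ^+ 3 by rewrite exprn_ge0.
  have : 0 <= `|x| ^+ 4 by rewrite exprn_ge0.
  lra.
by rewrite (_ : 4 = 2 * 2)%N// !exprM real_normK// num_real.
Qed.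

(** The addition formula leaves only [cos b - 1] and [sin b - b], both quadratic in [b]. An error
    that is uniform in [a] allows differentiation under the Gaussian integral. *)
Lemma cos_increment_le a b : `|cos (a + b) - cos a + b * sin a| <= 2 * b ^+ 2.
Proof.
rewrite cosD (_ : _ - _ + _ = cos a * (cos b - 1) - sin a * (sin b - b)); last by ring.
rewrite (le_trans (ler_normB _ _))// !normrM.
have := cos_sub1_le b; have [+ _] := sin_sub_id_le b.
move: (cos_max a) (sin_max a) => ca sa sb cb.
have : `|cos a| * `|cos b - 1| <= 1 * (b ^+ 2 / 2) by exact: ler_pM.
have : `|sin a| * `|sin b - b| <= 1 * (b ^+ 2) by exact: ler_pM.
by have := sqr_ge0 b; lra.
Qed.

End trig_inequalities.

(** * Integration *)

Section integral_transfer.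
Context {d} {T' : measurableType d} {R : realType}.

Import HBNNSimple.

(** The simple functions [nnsfun_approx] depend on [g] alone. After monotone convergence and
    linearity, the right-hand side knows [mu], [phi] and [w] only through weighted integrals of
    indicators. *)
Lemma ge0_integral_comp_lim {d1} {T1 : measurableType d1}
    (mu : {measure set T1 -> \bar R}) (phi : T1 -> T') (w : T1 -> R) (g : T' -> R)
    (mg : measurable_fun setT (EFin \o g)) :
  measurable_fun setT phi -> measurable_fun setT w ->
  (forall x, 0 <= w x) -> (forall y, 0 <= g y) ->
  (\int[mu]_x (g (phi x) * w x)%:E =
   limn (fun n => \sum_(r \in range (nnsfun_approx measurableT mg n))
     r%:E * \int[mu]_x
       (\1_(nnsfun_approx measurableT mg n @^-1` [set r]) (phi x) * w x)%:E))%E.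
Proof.
move=> mphi mw w0 g0; set g_ := nnsfun_approx _ _.
have mind n r : measurable_fun setT (fun x => \1_(g_ n @^-1` [set r]) (phi x) * w x).
  by apply: measurable_funM => //; exact: measurableT_comp.
transitivity (limn (fun n => (\int[mu]_x (g_ n (phi x) * w x)%:E)%E)).
  rewrite -monotone_convergence//.
  - apply: eq_integral => x _; apply/esym/cvg_lim => //.
    rewrite EFinM; under eq_fun do rewrite EFinM.
    by apply: cvgeZr => //; apply: cvg_nnsfun_approx => // y _; rewrite lee_fin.
  - by move=> n; apply/measurable_EFinP/measurable_funM => //; exact: measurableT_comp.
  - by move=> n x _; rewrite lee_fin mulr_ge0.
  - move=> x _ m n mn; rewrite lee_fin ler_wpM2r//.
    exact/lefP/nd_nnsfun_approx.
congr (limn _); apply/funext => n.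
transitivity (\int[mu]_x (\sum_(r \in range (g_ n))
    (r * (\1_(g_ n @^-1` [set r]) (phi x) * w x))%:E))%E.
  apply: eq_integral => x _; rewrite fsumEFin//; congr EFin.
  by rewrite fimfunE mulr_fsuml//; apply: eq_fsbigr => r _; rewrite mulrA.
rewrite ge0_integral_fsum//; last 2 first.
- by move=> r; apply/measurable_EFinP/measurable_funM.
- move=> r x _; rewrite mulrA lee_fin mulr_ge0//.
  by have := nnfun_muleindic_ge0 (g_ n) r (phi x); rewrite -EFinM lee_fin.
apply: eq_fsbigr => r /[!inE] -[y _ gy].
under eq_integral do rewrite EFinM.
rewrite ge0_integralZl_EFin//; last by rewrite -gy.
- by move=> x _; rewrite lee_fin mulr_ge0.
- exact/measurable_EFinP.
Qed.

(** One principle with three uses: with a density as weight it evaluates Gaussian integrals, with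
    weight 1 it transfers integrals between equal laws, and with the remaining factors as weight it
    extends independence from events to functions. *)
Lemma ge0_integral_transfer {d1 d2} {T1 : measurableType d1} {T2 : measurableType d2}
    (mu1 : {measure set T1 -> \bar R}) (mu2 : {measure set T2 -> \bar R})
    (phi1 : T1 -> T') (phi2 : T2 -> T') (w1 : T1 -> R) (w2 : T2 -> R) (g : T' -> R) :
  measurable_fun setT phi1 -> measurable_fun setT phi2 ->
  measurable_fun setT w1 -> measurable_fun setT w2 ->
  (forall x, 0 <= w1 x) -> (forall x, 0 <= w2 x) ->
  (forall B, measurable B -> \int[mu1]_x (\1_B (phi1 x) * w1 x)%:E =
                             \int[mu2]_x (\1_B (phi2 x) * w2 x)%:E)%E ->
  measurable_fun setT g -> (forall y, 0 <= g y) ->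
  (\int[mu1]_x (g (phi1 x) * w1 x)%:E = \int[mu2]_x (g (phi2 x) * w2 x)%:E)%E.
Proof.
move=> mphi1 mphi2 mw1 mw2 w10 w20 H /measurable_EFinP mg g0.
rewrite !(ge0_integral_comp_lim _ mg)//; congr (limn _); apply/funext => n.
by apply: eq_fsbigr => r _; rewrite H.
Qed.

End integral_transfer.

Notation L1 mu f := (mu.-integrable setT (EFin \o f)).

Section integrable_real.
Context {d} {T : measurableType d} {R : realType} (mu : {measure set T -> \bar R}).
Implicit Types f g : T -> R.

Lemma L1_measurable f : L1 mu f -> measurable_fun setT f.
Proof. by case/integrableP => /measurable_EFinP. Qed.

Lemma L1_le f g : measurable_fun setT f -> (forall x, `|f x| <= g x) ->
  L1 mu g -> L1 mu f.
Proof.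
move=> mf fg; apply: le_integrable => //; first exact/measurable_EFinP.
by move=> x _ /=; rewrite lee_fin (le_trans (fg x))// ler_norm.
Qed.

Lemma L1D f g : L1 mu f -> L1 mu g -> L1 mu (fun x => f x + g x).
Proof. exact: integrableD. Qed.

Lemma L1B f g : L1 mu f -> L1 mu g -> L1 mu (fun x => f x - g x).
Proof. exact: integrableB. Qed.

Lemma L1Z f (a : R) : L1 mu f -> L1 mu (fun x => a * f x).
Proof. exact: integrableZl. Qed.

Lemma L1_norm f : L1 mu f -> L1 mu (fun x => `|f x|).
Proof. exact: integrable_norm. Qed.

Lemma L1_sum I (s : seq I) (f : I -> T -> R) :
  (forall i, L1 mu (f i)) -> L1 mu (fun x => \sum_(i <- s) f i x).
Proof.
move=> f1; rewrite (_ : _ \o _ = fun x => (\sum_(i <- s) (f i x)%:E)%E).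
  by apply: integrable_sum => // i _; exact: f1.
by apply/funext => x; rewrite /= sumEFin.
Qed.

Lemma Rintegral_sum I (s : seq I) (f : I -> T -> R) :
  (forall i, L1 mu (f i)) ->
  \int[mu]_x (\sum_(i <- s) f i x) = \sum_(i <- s) \int[mu]_x f i x.
Proof.
move=> f1; elim: s => [|i s IHs].
  rewrite big_nil; under eq_Rintegral do rewrite big_nil.
  by rewrite /Rintegral integral0.
under eq_Rintegral do rewrite big_cons.
by rewrite RintegralD ?big_cons ?IHs//; exact: L1_sum.
Qed.

Lemma ge0_L1 f : measurable_fun setT f -> (forall x, 0 <= f x) ->
  (\int[mu]_x (f x)%:E < +oo)%E -> L1 mu f.
Proof.
move=> mf f0 foo; apply/integrableP; split; first exact/measurable_EFinP.
by under eq_integral do rewrite /= ger0_norm//.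
Qed.

Lemma L1_EFin f : L1 mu f -> (\int[mu]_x f x)%:E = (\int[mu]_x (f x)%:E)%E.
Proof. by move=> f1; rewrite fineK//; exact: integrable_fin_num. Qed.

Lemma normr_RintegralB_le f g h : L1 mu f -> L1 mu g -> L1 mu h ->
  (forall x, `|f x - g x| <= h x) ->
  `|\int[mu]_x f x - \int[mu]_x g x| <= \int[mu]_x h x.
Proof.
move=> f1 g1 h1 fgh; rewrite -RintegralB//.
rewrite (le_trans (le_normr_Rintegral _ (L1B f1 g1)))// le_Rintegral//.
by apply: L1_norm; exact: L1B.
Qed.

End integrable_real.

Section probability_integral.
Context {d} {T : measurableType d} {R : realType} (P : probability T R).
Implicit Types f g : T -> R.

Lemma L1_cst (a : R) : L1 P (fun=> a).
Proof. exact: finite_measure_integrable_cst. Qed.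

Lemma L1_bounded f (M : R) : measurable_fun setT f ->
  (forall x, `|f x| <= M) -> L1 P f.
Proof. by move=> mf fM; apply: (L1_le mf fM); exact: L1_cst. Qed.

Lemma Rintegral_prob_cst (a : R) : \int[P]_x a = a.
Proof. by rewrite Rintegral_cst// [X in fine X](probability_setT P) mulr1. Qed.

Lemma normr_Rintegral_le f (M : R) : measurable_fun setT f ->
  (forall x, `|f x| <= M) -> `|\int[P]_x f x| <= M.
Proof.
move=> mf fM; have f1 := L1_bounded mf fM.
rewrite (le_trans (le_normr_Rintegral _ f1))// -[leRHS]Rintegral_prob_cst.
by rewrite le_Rintegral//; [exact: L1_norm|exact: L1_cst].
Qed.

End probability_integral.

Lemma is_derive_quadratic {R : realType} (f : R -> R) (t a K : R) :
  (forall h, `|f (h + t) - f t - h * a| <= K * h ^+ 2) -> is_derive t (1 : R) f a.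
Proof.
move=> fK.
have H : (fun h : R => h^-1 *: ((f \o shift t) (h *: (1 : R)) - f t)) @ 0^' --> a.
  apply/cvgrPdist_le => e e0; near=> h.
  have h0 : h != 0 by near: h; exact: nbhs_dnbhs_neq.
  rewrite /= /GRing.scale/= mulr1 -(ler_pM2l (_ : 0 < `|h|)) ?normr_gt0//.
  rewrite -normrM mulrBr mulVKf// distrC (le_trans (fK h))//.
  rewrite -real_normK ?num_real// expr2 mulrCA ler_pM2l ?normr_gt0//.
  rewrite (le_trans (ler_norm _))// normrM normr_id.
  have : `|h| <= e / (`|K| + 1).
    near: h; apply: dnbhs0_le; exact: divr_gt0.
  rewrite ler_pdivlMr ?ltr_wpDl// => he; rewrite (le_trans _ he)// mulrC.
  by rewrite ler_wpM2l// lerDl.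
apply: DeriveDef; first exact: cvgP H.
exact/cvg_lim.
Unshelve. all: by end_near. Qed.

(** * Gaussian integrals *)

Section gaussian.
Context {R : realType}.
Local Notation mu := (@lebesgue_measure R).
Local Notation N01 := (normal_prob (0 : R) 1).
Local Notation p := (normal_pdf (0 : R) 1).

Lemma ge0_integral_normal (g : R -> R) : measurable_fun setT g ->
  (forall x, 0 <= g x) ->
  (\int[N01]_x (g x)%:E = \int[mu]_x (g x * p x)%:E)%E.
Proof.
move=> mg g0.
transitivity (\int[N01]_x (g x * cst (1 : R) x)%:E)%E.
  by apply: eq_integral => x _; rewrite /= mulr1.
apply: (@ge0_integral_transfer _ _ _ _ _ _ _ N01 mu id id) => //.
- exact: measurable_normal_pdf.
- by move=> x; exact: normal_pdf_ge0.
move=> B mB; under eq_integral do rewrite /= mulr1.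
rewrite integral_indic// setIT /= /normal_prob integral_mkcond.
apply: eq_integral => x _; rewrite /patch indicE.
by case: ifPn => _; rewrite ?mul1r ?mul0r.
Qed.

Lemma measurable_trig (t c : R) : measurable_fun setT (fun x : R => cos (t * x + c)) /\
  measurable_fun setT (fun x : R => sin (t * x + c)).
Proof.
have m : measurable_fun setT (fun x : R => t * x + c).
  by apply: measurable_funD => //; exact: measurable_funM.
split; apply: measurableT_comp => //.
- by apply: continuous_measurable_fun; exact: continuous_cos.
- by apply: continuous_measurable_fun; exact: continuous_sin.
Qed.

Lemma normal_pdf01E (x : R) : p x = normal_peak 1 * expR (- x ^+ 2 / 2).
Proof. by rewrite normal_pdfE ?oner_eq0// /normal_fun subr0 expr1n. Qed.

Lemma mul_expRN_le1 (y : R) : y * expR (- y) <= 1.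
Proof.
rewrite expRN ler_pdivrMr ?expR_gt0// mul1r (le_trans _ (expR_ge1Dx y))//.
by rewrite lerDr.
Qed.

Lemma measurable_sqr : measurable_fun setT (fun x : R => x ^+ 2).
Proof. exact: measurable_funX. Qed.

Lemma L1_normal_sqr : L1 N01 (fun x => x ^+ 2).
Proof.
have s2 : Num.sqrt 2 != 0 :> R by rewrite sqrtr_eq0 -ltNge.
(* With [y = x ^+ 2 / 4], the product of [x ^+ 2] and [expR (- x ^+ 2 / 2)] is
   [4 * y * expR (- y) * expR (- y)]. By [mul_expRN_le1] it is at most [4 * expR (- y)], up to
   normalization the density of variance 2; the ratio of the peaks adjusts the normalization. *)
pose C : R := 4 * (normal_peak 1 / normal_peak (Num.sqrt 2)).
apply: ge0_L1 => //; first by move=> x; exact: sqr_ge0.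
rewrite ge0_integral_normal//; last by move=> x; exact: sqr_ge0.
have C0 : 0 <= C by rewrite mulr_ge0// mulr_ge0 ?invr_ge0 ?normal_peak_ge0.
apply: (@le_lt_trans _ _ (\int[mu]_x (C%:E * (normal_pdf 0 (Num.sqrt 2) x)%:E)))%E.
  apply: ge0_le_integral => //.
  - by move=> x _; rewrite lee_fin mulr_ge0 ?sqr_ge0// normal_pdf_ge0.
  - apply/measurable_EFinP/measurable_funM; first exact: measurable_sqr.
    exact: measurable_normal_pdf.
  - apply/measurable_EFinP; apply: (@measurable_funM _ _ _ _ (fun=> C)) => //.
    exact: measurable_normal_pdf.
  move=> x _; rewrite -EFinM lee_fin normal_pdf01E normal_pdfE//.
  rewrite /normal_fun subr0 sqr_sqrtr// /C.
  have -> : 4 * (normal_peak 1 / normal_peak (Num.sqrt 2)) *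
    (normal_peak (Num.sqrt 2) * expR (- x ^+ 2 / (2 *+ 2))) =
    normal_peak 1 * (4 * expR (- x ^+ 2 / 4)).
    rewrite (_ : 2 *+ 2 = 4 :> R); last by rewrite -mulrnA.
    by field; rewrite gt_eqF// normal_peak_gt0.
  rewrite mulrCA ler_wpM2l ?normal_peak_ge0//.
  have -> : - x ^+ 2 / 2 = - (x ^+ 2 / 4) + - x ^+ 2 / 4 by lra.
  rewrite expRD mulrA ler_wpM2r ?expR_ge0//.
  by have := mul_expRN_le1 (x ^+ 2 / 4); lra.
rewrite ge0_integralZl_EFin//.
- by rewrite integral_normal_pdf mule1 ltry.
- by move=> x _; rewrite lee_fin normal_pdf_ge0.
- by apply/measurable_EFinP; exact: measurable_normal_pdf.
Qed.

Lemma Rintegral_normal (g : R -> R) : L1 N01 g ->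
  L1 mu (fun x => g x * p x) /\ \int[N01]_x g x = \int[mu]_x (g x * p x).
Proof.
move=> g1; have mg := L1_measurable g1.
have nonneg (h : R -> R) : L1 N01 h -> (forall x, 0 <= h x) ->
    L1 mu (fun x => h x * p x) /\ \int[N01]_x h x = \int[mu]_x (h x * p x).
  move=> h1 h0; have mh := L1_measurable h1.
  have hE := ge0_integral_normal mh h0.
  split; last by rewrite /Rintegral hE.
  apply: ge0_L1.
  - by apply: measurable_funM => //; exact: measurable_normal_pdf.
  - by move=> x; rewrite mulr_ge0// normal_pdf_ge0.
  - by rewrite -hE -L1_EFin// ltry.
have [||L2 I2] := nonneg (fun x => `|g x|).
- exact: L1_norm.
- by move=> x; exact: normr_ge0.
(* [g] is the difference of the non-negative functions [g + |g|] and [|g|]; the same splitting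
   reappears for equal laws and for independence. *)
have [||L3 I3] := nonneg (fun x => g x + `|g x|).
- by apply: L1D => //; exact: L1_norm.
- by move=> x; have := ler_norm (- g x); rewrite normrN; lra.
have gE x : g x * p x = (g x + `|g x|) * p x - `|g x| * p x by ring.
split; first by under eq_fun do rewrite gE; exact: L1B.
under [RHS]eq_Rintegral do rewrite gE.
rewrite RintegralB// -I2 -I3 -RintegralB//.
- by apply: eq_Rintegral => x _; rewrite addrK.
- by apply: L1D => //; exact: L1_norm.
- exact: L1_norm.
Qed.

Lemma normal_tail (n : nat) : p n.+1%:R <= normal_peak 1 / n.+1%:R /\
  p (- n.+1%:R) <= normal_peak 1 / n.+1%:R.
Proof.
rewrite !normal_pdf01E sqrrN; suff H : expR (- (n.+1%:R : R) ^+ 2 / 2) <= n.+1%:R^-1.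
  by split; rewrite ler_wpM2l// normal_peak_ge0.
rewrite mulNr expRN lef_pV2 ?posrE ?expR_gt0 ?ltr0n//.
rewrite (le_trans _ (expR_ge1Dx _))//.
have := sqr_ge0 (n.+1%:R - 1 : R); lra.
Qed.

(** Stein's operator [x f(x) - f'(x)] applied to the function [f] sending [x] to [sin (t * x + c)].
    Times the normal density [p] it is the derivative of [- f p], because [p' = - x p]. *)
Definition stein_fun (t c x : R) := x * sin (t * x + c) - t * cos (t * x + c).

Lemma stein_is_derive (t c x : R) :
  is_derive x (1 : R) (fun x => - (sin (t * x + c) * p x)) (stein_fun t c x * p x).
Proof.
rewrite (_ : (fun x => _) = (fun x => - (normal_peak 1 * (sin (t * x + c) *
  expR (- x ^+ 2 / 2))))); last first.
  by apply/funext => y; rewrite normal_pdf01E mulrCA.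
rewrite normal_pdf01E /stein_fun.
apply: is_derive_eq; rewrite /GRing.scale/=.
by field.
Qed.

Lemma L1_stein (t c : R) : L1 N01 (stein_fun t c).
Proof.
have [mc ms] := measurable_trig t c.
refine (@L1_le _ _ _ N01 (stein_fun t c) (fun x => (1 + `|t|) + x ^+ 2) _ _ _).
- by apply: measurable_funB; apply: measurable_funM.
- move=> x; rewrite (le_trans (ler_normB _ _))// !normrM.
  have : `|x| * `|sin (t * x + c)| <= `|x| * 1 by rewrite ler_wpM2l// sin_max.
  have : `|t| * `|cos (t * x + c)| <= `|t| * 1 by rewrite ler_wpM2l// cos_max.
  rewrite -(real_normK (num_real x)); have := sqr_ge0 (`|x| - 1); nra.
- by apply: L1D; [exact: L1_cst|exact: L1_normal_sqr].
Qed.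

(** By the fundamental theorem of calculus only the two boundary values remain, and [normal_tail]
    bounds each of them. *)
Lemma stein_truncated (t c : R) (n : nat) :
  `|\int[mu]_(x in `[- n.+1%:R, n.+1%:R]) (stein_fun t c x * p x)| <=
  2 * normal_peak 1 / n.+1%:R.
Proof.
pose F (x : R) := - (sin (t * x + c) * p x).
have dF (x : R) : derivable F x 1 by have [] := stein_is_derive t c x.
have cF (x : R) : {for x, continuous F}.
  exact/differentiable_continuous/derivable1_diffP.
have csin : continuous (fun x : R => sin (t * x + c)).
  move=> x; apply: (@continuous_comp _ _ _ (fun x : R => t * x + c) sin).
    apply: cvgD; last exact: cvg_cst.
    by apply: cvgM; [exact: cvg_cst|exact: cvg_id].
  exact: continuous_sin.
have ccos : continuous (fun x : R => cos (t * x + c)).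
  move=> x; apply: (@continuous_comp _ _ _ (fun x : R => t * x + c) cos).
    apply: cvgD; last exact: cvg_cst.
    by apply: cvgM; [exact: cvg_cst|exact: cvg_id].
  exact: continuous_cos.
have cf : continuous (fun x : R => stein_fun t c x * p x).
  move=> x; apply: cvgM; last exact: continuous_normal_pdf.
  apply: cvgB; apply: cvgM.
  - exact: cvg_id.
  - exact: csin.
  - exact: cvg_cst.
  - exact: ccos.
rewrite /Rintegral (@continuous_FTC2 _ _ F).
- have [p1 p2] := normal_tail n.
  rewrite /= /F (le_trans (ler_normB _ _))// !normrN !normrM.
  rewrite !(ger0_norm (normal_pdf_ge0 _ _ _)).
  have H (a b : R) : 0 <= b -> b <= normal_peak 1 / n.+1%:R ->
      `|sin a| * b <= normal_peak 1 / n.+1%:R.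
    by move=> b0; apply: le_trans; rewrite ler_piMl// sin_max.
  rewrite -mulrA mulr_natl mulr2n.
  by apply: lerD; apply: H => //; exact: normal_pdf_ge0.
- by rewrite (@lt_trans _ _ 0)// oppr_lt0 ltr0n.
- exact: continuous_subspaceT.
- split=> //.
  + by apply: cvg_at_right_filter; exact: cF.
  + by apply: cvg_at_left_filter; exact: cF.
- by move=> x _; rewrite derive1E; have [] := stein_is_derive t c x.
Qed.

Lemma stein_identity (t c : R) : \int[N01]_x stein_fun t c x = 0.
Proof.
have [L ->] := Rintegral_normal (L1_stein t c).
set h := fun x => _ in L *.
pose hn n := h \_ `[- n.+1%:R, n.+1%:R]%classic.
have mh : measurable_fun setT h by exact: L1_measurable L.
have [|||||_ _] := @dominated_convergence _ _ _ mu setT measurableT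
    (fun n x => (hn n x)%:E) (EFin \o h) (fun x => `|h x|%:E).
- move=> n; apply/measurable_EFinP/(measurable_restrictT _ _).1 => //.
  exact: measurable_funS mh.
- exact/measurable_EFinP.
- apply: aeW => x _; apply/cvg_EFin; first exact: nearW.
  apply: (@cvg_near_cst).
  near=> n; rewrite /= /hn patchE mem_set// /= in_itv/= -ler_norml.
  rewrite (@le_trans _ _ n%:R)//; last by rewrite ler_nat.
  by near: n; exact: nbhs_infty_ger.
- exact: L1_norm L.
- apply: aeW => x n _; rewrite lee_fin /hn patchE; case: ifP => //.
  by rewrite normr0.
move=> cv.
have cv0 : (fun n => \int[mu]_(x in `[- n.+1%:R, n.+1%:R]) h x) @ \oo --> (0 : R).
  apply/cvgr0Pnorm_le => e e0; near=> n; rewrite (le_trans (stein_truncated _ _ _))//.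
  rewrite ler_pdivrMr ?ltr0n// -ler_pdivrMl// (@le_trans _ _ n%:R)//.
    by near: n; exact: nbhs_infty_ger.
  by rewrite ler_nat.
move: cv; rewrite -(L1_EFin L) => /fine_cvg cv.
have E : fine \o [sequence (\int[mu]_x (hn n x)%:E)%E]_n =
    (fun n => \int[mu]_(x in `[- n.+1%:R, n.+1%:R]) h x).
  by apply/funext => n; rewrite Rintegral_mkcond.
by move: cv0; rewrite -E => cv0; exact: (cvg_unique _ cv cv0).
Unshelve. all: by end_near. Qed.

(** As a function of [t] the integral [phi] satisfies [phi' = - t phi]: differentiating under the
    integral produces [x sin (t x + c)], which Stein's identity turns back into [t phi]. Hence
    [phi t * expR (t ^+ 2 / 2)] keeps its value [cos c] at 0. *)
Lemma Rintegral_normal_cos (t c : R) :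
  \int[N01]_x cos (t * x + c) = expR (- t ^+ 2 / 2) * cos c.
Proof.
pose phi (t : R) := \int[N01]_x cos (t * x + c).
have L1c (s : R) : L1 N01 (fun x => cos (s * x + c)).
  refine (@L1_bounded _ _ _ N01 _ 1 _ _); first by have [] := measurable_trig s c.
  by move=> x; exact: cos_max.
have L1s (s : R) : L1 N01 (fun x => x * sin (s * x + c)).
  have -> : (fun x => x * sin (s * x + c)) =
      (fun x => stein_fun s c x + s * cos (s * x + c)).
    by apply/funext => x; rewrite /stein_fun subrK.
  apply: L1D; first exact: L1_stein.
  exact: L1Z.
have Is (s : R) : \int[N01]_x (x * sin (s * x + c)) = s * phi s.
  have := stein_identity s c; rewrite /stein_fun RintegralB//; last exact: L1Z.
  by move/eqP; rewrite subr_eq0 => /eqP ->; rewrite RintegralZl.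
have dphi (s : R) : is_derive s (1 : R) phi (- s * phi s).
  apply: (@is_derive_quadratic _ _ _ _ (2 * \int[N01]_x (x ^+ 2))) => h.
  rewrite mulNr mulrN opprK -Is -RintegralZl// -RintegralB// -RintegralD//; last 2 first.
  - exact: L1B.
  - exact: L1Z.
  rewrite [leRHS]mulrC mulrA -RintegralZl//; last exact: L1_normal_sqr.
  apply: (le_trans (le_normr_Rintegral _ _)) => //.
    by apply: L1D; [exact: L1B|exact: L1Z].
  apply: le_Rintegral => //.
  - by apply: L1_norm; apply: L1D; [exact: L1B|exact: L1Z].
  - by apply: L1Z; exact: L1_normal_sqr.
  move=> x _; have := cos_increment_le (s * x + c) (h * x).
  rewrite (_ : s * x + c + h * x = (h + s) * x + c); last by ring.
  by rewrite -(mulrA h x) (_ : h ^+ 2 * 2 * x ^+ 2 = 2 * (h * x) ^+ 2)//; ring.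
have dpsi (s : R) : is_derive s (1 : R) (fun s => phi s * expR (s ^+ 2 / 2)) 0.
  apply: is_derive_eq; rewrite /GRing.scale/=; by field.
have := @is_derive_0_is_cst _ _ t 0 dpsi.
rewrite expr0n/= mul0r expR0 mulr1 /phi.
under [X in _ = X -> _]eq_Rintegral do rewrite mul0r add0r.
rewrite (Rintegral_prob_cst N01) => /(congr1 (fun z => z * expR (- t ^+ 2 / 2))).
by rewrite -mulrA -expRD mulNr subrr expR0 mulr1 mulrC.
Qed.

End gaussian.

(** * Independence *)

Section independence.
Context {d d'} {T : measurableType d} {T' : measurableType d'} {R : realType}.
Variables (P : probability T R) (Z : nat -> T -> T').
Hypothesis mZ : forall i, measurable_fun setT (Z i).
Hypothesis indZ : mutually_independent P Z.
Implicit Types g : nat -> T' -> R.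

Definition update g (k : nat) (f : T' -> R) : nat -> T' -> R :=
  fun i => if i == k then f else g i.

Lemma prod_update g k f (n : nat) (kn : (k < n)%N) (F : nat -> (T' -> R) -> R) :
  \prod_(i < n) F i (update g k f i) =
  F k f * \prod_(i < n | i != Ordinal kn) F i (g i).
Proof.
rewrite (bigD1 (Ordinal kn))//= /update eqxx; congr (_ * _).
apply: eq_bigr => i ik; rewrite ifF//; apply: contraNF ik => /eqP ik.
exact/eqP/val_inj.
Qed.

Lemma independent_prod_indic (B : nat -> set T') (n : nat) :
  (forall i, measurable (B i)) ->
  (\int[P]_w (\prod_(i < n) \1_(B i) (Z i w))%:E =
   (\prod_(i < n) \int[P]_w \1_(B i) (Z i w))%:E)%E.
Proof.
move=> mB; pose J := seq_fset tt (iota 0 n).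
have mA i : measurable (Z i @^-1` B i) by rewrite -[X in measurable X]setTI; exact: mZ.
have J_ i : (i \in J) = (i < n)%N by rewrite seq_fsetE mem_iota/= add0n.
have big_J (S : Type) (idx : S) (op : Monoid.com_law idx) (F : nat -> S) :
    \big[op/idx]_(i <- J) F i = \big[op/idx]_(i < n) F i.
  rewrite (perm_big _ (seq_fset_perm tt (iota 0 n))) undup_id ?iota_uniq//.
  by rewrite -[n in iota 0 n]subn0 big_mkord.
transitivity (\int[P]_w (\1_(\bigcap_(i in [set` J]) (Z i @^-1` B i)) w : R)%:E)%E.
  apply: eq_integral => w _; congr EFin.
  have [H|H] := pselect ((\bigcap_(i in [set` J]) (Z i @^-1` B i)) w).
    rewrite [RHS]indicE mem_set// big1// => i _; rewrite indicE mem_set//.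
    by apply: H => /=; rewrite J_.
  rewrite [RHS]indicE memNset//.
  have [i iB] : exists i : 'I_n, ~ B i (Z i w).
    apply: contrapT => /forallNP H'; apply: H => i /=; rewrite J_ => in_.
    exact: contrapT (H' (Ordinal in_)).
  by rewrite (bigD1 i)//= indicE memNset// mul0r.
rewrite integral_indic ?setIT//; last exact: fin_bigcap_measurable.
etransitivity; first exact: indZ.
rewrite big_J -prodEFin; apply: eq_bigr => i _.
have L : L1 P (fun w => \1_(B i) (Z i w) : R).
  apply: (@L1_bounded _ _ _ P _ 1) => [|w]; last by rewrite indicE; case: (_ \in _); rewrite ?normr1 ?normr0.
  by apply: measurableT_comp => //; exact: measurable_indic.
rewrite (L1_EFin L); transitivity (\int[P]_w (\1_(Z i @^-1` B i) w : R)%:E)%E => //.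
by rewrite integral_indic ?setIT.
Qed.

Lemma measurable_update g k f : (forall i, measurable_fun setT (g i)) ->
  measurable_fun setT f -> forall i, measurable_fun setT (update g k f i).
Proof. by move=> mg mf i; rewrite /update; case: ifP. Qed.

Lemma L1_update g k f : (forall i, L1 P (g i \o Z i)) -> L1 P (f \o Z k) ->
  forall i, L1 P (update g k f i \o Z i).
Proof. by move=> g1 f1 i; rewrite /update; case: eqP => [->|]. Qed.

Lemma measurable_prod_comp g (n : nat) (Q : pred 'I_n) :
  (forall i, measurable_fun setT (g i)) ->
  measurable_fun setT (fun w => \prod_(i < n | Q i) g i (Z i w)).
Proof.
move=> mg; under eq_fun do rewrite -big_filter.
by apply: measurable_prod => i _; exact: measurableT_comp.
Qed.

(** The inductions below impose conditions on all large indices, although a product over [i < n]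
    involves only finitely many. An indicator at the other places satisfies both kinds of condition,
    being an indicator and non-negative. *)
Definition truncate (n : nat) g : nat -> T' -> R :=
  fun i => if (i < n)%N then g i else \1_setT.

Lemma measurable_truncate n g : (forall i, measurable_fun setT (g i)) ->
  forall i, measurable_fun setT (truncate n g i).
Proof. by move=> mg i; rewrite /truncate; case: ifP. Qed.

Lemma L1_truncate n g : (forall i, L1 P (g i \o Z i)) ->
  forall i, L1 P (truncate n g i \o Z i).
Proof.
move=> g1 i; rewrite /truncate; case: ifP => // _.
by rewrite (_ : _ \o _ = fun=> 1) ?indicT//; exact: L1_cst.
Qed.

Lemma prod_truncate n g w :
  \prod_(i < n) g i (Z i w) = \prod_(i < n) truncate n g i (Z i w).
Proof. by apply: eq_bigr => i _; rewrite /truncate ltn_ord. Qed.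

Lemma prod_int_truncate n g : \prod_(i < n) \int[P]_w g i (Z i w) =
  \prod_(i < n) \int[P]_w truncate n g i (Z i w).
Proof. by apply: eq_bigr => i _; rewrite /truncate ltn_ord. Qed.

(** Induction on the number [k] of leading factors that are arbitrary, the later ones being
    indicators. To free factor [k], both sides are viewed as integrals of [g k] against a weight; it
    then suffices to compare them for an indicator at place [k], which is the induction
    hypothesis. *)
Lemma independent_prod_ge0 (k n : nat) g :
  (forall i, measurable_fun setT (g i)) -> (forall i y, 0 <= g i y) ->
  (forall i, L1 P (g i \o Z i)) ->
  (forall i, (k <= i)%N -> exists2 B, measurable B & g i = \1_B) ->
  (\int[P]_w (\prod_(i < n) g i (Z i w))%:E =
   (\prod_(i < n) \int[P]_w g i (Z i w))%:E)%E.
Proof.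
elim: k g => [|k IHk] g mg g0 g1 gB.
  have /choice[B HB] : forall i, exists B, measurable B /\ g i = \1_B.
    by move=> i; have [//|B] := gB i; exists B.
  under eq_integral do (under eq_bigr do rewrite (HB _).2).
  rewrite (independent_prod_indic n (fun i => (HB i).1)).
  by congr EFin; apply: eq_bigr => i _; rewrite (HB i).2.
have [nk|kn] := leqP n k.
  under eq_integral do rewrite prod_truncate.
  rewrite prod_int_truncate; apply: IHk.
  - exact: measurable_truncate.
  - by move=> i y; rewrite /truncate; case: ifP => _ //; rewrite indicE.
  - exact: L1_truncate.
  - by move=> i ki; rewrite /truncate ltnNge (leq_trans nk ki)/=; exists setT.
pose H w := \prod_(i < n | i != Ordinal kn) g i (Z i w).
pose h := \prod_(i < n | i != Ordinal kn) \int[P]_w g i (Z i w).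
have split_k (f : T' -> R) w :
    \prod_(i < n) update g k f i (Z i w) = f (Z k w) * H w.
  exact: (prod_update g f kn (fun i e => e (Z i w))).
have split_int (f : T' -> R) : \prod_(i < n) (\int[P]_w update g k f i (Z i w)) =
    (\int[P]_w f (Z k w)) * h.
  exact: (prod_update g f kn (fun i e => \int[P]_w e (Z i w))).
have gk : update g k (g k) = g.
  by apply/funext => i; rewrite /update; case: eqP => [->|].
have h0 : 0 <= h by apply: prodr_ge0 => i _; exact: Rintegral_ge0.
rewrite -[in LHS]gk -[in RHS]gk split_int.
under eq_integral do rewrite split_k.
(* The weight is the product [H] of the other factors on one side and the constant [h], the product
   of their integrals, on the other. *)
rewrite (@ge0_integral_transfer _ _ _ _ _ _ _ P P (Z k) (Z k) H (fun=> h))//.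
- under eq_integral do rewrite mulrC EFinM.
  rewrite ge0_integralZl_EFin//.
  + by rewrite mulrC EFinM (L1_EFin (g1 k)).
  + by move=> w _; rewrite lee_fin.
  + by apply/measurable_EFinP; exact: measurableT_comp.
- exact: measurable_prod_comp.
- by move=> w; apply: prodr_ge0 => i _.
- move=> B mB.
  have LB : L1 P (\1_B \o Z k : _ -> R).
    apply: (@L1_bounded _ _ _ P _ 1) => [|w]; last by rewrite /= indicE; case: (_ \in _); rewrite ?normr1 ?normr0.
    by apply: measurableT_comp => //; exact: measurable_indic.
  under [RHS]eq_integral do rewrite mulrC EFinM.
  rewrite ge0_integralZl_EFin//; last by apply/measurable_EFinP; exact: L1_measurable LB.
  rewrite -(L1_EFin LB) -EFinM mulrC -split_int -IHk.
  + by apply: eq_integral => w _; rewrite split_k.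
  + by apply: measurable_update => //; exact: measurable_indic.
  + by move=> i y; rewrite /update; case: ifP => // _; rewrite indicE.
  + exact: L1_update.
  + move=> i; rewrite leq_eqVlt /update eq_sym => /predU1P[->|ki].
      by rewrite eqxx; exists B.
    by rewrite gtn_eqF//; exact: gB.
Qed.

(** A second induction, now on the number of leading factors of free sign: factor [k] is a
    difference of two non-negative functions, and both sides are linear in it. *)
Lemma independent_prod_ge (k n : nat) g :
  (forall i, measurable_fun setT (g i)) -> (forall i, L1 P (g i \o Z i)) ->
  (forall i y, (k <= i)%N -> 0 <= g i y) ->
  L1 P (fun w => \prod_(i < n) g i (Z i w)) /\
  \int[P]_w (\prod_(i < n) g i (Z i w)) = \prod_(i < n) \int[P]_w g i (Z i w).
Proof.
elim: k g => [|k IHk] g mg g1 g0.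
  have I : (\int[P]_w (\prod_(i < n) truncate n g i (Z i w))%:E =
      (\prod_(i < n) \int[P]_w truncate n g i (Z i w))%:E)%E.
    apply: (@independent_prod_ge0 n).
    - exact: measurable_truncate.
    - by move=> i y; rewrite /truncate; case: ifP => _; [exact: g0|rewrite indicE].
    - exact: L1_truncate.
    - by move=> i ni; rewrite /truncate ltnNge ni/=; exists setT.
  under eq_fun do rewrite prod_truncate.
  rewrite prod_int_truncate.
  split; last by rewrite /Rintegral I.
  apply: ge0_L1; last by rewrite I ltry.
  - exact/measurable_prod_comp/measurable_truncate.
  - move=> w; rewrite -prod_truncate.
    by apply: prodr_ge0 => i _; exact: g0.
have [nk|kn] := leqP n k.
  under eq_fun do rewrite prod_truncate.
  rewrite prod_int_truncate; apply: IHk.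
  - exact: measurable_truncate.
  - exact: L1_truncate.
  - by move=> i y ki; rewrite /truncate ltnNge (leq_trans nk ki)/= indicE.
pose f1 y := g k y + `|g k y|; pose f2 y := `|g k y|.
have mf2 : measurable_fun setT f2 by exact: measurableT_comp.
have mf1 : measurable_fun setT f1 by exact: measurable_funD.
have Lf2 : L1 P (f2 \o Z k) by exact: L1_norm (g1 k).
have Lf1 : L1 P (f1 \o Z k) by exact: L1D (g1 k) Lf2.
have gk w : \prod_(i < n) g i (Z i w) = \prod_(i < n) update g k f1 i (Z i w) -
    \prod_(i < n) update g k f2 i (Z i w).
  rewrite !(prod_update g _ kn (fun i e => e (Z i w))) -mulrBl addrK.
  by rewrite (bigD1 (Ordinal kn)).
have f10 y : 0 <= f1 y by rewrite /f1; have := ler_norm (- g k y); rewrite normrN; lra.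
have [||i y|L1' I1] := IHk (update g k f1).
- exact: measurable_update.
- exact: L1_update.
- rewrite leq_eqVlt /update eq_sym => /predU1P[->|ki]; first by rewrite eqxx.
  by rewrite gtn_eqF//; exact: g0.
have [||i y|L2' I2] := IHk (update g k f2).
- exact: measurable_update.
- exact: L1_update.
- rewrite leq_eqVlt /update eq_sym => /predU1P[->|ki]; first by rewrite eqxx normr_ge0.
  by rewrite gtn_eqF//; exact: g0.
under eq_fun do rewrite gk.
split; first exact: L1B.
rewrite RintegralB// I1 I2 !(prod_update g _ kn (fun i e => \int[P]_w e (Z i w))).
rewrite -mulrBl [RHS](bigD1 (Ordinal kn))//=; congr (_ * _).
by rewrite -RintegralB//; apply: eq_Rintegral => w _; rewrite addrK.
Qed.

Lemma independent_prod (n : nat) g :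
  (forall i, measurable_fun setT (g i)) -> (forall i, L1 P (g i \o Z i)) ->
  L1 P (fun w => \prod_(i < n) g i (Z i w)) /\
  \int[P]_w (\prod_(i < n) g i (Z i w)) = \prod_(i < n) \int[P]_w g i (Z i w).
Proof.
move=> mg g1.
under eq_fun do rewrite prod_truncate.
rewrite prod_int_truncate.
apply: (@independent_prod_ge n).
- exact: measurable_truncate.
- exact: L1_truncate.
- by move=> i y ki; rewrite /truncate ltnNge ki/= indicE.
Qed.

End independence.

(** * Integrals under equal laws *)

Section identically_distributed.
Context {d0 d d'} {T0 : measurableType d0} {T : measurableType d}
  {T' : measurableType d'} {R : realType}.
Variables (P0 : probability T0 R) (P : probability T R) (Z0 : T0 -> T') (Z : T -> T').
Hypothesis mZ0 : measurable_fun setT Z0.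
Hypothesis mZ : measurable_fun setT Z.
Hypothesis eqZ : forall B : set T', measurable B ->
  pushforward P Z B = pushforward P0 Z0 B.

Lemma same_law_Rintegral (h : T' -> R) : measurable_fun setT h ->
  L1 P0 (h \o Z0) -> L1 P (h \o Z) /\ \int[P]_w h (Z w) = \int[P0]_w h (Z0 w).
Proof.
move=> mh h1.
have ge0 (f : T' -> R) : measurable_fun setT f -> (forall y, 0 <= f y) ->
    (\int[P]_w (f (Z w))%:E = \int[P0]_w (f (Z0 w))%:E)%E.
  move=> mf f0.
  transitivity (\int[P]_w (f (Z w) * cst (1 : R) w)%:E)%E.
    by apply: eq_integral => w _; rewrite mulr1.
  transitivity (\int[P0]_w (f (Z0 w) * cst (1 : R) w)%:E)%E; last first.
    by apply: eq_integral => w _; rewrite mulr1.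
  apply: ge0_integral_transfer => // B mB.
  transitivity (P (Z @^-1` B)).
    under eq_integral do rewrite mulr1.
    transitivity (\int[P]_w (\1_(Z @^-1` B) w : R)%:E)%E => //.
    by rewrite integral_indic ?setIT// -[X in measurable X]setTI; exact: mZ.
  transitivity (P0 (Z0 @^-1` B)); first exact: eqZ.
  under eq_integral do rewrite mulr1.
  transitivity (\int[P0]_w (\1_(Z0 @^-1` B) w : R)%:E)%E => //.
  by rewrite integral_indic ?setIT// -[X in measurable X]setTI; exact: mZ0.
have nonneg (f : T' -> R) : measurable_fun setT f -> (forall y, 0 <= f y) ->
    L1 P0 (f \o Z0) -> L1 P (f \o Z) /\ \int[P]_w f (Z w) = \int[P0]_w f (Z0 w).
  move=> mf f0 f1; split; last by rewrite /Rintegral ge0.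
  apply: ge0_L1; first exact: measurableT_comp.
    by move=> w; exact: f0.
  by rewrite ge0// -(L1_EFin f1) ltry.
have L2 := L1_norm h1; have L3 := L1D h1 L2.
have mh' : measurable_fun setT (fun y => `|h y|) by exact: measurableT_comp.
have [L2' I2] := nonneg _ mh' (fun y => normr_ge0 _) L2.
have [|L3' I3] := nonneg _ (measurable_funD mh mh') _ L3.
  by move=> y; have := ler_norm (- h y); rewrite normrN /=; lra.
have hE : h = fun y => (h y + `|h y|) - `|h y| by apply/funext => y; rewrite addrK.
split; first by rewrite hE; exact: L1B L3' L2'.
rewrite {1}hE RintegralB// I2 I3 -RintegralB//.
by apply: eq_Rintegral => w _; rewrite addrK.
Qed.

End identically_distributed.

Lemma expRN_taylor1 {R : realType} (x : R) : 0 <= x ->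
  `|expR (- x) - 1 + x| <= x ^+ 2.
Proof.
move=> x0.
rewrite (_ : expR (- x) - 1 + x = (expR (- x) - 1 + x) - (expR (- 0) - 1 + 0)); last first.
  by rewrite oppr0 expR0 subrr addr0 subr0.
apply: (@increment_le _ (fun y => expR (- y) - 1 + y) (fun y => 1 - expR (- y))) => //.
  by move=> y; apply: is_derive_eq; rewrite /GRing.scale/=; ring.
move=> y y0 yx; rewrite ger0_norm.
  by have := expR_ge1Dx (- y); lra.
by rewrite subr_ge0 -[leRHS]expR0 ler_expR oppr_le0.
Qed.

(** * Cosine integrals of sums of independent variables *)

Section cosine_of_sums.
Context {d d'} {T : measurableType d} {T' : measurableType d'} {R : realType}.
Variables (P : probability T R) (Z : nat -> T -> T') (psi : T' -> R).
Hypothesis mZ : forall i, measurable_fun setT (Z i).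
Hypothesis indZ : mutually_independent P Z.
Hypothesis mpsi : measurable_fun setT psi.

(* [cos_rec alpha beta j c] is the real part of [exp (i c) (alpha + i beta) ^ j]:
   the shift by [pi / 2] turns cosines into sines, so that no complex
   characteristic function is needed. *)
Fixpoint cos_rec (alpha beta : R) (j : nat) (c : R) : R :=
  if j is j'.+1 then
    alpha * cos_rec alpha beta j' c - beta * cos_rec alpha beta j' (c - pi / 2)
  else cos c.

Lemma measurable_cos_sum (a c : R) (j : nat) :
  measurable_fun setT (fun w => cos (a * \sum_(i < j) psi (Z i w) + c)).
Proof.
apply: (measurableT_comp (measurable_trig a c).1).
by apply: measurable_sum => i; exact: measurableT_comp.
Qed.

Variables (a alpha beta : R).
Hypothesis int_cos : forall i, \int[P]_w cos (a * psi (Z i w)) = alpha.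
Hypothesis int_sin : forall i, \int[P]_w sin (a * psi (Z i w)) = beta.

Lemma L1_comp_bounded (g : T' -> R) (M : R) i : measurable_fun setT g ->
  (forall y, `|g y| <= M) -> L1 P (g \o Z i).
Proof.
move=> mg gM; apply: (@L1_bounded _ _ _ P _ M); first exact: measurableT_comp.
by move=> w; exact: gM.
Qed.

(** The extra product makes the induction close. Splitting off one summand by the addition formula
    produces the cosine and the sine of [a * psi (Z j w)], which become new factors at place [j];
    the sine of the remaining sum is a cosine with phase lowered by [pi / 2]. *)
Lemma Rintegral_cos_sum_prod (j n : nat) (g : nat -> T' -> R) (c : R) :
  (j <= n)%N -> (forall i, measurable_fun setT (g i)) ->
  (forall i y, `|g i y| <= 1) ->
  \int[P]_w (cos (a * \sum_(i < j) psi (Z i w) + c) *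
             \prod_(j <= i < n) g i (Z i w)) =
  cos_rec alpha beta j c * \prod_(j <= i < n) \int[P]_w g i (Z i w).
Proof.
elim: j g c => [|j IHj] g c jn mg gM.
  have [L I] := independent_prod mZ indZ n mg (fun i => L1_comp_bounded i (mg i) (gM i)).
  rewrite /= big_mkord -I -RintegralZl//.
  by apply: eq_Rintegral => w _; rewrite big_ord0 mulr0 add0r big_mkord.
have mpsia : measurable_fun setT (fun y => a * psi y + 0).
  by apply: measurable_funD => //; exact: measurable_funM.
have mcos : measurable_fun setT (fun y => cos (a * psi y)).
  by have := measurableT_comp (measurable_trig a 0).1 mpsi; under eq_fun do rewrite /= addr0.
have msin : measurable_fun setT (fun y => sin (a * psi y)).
  by have := measurableT_comp (measurable_trig a 0).2 mpsi; under eq_fun do rewrite /= addr0.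
have upd (f : T' -> R) (F : nat -> (T' -> R) -> R) :
    \prod_(j <= i < n) F i (update g j f i) = F j f * \prod_(j.+1 <= i < n) F i (g i).
  rewrite big_ltn// {1}/update eqxx; congr (_ * _).
  by apply: eq_big_nat => i /andP[ji _]; rewrite /update gtn_eqF.
have bnd (f : T' -> R) : (forall y, `|f y| <= 1) -> forall i y, `|update g j f i y| <= 1.
  by move=> f1 i y; rewrite /update; case: ifP.
have Lp (f : T' -> R) (c' : R) : measurable_fun setT f -> (forall y, `|f y| <= 1) ->
    L1 P (fun w => cos (a * \sum_(i < j) psi (Z i w) + c') *
       \prod_(j <= i < n) update g j f i (Z i w)).
  move=> mf f1; apply: (@L1_bounded _ _ _ P _ 1).
    apply: measurable_funM; first exact: measurable_cos_sum.
    apply: measurable_prod => i _; apply: measurableT_comp => //.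
    exact: measurable_update.
  move=> w; rewrite normrM mulr_ile1 ?normr_ge0 ?cos_max// normr_prod.
  by apply: prodr_ile1 => i; rewrite normr_ge0 bnd.
have cosM : forall y, `|cos (a * psi y)| <= 1 by move=> y; exact: cos_max.
have sinM : forall y, `|sin (a * psi y)| <= 1 by move=> y; exact: sin_max.
have E1 := IHj (update g j (fun y => cos (a * psi y))) c (ltnW jn)
  (measurable_update j mg mcos) (bnd _ cosM).
have E2 := IHj (update g j (fun y => sin (a * psi y))) (c - pi / 2) (ltnW jn)
  (measurable_update j mg msin) (bnd _ sinM).
move: E1 E2; rewrite !(upd _ (fun i e => \int[P]_w e (Z i w))) int_cos int_sin => E1 E2.
rewrite /= mulrBl -[alpha * _ * _]mulrA -[beta * _ * _]mulrA.
rewrite [alpha * _]mulrCA [beta * _]mulrCA -E1 -E2 -RintegralB//; last 2 first.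
- exact: Lp.
- exact: Lp.
apply: eq_Rintegral => w _; rewrite !(upd _ (fun i e => e (Z i w))).
rewrite big_ord_recr/= mulrDr addrAC cosD addrA cosBpihalf; ring.
Qed.

Lemma Rintegral_cos_sum (n : nat) (c : R) :
  \int[P]_w cos (a * \sum_(i < n) psi (Z i w) + c) = cos_rec alpha beta n c.
Proof.
have H := @Rintegral_cos_sum_prod n n (fun _ _ => 0) c (leqnn n).
rewrite -[RHS]mulr1 -[X in _ * X](@big_geq _ 1 *%R n n xpredT (fun i => \int[P]_w 0))//.
rewrite -H//; last by move=> *; rewrite normr0.
by apply: eq_Rintegral => w _; rewrite big_geq// mulr1.
Qed.

(** For [alpha = q] and [beta = 0] the recursion gives [q ^+ n * cos c] exactly. Each of the [n]
    steps adds at most [|alpha - q| + |beta|], and [|q| <= 1] keeps earlier errors from growing. *)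
Lemma cos_sum_approx (q : R) (n : nat) (c : R) : `|q| <= 1 ->
  `|\int[P]_w cos (a * \sum_(i < n) psi (Z i w) + c) - q ^+ n * cos c| <=
  n%:R * (`|alpha - q| + `|beta|).
Proof.
move=> q1; rewrite Rintegral_cos_sum; elim: n c => [|n IHn] c.
  by rewrite /= expr0 mul1r subrr normr0 mul0r.
(* The bound is not visible in the recursion; it holds because [cos_rec] is the integral of a
   cosine. *)
have bnd c' : `|cos_rec alpha beta n c'| <= 1.
  rewrite -Rintegral_cos_sum; apply: normr_Rintegral_le => [|w].
    exact: measurable_cos_sum.
  exact: cos_max.
rewrite /= (_ : _ - _ = (alpha - q) * cos_rec alpha beta n c
  - beta * cos_rec alpha beta n (c - pi / 2)
  + q * (cos_rec alpha beta n c - q ^+ n * cos c)); last by rewrite exprS; ring.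
rewrite (le_trans (ler_normD _ _))// -(natr1 n) (mulrDl n%:R) mul1r addrC lerD//.
  by rewrite normrM -[leRHS]mul1r ler_pM.
rewrite (le_trans (ler_normB _ _))// !normrM.
by rewrite lerD// -[leRHS]mulr1 ler_wpM2l.
Qed.

End cosine_of_sums.

(** * The one-dimensional central limit theorem *)

Lemma cvg_natV (R : realType) : (fun n : nat => n%:R^-1 : R) @ \oo --> (0 : R).
Proof.
apply/cvgr0Pnorm_le => e e0; near=> n.
have n0 : (0 < n)%N by near: n; exists 1%N.
rewrite ger0_norm ?invr_ge0// -[leRHS]invrK lef_pV2 ?posrE ?ltr0n ?invr_gt0//.
by near: n; exact: nbhs_infty_ger.
Unshelve. all: by end_near. Qed.

(** At scale [1 / sqrt n] the Taylor remainder is at most [1 / n] times this minimum. The cubic term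
    tends to 0 pointwise and the square dominates, so a finite second moment suffices, in the spirit
    of Lindeberg's condition. *)
Lemma truncated_third_moment_cvg0 {d} {T : measurableType d} {R : realType}
    (P : probability T R) (xi : T -> R) : measurable_fun setT xi ->
  L1 P (fun w => xi w ^+ 2) ->
  (fun n : nat => \int[P]_w Num.min (xi w ^+ 2) (`|xi w| ^+ 3 / Num.sqrt n%:R))
    @ \oo --> (0 : R).
Proof.
move=> mxi L2.
pose f (n : nat) (w : T) : R := Num.min (xi w ^+ 2) (`|xi w| ^+ 3 / Num.sqrt n%:R).
have f0 n w : 0 <= f n w.
  by rewrite /f le_min sqr_ge0 mulr_ge0// invr_ge0 sqrtr_ge0.
have mf n : measurable_fun setT (f n).
  apply: measurable_minr; first exact: measurable_funX.
  apply: measurable_funM => //; apply: measurable_funX; exact: measurableT_comp.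
have [|||||_ _] := @dominated_convergence _ _ _ P setT measurableT
    (fun n w => (f n w)%:E) (cst 0%E) (fun w => (xi w ^+ 2)%:E).
- by move=> n; exact/measurable_EFinP.
- exact: measurable_cst.
- apply: aeW => w _; apply: cvg_EFin; first exact: nearW.
  apply/cvgr0Pnorm_le => e e0; near=> n.
  rewrite /= ger0_norm// /f ge_min; apply/orP; right.
  have n0 : (0 < n)%N by near: n; exists 1%N.
  rewrite ler_pdivrMr ?sqrtr_gt0 ?ltr0n// -ler_pdivrMl//.
  rewrite -[leLHS]ger0_norm ?mulr_ge0 ?invr_ge0 ?(ltW e0)//.
  rewrite -sqrtr_sqr ler_wsqrtr//.
  by near: n; exact: nbhs_infty_ger.
- exact: L2.
- apply: aeW => w n _; rewrite lee_fin ger0_norm// /f ge_min; apply/orP; left.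
  exact: lexx.
rewrite integral0 => /fine_cvg; exact.
Unshelve. all: by end_near. Qed.

Section clt_cos.
Context {d0 d d'} {T0 : measurableType d0} {T : measurableType d}
  {T' : measurableType d'} {R : realType}.
Variables (P0 : probability T0 R) (P : probability T R) (Z0 : T0 -> T') (Z : nat -> T -> T').
Hypothesis mZ0 : measurable_fun setT Z0.
Hypothesis mZ : forall i, measurable_fun setT (Z i).
Hypothesis iidZ : iid_copies P0 Z0 P Z.
Variable psi : T' -> R.
Hypothesis mpsi : measurable_fun setT psi.
Hypothesis L1psi : L1 P0 (psi \o Z0).
Hypothesis L2psi : L1 P0 (fun w => psi (Z0 w) ^+ 2).
Hypothesis mean0 : \int[P0]_w psi (Z0 w) = 0.

Let s2 := \int[P0]_w (psi (Z0 w) ^+ 2).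
Let eps (n : nat) := \int[P0]_w Num.min (psi (Z0 w) ^+ 2)
  (`|psi (Z0 w)| ^+ 3 / Num.sqrt n%:R).
Let xi w := psi (Z0 w).

Let mxi : measurable_fun setT xi. Proof. exact: measurableT_comp. Qed.

Let L1_min n : L1 P0 (fun w => Num.min (xi w ^+ 2) (`|xi w| ^+ 3 / Num.sqrt n%:R)).
Proof.
apply: L1_le L2psi.
  apply: measurable_minr; first exact: measurable_funX.
  apply: measurable_funM => //; apply: measurable_funX; exact: measurableT_comp.
move=> w; rewrite ger0_norm; first by rewrite ge_min lexx.
by rewrite le_min sqr_ge0 mulr_ge0// invr_ge0 sqrtr_ge0.
Qed.

Let min_scaled (n : nat) (x y : R) : (0 < n)%N ->
  `|y| <= ((Num.sqrt n%:R)^-1 * x) ^+ 2 /\ `|y| <= `|(Num.sqrt n%:R)^-1 * x| ^+ 3 ->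
  `|y| <= n%:R^-1 * Num.min (x ^+ 2) (`|x| ^+ 3 / Num.sqrt n%:R).
Proof.
move=> n0 [y2 y3]; have sn : 0 < Num.sqrt n%:R :> R by rewrite sqrtr_gt0 ltr0n.
have nE : n%:R^-1 = (Num.sqrt n%:R : R)^-1 ^+ 2.
  by rewrite exprVn sqr_sqrtr ?ler0n.
rewrite -ler_pdivrMl ?invr_gt0 ?ltr0n// le_min.
rewrite !ler_pdivrMl ?invr_gt0 ?ltr0n// nE -exprMn y2/=.
rewrite (le_trans y3)// normrM exprMn ger0_norm ?invr_ge0 ?sqrtr_ge0//.
by rewrite exprSr -mulrA (mulrC _ (`|x| ^+ 3)).
Qed.

Let alpha n := \int[P0]_w cos ((Num.sqrt n%:R)^-1 * xi w).
Let beta n := \int[P0]_w sin ((Num.sqrt n%:R)^-1 * xi w).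

Let mtrig n : measurable_fun setT (fun y => cos ((Num.sqrt n%:R)^-1 * psi y)) /\
  measurable_fun setT (fun y => sin ((Num.sqrt n%:R)^-1 * psi y)).
Proof.
have E : (fun y => (Num.sqrt n%:R)^-1 * psi y) = fun y => (Num.sqrt n%:R)^-1 * psi y + 0.
  by apply/funext => y; rewrite addr0.
have [m1 m2] := measurable_trig (Num.sqrt n%:R)^-1 (0 : R).
split.
  by have := measurableT_comp m1 mpsi; under eq_fun do rewrite /= addr0.
by have := measurableT_comp m2 mpsi; under eq_fun do rewrite /= addr0.
Qed.

Let L1trig n : L1 P0 (fun w => cos ((Num.sqrt n%:R)^-1 * xi w)) /\
  L1 P0 (fun w => sin ((Num.sqrt n%:R)^-1 * xi w)).
Proof.
have [m1 m2] := mtrig n.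
split.
  apply: (@L1_bounded _ _ _ P0 _ 1); last by move=> w; exact: cos_max.
  exact: measurableT_comp m1 mZ0.
apply: (@L1_bounded _ _ _ P0 _ 1); last by move=> w; exact: sin_max.
exact: measurableT_comp m2 mZ0.
Qed.

Let beta_le n : (0 < n)%N -> `|beta n| <= n%:R^-1 * eps n.
Proof.
move=> n0; have [_ Ls] := L1trig n.
(* Subtracting the mean of [psi], which is 0, supplies the linear Taylor term of the sine. *)
rewrite /beta -[X in `|X|]subr0 -[X in `|_ - X|](mulr0 (Num.sqrt n%:R)^-1) -mean0.
rewrite -RintegralZl// /eps -RintegralZl//.
apply: normr_RintegralB_le => //.
- exact: L1Z.
- exact: L1Z (L1_min n).
- by move=> w; apply: min_scaled => //; exact: sin_sub_id_le.
Qed.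

Let alpha_le n : (0 < n)%N ->
  `|alpha n - (1 - s2 / 2 / n%:R)| <= n%:R^-1 * eps n.
Proof.
move=> n0; have [Lc _] := L1trig n.
have L2' : L1 P0 (fun w => (2^-1 / n%:R) * xi w ^+ 2) by exact: L1Z.
have -> : 1 - s2 / 2 / n%:R = \int[P0]_w (1 - 2^-1 / n%:R * xi w ^+ 2).
  rewrite RintegralB//; last exact: L1_cst.
  by rewrite Rintegral_prob_cst RintegralZl// -/s2; congr (_ - _); ring.
rewrite /eps -RintegralZl//; apply: normr_RintegralB_le => //.
- by apply: L1B => //; exact: L1_cst.
- exact: L1Z (L1_min n).
- move=> w; apply: min_scaled => //.
  have -> : cos ((Num.sqrt n%:R)^-1 * xi w) - (1 - 2^-1 / n%:R * xi w ^+ 2) =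
    cos ((Num.sqrt n%:R)^-1 * xi w) - 1 + ((Num.sqrt n%:R)^-1 * xi w) ^+ 2 / 2.
    by rewrite exprMn exprVn sqr_sqrtr ?ler0n//; ring.
  exact: cos_taylor2_le.
Qed.

Lemma clt_cos (c : R) :
  (fun n : nat => \int[P]_w cos ((Num.sqrt n%:R)^-1 * \sum_(i < n) psi (Z i w) + c))
    @ \oo --> expR (- (s2 / 2)) * cos c.
Proof.
have [ind same] := iidZ.
have s20 : 0 <= s2 by apply: Rintegral_ge0 => w _; exact: sqr_ge0.
have eps0 := truncated_third_moment_cvg0 mxi L2psi.
pose bound (n : nat) := 2 * eps n + (s2 / 2) ^+ 2 / n%:R.
have cb : bound @ \oo --> (0 : R).
  rewrite (_ : 0 = 2 * 0 + (s2 / 2) ^+ 2 * 0 :> R); last by rewrite !mulr0 addr0.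
  apply: cvgD; apply: cvgM => //; try exact: cvg_cst.
  exact: cvg_natV.
apply/cvgrPdist_le => e e0; near=> n.
have n0 : (0 < n)%N by near: n; exists 1%N.
have nR : n%:R != 0 :> R by rewrite pnatr_eq0 -lt0n.
(* With this [q] the value [q ^+ n * cos c] is exactly the limit. The total error is at most
   [2 * eps n] from the Taylor remainders plus [(s2 / 2) ^+ 2 / n] from comparing [q] with
   [1 - s2 / 2 / n], which is [bound n]. *)
pose q := expR (- (s2 / 2 / n%:R)).
have qn : expR (- (s2 / 2)) = q ^+ n.
  by rewrite -expRM_natl; congr expR; field.
have q1 : `|q| <= 1.
  rewrite ger0_norm ?expR_ge0// -[leRHS]expR0 ler_expR oppr_le0.
  by rewrite !mulr_ge0// invr_ge0.
have [m1 m2] := mtrig n; have [L1' L2'] := L1trig n.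
rewrite distrC qn (le_trans (@cos_sum_approx _ _ _ _ _ P Z psi mZ ind mpsi
  (Num.sqrt n%:R)^-1 (alpha n) (beta n) _ _ q n c q1))//.
- by move=> i; exact: (same_law_Rintegral mZ0 (mZ i) (same i) m1 L1').2.
- by move=> i; exact: (same_law_Rintegral mZ0 (mZ i) (same i) m2 L2').2.
apply: (@le_trans _ _ (bound n)).
  rewrite -ler_pdivlMl ?ltr0n//.
  have := alpha_le n0; have := beta_le n0.
  have := @expRN_taylor1 _ (s2 / 2 / n%:R) _.
  rewrite -/q => H1 H2 H3.
  rewrite (_ : alpha n - q = (alpha n - (1 - s2 / 2 / n%:R)) -
     (q - 1 + s2 / 2 / n%:R)); last by ring.
  have := ler_normB (alpha n - (1 - s2 / 2 / n%:R)) (q - 1 + s2 / 2 / n%:R).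
  have := H1 _; rewrite /bound mulrDr.
  have -> : n%:R^-1 * ((s2 / 2) ^+ 2 / n%:R) = (s2 / 2 / n%:R) ^+ 2 by ring.
  have : 0 <= s2 / 2 / n%:R by rewrite !mulr_ge0// invr_ge0.
  move=> ? /(_ _) ?; lra.
rewrite (le_trans (ler_norm _))//.
by near: n; apply: cvgr0_norm_le.
Unshelve. all: by end_near. Qed.

End clt_cos.

(** * Approximation by trigonometric polynomials *)

(** Only [x] is confined to the box: an estimator may leave it while its linear part lies inside.
    Compactness is used as a near-covering property, with the radii [delta] tending to 0 from the
    right as the second filter. *)
Lemma continuous_unif_box {R : realType} (f : R * R -> R) (K e : R) :
  continuous f -> 0 < e -> exists2 delta : R, 0 < delta &
  forall x y, `|x.1| <= K -> `|x.2| <= K -> `|x.1 - y.1| < delta ->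
    `|x.2 - y.2| < delta -> `|f x - f y| <= e.
Proof.
move=> cf e0; pose B := [set` `[- K, K]] `*` [set` `[- K, K]] : set (R * R).
have cB : compact B by apply: compact_setX; exact: segment_compact.
pose Q (delta : R) (x : R * R) := forall y : R * R, `|x.1 - y.1| < delta ->
  `|x.2 - y.2| < delta -> `|f x - f y| <= e.
have H := (compact_near_coveringP B).1 cB R (0 : R)^'+ Q _.
have : (0 : R)^'+ (fun delta => B `<=` Q delta).
  apply: H => x Bx.
  have e2 : 0 < e / 2 by rewrite divr_gt0.
  have /cvgrPdist_lt/(_ _ e2)/nbhs_ballP[r /= r0 rf] := cf x.
  have r2 : 0 < r / 2 by rewrite divr_gt0.
  exists (ball x (r / 2), [set delta | delta < r / 2]).
    by split; [exact: nbhsx_ballx|exact: nbhs_right_lt].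
  case=> x' delta /= [[xx1 xx2] dr] y xy1 xy2.
  have fx' : `|f x - f x'| < e / 2.
    apply: rf; split; apply: le_ball; [|exact: xx1| |exact: xx2].
      by lra.
    by lra.
  have fy : `|f x - f y| < e / 2.
    apply: rf; split; rewrite -ball_normE /=.
      rewrite (splitr r) (_ : x.1 - y.1 = (x.1 - x'.1) + (x'.1 - y.1)); last by ring.
      rewrite (le_lt_trans (ler_normD _ _))// ltrD//.
      exact: lt_trans dr.
    rewrite (splitr r) (_ : x.2 - y.2 = (x.2 - x'.2) + (x'.2 - y.2)); last by ring.
    rewrite (le_lt_trans (ler_normD _ _))// ltrD//.
    exact: lt_trans dr.
  rewrite (_ : f x' - f y = (f x - f y) - (f x - f x')); last by ring.
  by rewrite (le_trans (ler_normB _ _))// (splitr e) ltW// ltrD.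
move=> /(filterI (nbhs_right_gt 0)) /filter_ex[delta [d0 Bd]].
exists delta => // x y x1 x2 xy1 xy2; apply: Bd => //.
by split; rewrite /= in_itv/= -ler_norml.
Qed.

Section bernstein.
Context {R : realType}.
Implicit Types (u v : R) (F : nat -> R) (N : nat).

(* The expectation of [F] at a binomial (N, u) variable. *)
Fixpoint bernstein N u F : R :=
  if N is N'.+1 then
    (1 - u) * bernstein N' u F + u * bernstein N' u (fun i => F i.+1)
  else F 0%N.

Lemma bernsteinD N u F G :
  bernstein N u (fun i => F i + G i) = bernstein N u F + bernstein N u G.
Proof. by elim: N F G => //= N IHN F G; rewrite !IHN; ring. Qed.

Lemma bernsteinZ N u a F : bernstein N u (fun i => a * F i) = a * bernstein N u F.
Proof. by elim: N F => //= N IHN F; rewrite !IHN; ring. Qed.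

Lemma bernstein_cst N u a : bernstein N u (fun=> a) = a.
Proof. by elim: N => //= N ->; ring. Qed.

Lemma bernstein_le N u F G : 0 <= u <= 1 -> (forall i, (i <= N)%N -> F i <= G i) ->
  bernstein N u F <= bernstein N u G.
Proof.
move=> /andP[u0 u1]; elim: N F G => [|N IHN] F G FG /=; first exact: FG.
apply: lerD; rewrite ler_wpM2l ?subr_ge0//; apply: IHN => i iN; apply: FG => //.
exact: leqW.
Qed.

(** The centre [x] must be arbitrary, because the shifted branch of the recursion replaces [x] by
    [x - 1]. For [x = N u] this is the binomial variance. *)
Lemma bernstein_sqr N u x :
  bernstein N u (fun i => (i%:R - x) ^+ 2) = (N%:R * u - x) ^+ 2 + N%:R * u * (1 - u).
Proof.
elim: N x => [|N IHN] x /=; first by rewrite !mul0r addr0.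
have -> : (fun i => (i.+1%:R - x) ^+ 2) = fun i => (i%:R - (x - 1)) ^+ 2.
  by apply/funext => i; rewrite -natr1; congr (_ ^+ 2); ring.
by rewrite !IHN -natr1; ring.
Qed.

Lemma bernstein_dist N u : (0 < N)%N ->
  bernstein N u (fun i => (i%:R / N%:R - u) ^+ 2) = u * (1 - u) / N%:R.
Proof.
move=> N0; have NR : N%:R != 0 :> R by rewrite pnatr_eq0 -lt0n.
rewrite (_ : (fun i => _) = fun i => N%:R^-1 ^+ 2 * (i%:R - N%:R * u) ^+ 2).
  by rewrite bernsteinZ bernstein_sqr subrr expr0n add0r /=; field.
by apply/funext => i; field.
Qed.

Lemma bernstein_norm_le N u F M : 0 <= u <= 1 -> (forall i, `|F i| <= M) ->
  `|bernstein N u F| <= M.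
Proof.
move=> u01 FM; rewrite ler_norml; apply/andP; split;
  [rewrite -[leLHS](bernstein_cst N u)|rewrite -[leRHS](bernstein_cst N u)];
  apply: bernstein_le => // i _.
  by have := FM i; rewrite ler_norml => /andP[].
by have := FM i; rewrite ler_norml => /andP[].
Qed.

Lemma bernstein_normB_le N u a F G : 0 <= u <= 1 ->
  (forall i, `|a - F i| <= G i) -> `|a - bernstein N u F| <= bernstein N u G.
Proof.
move=> u01 FG; rewrite ler_distlC; apply/andP; split.
  rewrite lerBlDr -[leLHS](bernstein_cst N u) -bernsteinD; apply: bernstein_le => // i _.
  by have := FG i; rewrite ler_distl => /andP[]; lra.
rewrite -[X in X + _](bernstein_cst N u) -bernsteinD; apply: bernstein_le => // i _.
by have := FG i; rewrite ler_distl => /andP[]; lra.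
Qed.

End bernstein.

Section trig_polynomials.
Context {R : realType}.
Implicit Types f g : R * R -> R.

(** Cosines alone suffice as generators: sines come from a phase shift, constants from zero
    frequencies, and products from the product-to-sum formula. *)
Inductive trig_poly : (R * R -> R) -> Prop :=
| trig_poly_cos t1 t2 c : trig_poly (fun z => cos (t1 * z.1 + t2 * z.2 + c))
| trig_polyD f g : trig_poly f -> trig_poly g -> trig_poly (fun z => f z + g z)
| trig_polyZ a f : trig_poly f -> trig_poly (fun z => a * f z).

Lemma trig_poly_cst a : trig_poly (fun=> a).
Proof.
rewrite (_ : (fun=> a) = fun z => a * cos (0 * z.1 + 0 * z.2 + 0)).
  by apply: trig_polyZ; exact: trig_poly_cos.
by apply/funext => z; rewrite !mul0r !addr0 cos0 mulr1.
Qed.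

Lemma trig_polyM f g : trig_poly f -> trig_poly g -> trig_poly (fun z => f z * g z).
Proof.
move=> + tg; elim => [t1 t2 c|f1 f2 _ H1 _ H2|a f1 _ H1]; last 2 first.
- by under eq_fun do rewrite mulrDl; exact: trig_polyD.
- by under eq_fun do rewrite -mulrA; exact: trig_polyZ.
elim: tg => [s1 s2 e|g1 g2 _ H1 _ H2|a g1 _ H1]; last 2 first.
- by under eq_fun do rewrite mulrDr; exact: trig_polyD.
- by under eq_fun do rewrite mulrCA; exact: trig_polyZ.
rewrite (_ : (fun z => _) = fun z =>
  2^-1 * (cos ((t1 + s1) * z.1 + (t2 + s2) * z.2 + (c + e)) +
          cos ((t1 - s1) * z.1 + (t2 - s2) * z.2 + (c - e)))).
  by apply: trig_polyZ; apply: trig_polyD; exact: trig_poly_cos.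
apply/funext => z.
rewrite (_ : (t1 + s1) * z.1 + _ + _ = (t1 * z.1 + t2 * z.2 + c) + (s1 * z.1 + s2 * z.2 + e)); last by ring.
rewrite (_ : (t1 - s1) * z.1 + _ + _ = (t1 * z.1 + t2 * z.2 + c) - (s1 * z.1 + s2 * z.2 + e)); last by ring.
move: (t1 * z.1 + _ + _) (s1 * z.1 + _ + _) => A B.
by rewrite cosD cosB; field.
Qed.

Lemma trig_poly_bernstein N (u : R * R -> R) (F : nat -> R * R -> R) :
  trig_poly u -> (forall i, trig_poly (F i)) ->
  trig_poly (fun z => bernstein N (u z) (fun i => F i z)).
Proof.
move=> tu; elim: N F => [|N IHN] F tF /=; first exact: tF.
apply: trig_polyD; apply: trig_polyM => //; last 2 first.
- exact: IHN.
- by apply: IHN => i; exact: tF.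
apply: trig_polyD; first exact: trig_poly_cst.
by under eq_fun do rewrite -mulN1r; exact: trig_polyZ.
Qed.

Lemma cos1_le (c : R) : `|c| <= 1 -> cos 1 <= cos c.
Proof.
move=> c1; rewrite -(cos_norm c) leNgt ltr_cos -?leNgt// in_itv/=.
  by rewrite ler01 (le_trans _ (pi_ge2 R))// ler1n.
by rewrite normr_ge0 (le_trans c1)// (le_trans _ (pi_ge2 R))// ler1n.
Qed.

Lemma sin_norm_le1 (a : R) : `|a| <= 1 -> `|sin a| <= sin 1.
Proof.
have pi1 := pihalf_ge1 R.
rewrite !ler_norml => /andP[a1 a2]; rewrite -sinN.
by apply/andP; split; rewrite leNgt ltr_sin -?leNgt// in_itv/=; apply/andP; split; lra.
Qed.

(** Mean value theorem, the cosine being at least [cos 1 > 0] on [[-1, 1]]. This turns closeness of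
    sines into closeness of arguments. *)
Lemma sin_dist_ge (a b : R) : `|a| <= 1 -> `|b| <= 1 ->
  cos 1 * `|a - b| <= `|sin a - sin b|.
Proof.
wlog ab : a b / b <= a.
  move=> H a1 b1; have [/H|/ltW/H] := leP b a; first exact.
  by rewrite distrC (distrC (sin a)); exact.
rewrite !ler_norml => /andP[a1 a2] /andP[b1 b2].
have [|c] := @MVT_segment _ sin cos b a ab.
  by apply: continuous_subspaceT => x; exact: continuous_sin.
rewrite in_itv/= => /andP[bc ca] ->; rewrite normrM.
have c1 : `|c| <= 1 by rewrite ler_norml; apply/andP; split; lra.
by rewrite ler_wpM2r// (le_trans (cos1_le c1))// ler_norm.
Qed.

(* [sin theta] is the point of [[- sin 1, sin 1]] closest to [v]. *)
Lemma sin_node (v : R) : exists2 theta : R, `|theta| <= 1 &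
  forall a, `|a| <= 1 -> cos 1 * `|a - theta| <= `|sin a - v|.
Proof.
have s1 : 0 <= sin 1 :> R by rewrite (le_trans _ (@sin_norm_le1 0 _))// normr0.
pose s := Num.max (- sin 1) (Num.min (sin 1) v).
have [|||theta] := @IVT R sin (-1) 1 s.
- by lra.
- by apply: continuous_subspaceT => x; exact: continuous_sin.
- rewrite sinN min_l ?max_r ?ge_max ?le_max ?ge_min ?lexx ?orbT//; lra.
rewrite in_itv/= -ler_norml => th1 sth; exists theta => // a a1.
rewrite (le_trans (sin_dist_ge a1 th1))// sth.
have := sin_norm_le1 a1; rewrite ler_norml /s => /andP[sa1 sa2].
have [sv|vs] := leP (sin 1) v.
  by rewrite max_r ?ler0_norm//; lra.
have [sv|vs'] := leP (- sin 1) v; first by [].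
by rewrite !ger0_norm//; lra.
Qed.

(** Bernstein's argument in two variables: [g] averages [f] over grid points with coordinates
    [K * theta i], where [sin (theta i)] is as close as possible to [2 * (i / N) - 1]. Near nodes
    cost [e / 2] by uniform continuity, far ones are paid for by the binomial variance. As an
    average of values of [f], [g] is bounded by [M] on the whole plane, not only on the box. *)
Lemma trig_poly_approx f (M K e : R) : continuous f -> (forall z, `|f z| <= M) ->
  0 < K -> 0 < e -> exists g, [/\ trig_poly g, forall z, `|g z| <= M &
    forall z, `|z.1| <= K -> `|z.2| <= K -> `|f z - g z| <= e].
Proof.
move=> cf fM K0 e0.
have c1 := @cos1_gt0 R.
have [|delta d0 fdelta] := @continuous_unif_box _ f K (e / 2) cf; first exact: divr_gt0.
have M0 : 0 <= M by exact: le_trans (fM (0, 0)).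
(* [C] is the Lipschitz constant for passing from [p x] back to [x] on the box. [D] is such that a
   distance of at least [delta] in one coordinate makes [D] times the square of [i / N - p x] at
   least [2 * M]. *)
pose C := 2 * K / cos 1; pose D := 2 * M * C ^+ 2 / delta ^+ 2.
have D0 : 0 <= D by rewrite divr_ge0 ?sqr_ge0// mulr_ge0 ?sqr_ge0// mulr_ge0.
(* Each coordinate contributes at most [D / N]; together they must fit into the second half of
   [e]. *)
have [N NE] : exists N : nat, (0 < N)%N /\ 2 * D / N%:R <= e / 2.
  exists (Num.truncn (4 * D / e)).+1; split=> //.
  rewrite ler_pdivrMr ?ltr0n//; have := truncnS_gt (4 * D / e).
  by rewrite ltr_pdivrMr// => /ltW; lra.
have /choice[theta Htheta] (i : nat) : exists theta : R, `|theta| <= 1 /\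
    forall a, `|a| <= 1 -> cos 1 * `|a - theta| <= `|sin a - (2 * (i%:R / N%:R) - 1)|.
  by have [th ? ?] := sin_node (2 * (i%:R / N%:R) - 1); exists th.
pose p (x : R) := (1 + sin (x / K)) / 2.
pose g (z : R * R) := bernstein N (p z.1) (fun i => bernstein N (p z.2)
  (fun j => f (K * theta i, K * theta j))).
have p01 x : 0 <= p x <= 1.
  by have := sin_geN1 (x / K); have := sin_le1 (x / K); rewrite /p => *; apply/andP; split; lra.
exists g; split.
- have tp (u : R * R -> R) s t : (forall z, u z = s * z.1 + t * z.2) ->
      trig_poly (fun z => (1 + sin (u z)) / 2).
    move=> uE; under eq_fun do rewrite mulrC; apply: trig_polyZ.
    apply: trig_polyD; first exact: trig_poly_cst.
    by under eq_fun do rewrite -cosBpihalf uE; exact: trig_poly_cos.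
  apply: trig_poly_bernstein; first by apply: (tp _ K^-1 0) => z; rewrite mul0r addr0 mulrC.
  move=> i; apply: trig_poly_bernstein; first by apply: (tp _ 0 K^-1) => z; rewrite mul0r add0r mulrC.
  by move=> j; exact: trig_poly_cst.
- by move=> z; do 2 (apply: bernstein_norm_le => // ?).
move=> z z1 z2.
have close (x : R) (i : nat) : `|x| <= K -> `|x - K * theta i| <= C * `|i%:R / N%:R - p x|.
  move=> xK; have [_ /(_ (x / K))] := Htheta i.
  rewrite normrM normfV (gtr0_norm K0) ler_pdivrMr// mul1r => /(_ xK).
  have -> : sin (x / K) - (2 * (i%:R / N%:R) - 1) = - (2 * (i%:R / N%:R - p x)).
    by rewrite /p; field; rewrite pnatr_eq0 -lt0n NE.1.
  rewrite normrN normrM (ger0_norm (ler0n _ 2)) mulrC -ler_pdivlMr// => H.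
  rewrite (_ : x - K * theta i = K * (x / K - theta i)); last by field; rewrite gt_eqF.
  rewrite normrM (gtr0_norm K0) /C.
  rewrite (_ : 2 * K / cos 1 * _ = K * (2 * `|i%:R / N%:R - p x| / cos 1)); last by ring.
  by rewrite ler_wpM2l// ltW.
have far (x : R) (i : nat) : `|x| <= K -> delta <= `|x - K * theta i| ->
    2 * M <= D * (i%:R / N%:R - p x) ^+ 2.
  move=> xK dx; have H1 := le_trans dx (close x i xK).
  have : delta ^+ 2 <= (C * `|i%:R / N%:R - p x|) ^+ 2.
    by rewrite ler_sqr ?nnegrE ?(ltW d0)// (le_trans (ltW d0) H1).
  rewrite exprMn real_normK ?num_real// => H.
  have -> : D * (i%:R / N%:R - p x) ^+ 2 =
      2 * M * (C ^+ 2 * (i%:R / N%:R - p x) ^+ 2 / delta ^+ 2) by rewrite /D; ring.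
  by rewrite ler_peMr ?mulr_ge0// ler_pdivlMr ?mul1r// exprn_gt0.
have node_le i j : `|f z - f (K * theta i, K * theta j)| <=
    e / 2 + D * (i%:R / N%:R - p z.1) ^+ 2 + D * (j%:R / N%:R - p z.2) ^+ 2.
  have A0 x k : 0 <= D * (k%:R / N%:R - p x) ^+ 2 by rewrite mulr_ge0// sqr_ge0.
  have := A0 z.1 i; have := A0 z.2 j => A2 A1.
  have big : `|f z - f (K * theta i, K * theta j)| <= 2 * M.
    rewrite (le_trans (ler_normB _ _))//.
    by have := fM z; have := fM (K * theta i, K * theta j); lra.
  have [d1|d1] := ltP `|z.1 - K * theta i| delta; last first.
    by have := far _ _ z1 d1; lra.
  have [d2|d2] := ltP `|z.2 - K * theta j| delta; last first.
    by have := far _ _ z2 d2; lra.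
  by have := fdelta z (K * theta i, K * theta j) z1 z2 d1 d2; lra.
have q4 x : p x * (1 - p x) / N%:R <= N%:R^-1.
  rewrite ler_piMl ?invr_ge0//; have /andP[? ?] := p01 x.
  by rewrite mulr_ile1//; lra.
apply: (@le_trans _ _ (e / 2 + D * (p z.1 * (1 - p z.1) / N%:R) + D * (p z.2 * (1 - p z.2) / N%:R))).
  have E x (a : R) : a + D * (p x * (1 - p x) / N%:R) =
      bernstein N (p x) (fun i => a + D * (i%:R / N%:R - p x) ^+ 2).
    by rewrite bernsteinD bernsteinZ bernstein_cst bernstein_dist// NE.1.
  rewrite addrAC E; under eq_fun do rewrite addrAC E.
  by apply: bernstein_normB_le => // i; exact: bernstein_normB_le.
have := ler_wpM2l D0 (q4 z.1); have := ler_wpM2l D0 (q4 z.2).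
by case: NE => _; rewrite -mulrA; lra.
Qed.

End trig_polynomials.

(** * Weak convergence *)

Section integral_without_measurability.
Context {d} {T : measurableType d} {R : realType}.

(** The integral of a non-negative function is a supremum over the simple functions below it, so
    monotonicity holds for arbitrary functions. *)
Lemma ge0_le_integral_nomeas (mu : {measure set T -> \bar R}) (f g : T -> \bar R) :
  (forall x, 0 <= f x)%E -> (forall x, f x <= g x)%E ->
  (\int[mu]_x f x <= \int[mu]_x g x)%E.
Proof.
move=> f0 fg; have g0 x : (0 <= g x)%E by exact: le_trans (fg x).
rewrite !ge0_integralTE//; apply: le_ereal_sup => _ [h hf <-].
by exists h => // x; exact: le_trans (fg x).
Qed.

Lemma le_integral_nomeas (mu : {measure set T -> \bar R}) (f g : T -> \bar R) :
  (forall x, f x <= g x)%E -> (\int[mu]_x f x <= \int[mu]_x g x)%E.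
Proof.
move=> fg; rewrite integralE [leRHS]integralE.
apply: leeB; apply: ge0_le_integral_nomeas => x //.
  by rewrite !funeposE ge_max !le_max lexx fg orbT.
by rewrite !funenegE ge_max !le_max lexx leeN2 fg orbT.
Qed.

(** Additivity may fail for a non-measurable [f]. Its integral is therefore only squeezed between
    those of [h] minus and plus the measurable error [a + 2 * M * \1_E]. *)
Lemma integral_near (P : probability T R) (f h : T -> R) (E : set T) (M a e : R) :
  measurable E -> (P E <= e%:E)%E -> measurable_fun setT h ->
  (forall w, `|f w| <= M) -> (forall w, `|h w| <= M) -> 0 <= a ->
  (forall w, ~ E w -> `|f w - h w| <= a) ->
  ((\int[P]_w h w - (a + 2 * M * e))%:E <= \int[P]_w (f w)%:E)%E /\
  (\int[P]_w (f w)%:E <= (\int[P]_w h w + (a + 2 * M * e))%:E)%E.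
Proof.
move=> mE PE mh fM hM a0 fh.
have M0 : 0 <= M by exact: le_trans (fM point).
have Lh := L1_bounded P mh hM.
have LE : L1 P (\1_E : T -> R) by exact: integrable_indic.
have IE : \int[P]_w \1_E w <= e.
  by rewrite -lee_fin (L1_EFin LE) integral_indic// setIT.
have Lb : L1 P (fun w => a + 2 * M * \1_E w).
  by apply: L1D; [exact: L1_cst|exact: L1Z].
have Ib : \int[P]_w (a + 2 * M * \1_E w) <= a + 2 * M * e.
  rewrite RintegralD//; last 2 first.
  - exact: L1_cst.
  - exact: L1Z.
  by rewrite Rintegral_prob_cst RintegralZl// lerD2l ler_wpM2l// mulr_ge0.
have fhb w : `|f w - h w| <= a + 2 * M * \1_E w.
  rewrite indicE; have [wE|wE] := boolP (w \in E).
    rewrite mulr1 (le_trans (ler_normB _ _))//; have := fM w; have := hM w; lra.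
  rewrite mulr0 addr0; apply: fh => Ew; move: wE; rewrite notin_setE; exact.
split.
  apply: (@le_trans _ _ (\int[P]_w (h w - (a + 2 * M * \1_E w)))%:E).
    by rewrite lee_fin RintegralB// lerD2l lerN2.
  rewrite L1_EFin; last exact: L1B.
  apply: le_integral_nomeas => w; rewrite lee_fin.
  by have := fhb w; rewrite ler_distl => /andP[]; lra.
apply: (@le_trans _ _ (\int[P]_w (h w + (a + 2 * M * \1_E w)))%:E).
  rewrite L1_EFin; last exact: L1D.
  apply: le_integral_nomeas => w; rewrite lee_fin.
  by have := fhb w; rewrite ler_distl => /andP[]; lra.
by rewrite lee_fin RintegralD// lerD2l.
Qed.

(** Comparison with the zero function, the whole space being the exceptional set, bounds the
    integral on both sides by finite numbers. *)
Lemma integral_bounded_fin_num (P : probability T R) (f : T -> R) (M : R) :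
  (forall w, `|f w| <= M) -> (\int[P]_w (f w)%:E)%E \is a fin_num.
Proof.
move=> fM; have M0 : 0 <= M by exact: le_trans (fM point).
have P1 : (P setT <= 1%:E)%E by exact: probability_le1.
have f0 w : ~ setT w -> `|f w - 0| <= 0 by move=> /(_ I) [].
have h0 (w : T) : `|0 : R| <= M by rewrite normr0.
have := @integral_near P f (fun=> 0) setT M 0 1 measurableT P1 (measurable_cst _) fM h0 (lexx 0) f0.
by case: (\int[P]_w _)%E => [s| |] [] //; rewrite ?leye_eq ?leeNy_eq.
Qed.

End integral_without_measurability.

(** * Smallness in probability and tightness *)

Section stochastic_order.
Context {d} {T : measurableType d} {R : realType} (P : probability T R).
Implicit Types A B : nat -> T -> R.

(* The exceptional sets, and not the variables, are required to be measurable. *)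
Definition small_in_prob A := forall e : R, 0 < e -> \forall n \near \oo,
  exists2 E : set T, measurable E /\ (P E <= e%:E)%E & forall w, ~ E w -> `|A n w| <= e.

Definition tight A := forall e : R, 0 < e -> exists2 K : R, 0 < K &
  \forall n \near \oo, exists2 E : set T, measurable E /\ (P E <= e%:E)%E &
    forall w, ~ E w -> `|A n w| <= K.

Lemma prob_setU_le (E F : set T) (a b : R) : measurable E -> measurable F ->
  (P E <= a%:E)%E -> (P F <= b%:E)%E -> (P (E `|` F) <= (a + b)%:E)%E.
Proof.
move=> mE mF PE PF; rewrite (le_trans (measureU2 _ _ _))//.
by rewrite EFinD; exact: leeD.
Qed.

End stochastic_order.

Lemma measurable_norm_gt {d} {T : measurableType d} {R : realType} (X : T -> R) (a : R) :
  measurable_fun setT X -> measurable [set w | a < `|X w|].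
Proof.
move=> mX; have mX' : measurable_fun setT (fun w => `|X w|) by exact: measurableT_comp.
rewrite (_ : [set w | _] = setT `&` (fun w => `|X w|) @^-1` `]a, +oo[%classic).
  by apply: mX'.
by rewrite setTI; apply/seteqP; split => w /=; rewrite in_itv/= andbT.
Qed.

Lemma tight_cst {d} {T : measurableType d} {R : realType} (P : probability T R)
  (X : T -> R) : measurable_fun setT X -> tight P (fun=> X).
Proof.
move=> mX e e0; pose F (n : nat) := [set w | n%:R < `|X w|].
have mF n : measurable (F n) by exact: measurable_norm_gt.
have F0 : \bigcap_n F n = set0.
  apply/seteqP; split => // w /(_ (Num.truncn `|X w|).+1 I) /=.
  by rewrite /F/= ltNge ltW// truncnS_gt.
have /fine_cvgP[_ /cvgr0Pnorm_le/(_ _ e0) H] : (P \o F) @ \oo --> (0%:E : \bar R).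
  rewrite -[0%:E](measure0 P) -F0; apply: nonincreasing_cvg_mu => //.
  - by rewrite (le_lt_trans (probability_le1 _ _)) ?ltry.
  - exact: bigcap_measurable.
  - move=> n m nm; rewrite subsetEset => w /=; apply: le_lt_trans.
    by rewrite ler_nat.
have [N _ HN] := H; exists N.+1%:R => //.
apply: nearW => _; exists (F N.+1).
  split=> //; have := HN N.+1 (leqnSn _); rewrite /= ger0_norm ?fine_ge0//.
  by rewrite -lee_fin fineK// fin_num_measure.
by move=> w /negP; rewrite -leNgt.
Qed.

(** Chebyshev's inequality; the [+ 1] in [K] keeps it positive when [v = 0]. *)
Lemma tight_second_moment {d} {T : measurableType d} {R : realType}
  (P : probability T R) (A : nat -> T -> R) (v : R) :
  (forall n, measurable_fun setT (A n)) ->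
  (\forall n \near \oo, L1 P (fun w => A n w ^+ 2) /\ \int[P]_w (A n w ^+ 2) <= v) ->
  tight P A.
Proof.
move=> mA A2 e e0; pose K := Num.sqrt ((`|v| + 1) / e).
have K20 : 0 < (`|v| + 1) / e by rewrite divr_gt0// ltr_wpDl.
have K0 : 0 < K by rewrite sqrtr_gt0.
have K2 : K ^+ 2 = (`|v| + 1) / e by rewrite sqr_sqrtr// ltW.
exists K => //; apply: filterS A2 => n [L2 Iv].
exists [set w | K < `|A n w|]; last by move=> w /negP; rewrite -leNgt.
have mE : measurable [set w | K < `|A n w|] by exact: measurable_norm_gt.
split=> //; rewrite -[X in P X]setIT -integral_indic//.
have LE : L1 P (\1_[set w | K < `|A n w|] : T -> R) by exact: integrable_indic.
rewrite -(L1_EFin LE) lee_fin.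
apply: (@le_trans _ _ (\int[P]_w ((K ^+ 2)^-1 * A n w ^+ 2))).
  apply: le_Rintegral => //; first exact: L1Z.
  move=> w _; rewrite indicE; have [/set_mem/= Kw|_] := boolP (w \in _); last first.
    by rewrite mulr_ge0 ?invr_ge0 ?sqr_ge0.
  rewrite ler_pdivlMl ?mulr1 ?exprn_gt0// -(real_normK (num_real (A n w))).
  by rewrite ler_sqr ?nnegrE ?(ltW K0)// ltW.
rewrite RintegralZl// ler_pdivrMl ?exprn_gt0// K2 divfK ?gt_eqF//.
by rewrite (le_trans Iv)// (le_trans (ler_norm _))// lerDl.
Qed.

Lemma cvg_EFin_squeeze {R : realType} (x : nat -> \bar R) (r : R) :
  (forall e : R, 0 < e -> \forall n \near \oo,
    ((r - e)%:E <= x n)%E /\ (x n <= (r + e)%:E)%E) -> x @ \oo --> r%:E.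
Proof.
move=> H; have fin e y : ((r - e)%:E <= y)%E -> (y <= (r + e)%:E)%E -> y \is a fin_num.
  by case: y => [s| |] //; rewrite ?leye_eq ?leeNy_eq.
apply/fine_cvgP; split.
  by apply: filterS (H 1 ltr01) => n [h1 h2]; exact: fin h1 h2.
apply/cvgrPdist_le => e e0; apply: filterS (H e e0) => n [h1 h2].
have f := fin _ _ h1 h2; rewrite distrC ler_distl -!lee_fin /= fineK//.
by rewrite h1 h2.
Qed.

Section weak_convergence.
Context {d} {T : measurableType d} {R : realType} (P : probability T R)
  (nu : probability (R * R)%type R) (L Z : nat -> T -> R * R).
Hypothesis mL1 : forall n, measurable_fun setT (fun w => (L n w).1).
Hypothesis mL2 : forall n, measurable_fun setT (fun w => (L n w).2).

Lemma measurable_cos2 {d'} {S : measurableType d'} (f g : S -> R) (t1 t2 c : R) :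
  measurable_fun setT f -> measurable_fun setT g ->
  measurable_fun setT (fun w => cos (t1 * f w + t2 * g w + c)).
Proof.
move=> mf mg.
have := measurableT_comp (measurable_trig 1 c).1
  (measurable_funD (measurable_funM (measurable_cst t1) mf) (measurable_funM (measurable_cst t2) mg)).
by under eq_fun do rewrite /= mul1r.
Qed.

Lemma measurable_trig_poly {d'} {S : measurableType d'} (f : S -> R * R) g :
  measurable_fun setT (fun w => (f w).1) -> measurable_fun setT (fun w => (f w).2) ->
  trig_poly g -> measurable_fun setT (fun w => g (f w)).
Proof.
move=> m1 m2; elim => [t1 t2 c|g1 g2 _ H1 _ H2|a g1 _ H1].
- exact: (measurable_cos2 t1 t2 c m1 m2).
- exact: measurable_funD.
- exact: measurable_funM.
Qed.

Lemma trig_poly_bounded (g : R * R -> R) : trig_poly g ->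
  exists M, forall z, `|g z| <= M.
Proof.
elim => [t1 t2 c|g1 g2 _ [M1 H1] _ [M2 H2]|a g1 _ [M1 H1]].
- by exists 1 => z; exact: cos_max.
- by exists (M1 + M2) => z; rewrite (le_trans (ler_normD _ _))// lerD.
- by exists (`|a| * M1) => z; rewrite normrM ler_wpM2l.
Qed.

Lemma L1_trig_poly {d'} {S : measurableType d'} (Q : probability S R) (f : S -> R * R) g :
  measurable_fun setT (fun w => (f w).1) -> measurable_fun setT (fun w => (f w).2) ->
  trig_poly g -> L1 Q (fun w => g (f w)).
Proof.
move=> m1 m2 tg; have [M gM] := trig_poly_bounded tg.
by apply: (L1_bounded Q (M := M)) => //; exact: measurable_trig_poly.
Qed.

Hypothesis cvg_cos : forall t1 t2 c : R,
  (fun n => \int[P]_w cos (t1 * (L n w).1 + t2 * (L n w).2 + c)) @ \oo -->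
  \int[nu]_z cos (t1 * z.1 + t2 * z.2 + c).

Lemma cvg_trig_poly g : trig_poly g ->
  (fun n => \int[P]_w g (L n w)) @ \oo --> \int[nu]_z g z.
Proof.
elim => [t1 t2 c|g1 g2 t1 H1 t2 H2|a g1 t1 H1]; first exact: cvg_cos.
- rewrite (RintegralD _ (f1 := g1) (f2 := g2))//; last 2 first.
  + by apply: (@L1_trig_poly _ _ nu id); [exact: measurable_fst|exact: measurable_snd|].
  + by apply: (@L1_trig_poly _ _ nu id); [exact: measurable_fst|exact: measurable_snd|].
  under eq_fun do rewrite RintegralD ?L1_trig_poly//.
  exact: cvgD.
- rewrite (RintegralZl _ (f := g1))//; last by apply: (@L1_trig_poly _ _ nu id); [exact: measurable_fst|exact: measurable_snd|].
  under eq_fun do rewrite RintegralZl ?L1_trig_poly//.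
  by apply: cvgM => //; exact: cvg_cst.
Qed.

Hypothesis tightL1 : tight P (fun n w => (L n w).1).
Hypothesis tightL2 : tight P (fun n w => (L n w).2).
Hypothesis small1 : small_in_prob P (fun n w => (Z n w).1 - (L n w).1).
Hypothesis small2 : small_in_prob P (fun n w => (Z n w).2 - (L n w).2).

(** The mean of [f (Z n)] is compared with that of [g (L n)], then with the integrals of [g] and of
    [f] under [nu], where [g] is a trigonometric polynomial close to [f] on a box carrying most of
    the mass of [L n] and of [nu]. *)
Lemma cvg_in_distribution2_trig : cvg_in_distribution2 P Z nu.
Proof.
move=> f cf [M fM].
have M0 : 0 <= M by exact: le_trans (fM (0, 0)).
have tnu1 := tight_cst nu (@measurable_fst _ _ _ _).
have tnu2 := tight_cst nu (@measurable_snd _ _ _ _).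
rewrite -(fineK (integral_bounded_fin_num nu fM)).
set r := fine _; apply: cvg_EFin_squeeze => e e0.
(* Budget: [e1 + 4 * M * e1] for replacing [f] by [g] under [nu], with two exceptional sets;
   [2 * e1 + 8 * M * e1] for replacing [f (Z n)] by [g (L n)], with four; and [e1] for the
   convergence of the integrals of [g]. *)
pose e1 := e / (4 + 12 * M).
have M4 : 0 < 4 + 12 * M by rewrite ltr_wpDr// mulr_ge0.
have e10 : 0 < e1 by rewrite divr_gt0.
have e1E : e = 4 * e1 + 12 * M * e1 by rewrite /e1; field; rewrite gt_eqF.
have [K1 K10 HK1] := tightL1 e10; have [K2 K20 HK2] := tightL2 e10.
have [K3 K30 HK3] := tnu1 _ e10; have [K4 K40 HK4] := tnu2 _ e10.
pose K := K1 + K2 + K3 + K4.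
have K0 : 0 < K by rewrite !addr_gt0.
have [g [tg gM fg]] := trig_poly_approx cf fM K0 e10.
have [delta d0 fdelta] := continuous_unif_box K cf e10.
(* [small_in_prob] uses one number for size and probability: [delta / 2] gives the strict closeness
   that [fdelta] asks for, [e1] bounds the exceptional probability. *)
have d20 : 0 < Num.min (delta / 2) e1 by rewrite lt_min divr_gt0.
have [_ [E3 [mE3 PE3] E3K]] := filter_ex HK3.
have [_ [E4 [mE4 PE4] E4K]] := filter_ex HK4.
have mg : measurable_fun setT (g : R * R -> R).
  by apply: (@measurable_trig_poly _ _ id) => //; [exact: measurable_fst|exact: measurable_snd].
have [nu1 nu2] : ((\int[nu]_z g z - (e1 + 2 * M * (e1 + e1)))%:E <= r%:E)%E /\
    (r%:E <= (\int[nu]_z g z + (e1 + 2 * M * (e1 + e1)))%:E)%E.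
  rewrite fineK; last exact: integral_bounded_fin_num fM.
  apply: (integral_near (E := E3 `|` E4)) => //.
  - exact: measurableU.
  - exact: prob_setU_le.
  - exact: ltW.
  - move=> z /not_orP[/E3K z1 /E4K z2]; apply: fg.
      by rewrite (le_trans z1)// /K; lra.
    by rewrite (le_trans z2)// /K; lra.
have /cvgrPdist_le/(_ _ e10) cg := cvg_trig_poly tg.
apply: filterS (filterI HK1 (filterI HK2 (filterI (small1 d20)
  (filterI (small2 d20) cg)))) => n.
move=> [[E1 [mE1 PE1] E1K] [[E2 [mE2 PE2] E2K] [[E5 [mE5 PE5] E5K] [[E6 [mE6 PE6] E6K] cgn]]]].
have PE5' : (P E5 <= e1%:E)%E.
  by rewrite (le_trans PE5)// lee_fin ge_min lexx orbT.
have PE6' : (P E6 <= e1%:E)%E.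
  by rewrite (le_trans PE6)// lee_fin ge_min lexx orbT.
have mgL : measurable_fun setT (fun w => g (L n w)) by exact: measurable_trig_poly.
have mE : measurable (E1 `|` E2 `|` (E5 `|` E6)).
  by apply: measurableU; exact: measurableU.
have PE : (P (E1 `|` E2 `|` (E5 `|` E6)) <= (e1 + e1 + (e1 + e1))%:E)%E.
  by apply: prob_setU_le; [exact: measurableU|exact: measurableU|
    exact: prob_setU_le|exact: prob_setU_le].
have near w : ~ (E1 `|` E2 `|` (E5 `|` E6)) w -> `|f (Z n w) - g (L n w)| <= e1 + e1.
  move=> /not_orP[/not_orP[/E1K w1 /E2K w2] /not_orP[/E5K w5 /E6K w6]].
  have L1K : `|(L n w).1| <= K by rewrite (le_trans w1)// /K; lra.
  have L2K : `|(L n w).2| <= K by rewrite (le_trans w2)// /K; lra.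
  have dd : Num.min (delta / 2) e1 < delta.
    by rewrite (@le_lt_trans _ _ (delta / 2))// ?ge_min ?lexx//; lra.
  rewrite (_ : _ - _ = (f (Z n w) - f (L n w)) + (f (L n w) - g (L n w))); last by ring.
  rewrite (le_trans (ler_normD _ _))// lerD//; last exact: fg.
  rewrite distrC fdelta// distrC.
    exact: le_lt_trans w5 _.
  exact: le_lt_trans w6 _.
have e1e1 : 0 <= e1 + e1 by rewrite addr_ge0// ltW.
have [n1 n2] := integral_near mE PE mgL (fun w => fM (Z n w)) (fun w => gM (L n w)) e1e1 near.
rewrite unlock; rewrite !lee_fin in nu1 nu2.
move: cgn; rewrite ler_distl => /andP[c1 c2].
split; [apply: le_trans n1|apply: (le_trans n2)]; rewrite lee_fin; lra.
Qed.

End weak_convergence.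

(** * The delta method *)

Section stochastic_calculus.
Context {d} {T : measurableType d} {R : realType} (P : probability T R).
Implicit Types A B alpha beta : nat -> T -> R.

Local Notation small := (small_in_prob P).
Local Notation tight := (tight P).

Lemma small_near A B : (\forall n \near \oo, forall w, A n w = B n w) ->
  small A -> small B.
Proof.
move=> AB sA e e0; apply: filterS (filterI AB (sA e e0)) => n [ABn [E HE EA]].
by exists E => // w /EA; rewrite ABn.
Qed.

Lemma small_cst0 : small (fun _ _ => 0).
Proof.
move=> e e0; apply: nearW => _; exists set0 => [|w _]; last by rewrite normr0 ltW.
by rewrite measure0 lee_fin ltW.
Qed.

Lemma small_tight A : small A -> tight A.
Proof. by move=> sA e e0; exists e => //; exact: sA. Qed.

Lemma tight_prob_cst (a : R) : tight (fun _ _ => a).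
Proof.
move=> e e0; exists (`|a| + 1); first by rewrite ltr_wpDl.
apply: nearW => _; exists set0 => [|w _]; last by rewrite lerDl.
by rewrite measure0 lee_fin ltW.
Qed.

Lemma smallD A B : small A -> small B -> small (fun n w => A n w + B n w).
Proof.
move=> sA sB e e0; have e2 : 0 < e / 2 by rewrite divr_gt0.
apply: filterS (filterI (sA _ e2) (sB _ e2)) => n [[E [mE PE] EA] [F [mF PF] FB]].
exists (E `|` F).
  by split; [exact: measurableU|rewrite (splitr e); exact: prob_setU_le].
move=> w /not_orP[/EA Aw /FB Bw]; rewrite (splitr e) (le_trans (ler_normD _ _))//.
exact: lerD.
Qed.

Lemma tightD A B : tight A -> tight B -> tight (fun n w => A n w + B n w).
Proof.
move=> tA tB e e0; have e2 : 0 < e / 2 by rewrite divr_gt0.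
have [K K0 tK] := tA _ e2; have [K' K0' tK'] := tB _ e2.
exists (K + K'); first exact: addr_gt0.
apply: filterS (filterI tK tK') => n [[E [mE PE] EA] [F [mF PF] FB]].
exists (E `|` F).
  by split; [exact: measurableU|rewrite (splitr e); exact: prob_setU_le].
move=> w /not_orP[/EA Aw /FB Bw]; rewrite (le_trans (ler_normD _ _))//.
exact: lerD.
Qed.

Lemma tightM A B : tight A -> tight B -> tight (fun n w => A n w * B n w).
Proof.
move=> tA tB e e0; have e2 : 0 < e / 2 by rewrite divr_gt0.
have [K K0 tK] := tA _ e2; have [K' K0' tK'] := tB _ e2.
exists (K * K'); first exact: mulr_gt0.
apply: filterS (filterI tK tK') => n [[E [mE PE] EA] [F [mF PF] FB]].
exists (E `|` F).
  by split; [exact: measurableU|rewrite (splitr e); exact: prob_setU_le].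
by move=> w /not_orP[/EA Aw /FB Bw]; rewrite normrM ler_pM.
Qed.

Lemma small_tightM A B : tight A -> small B -> small (fun n w => A n w * B n w).
Proof.
move=> tA sB e e0; have e2 : 0 < e / 2 by rewrite divr_gt0.
have [K K0 tK] := tA _ e2.
have e3 : 0 < Num.min (e / 2) (e / K) by rewrite lt_min !divr_gt0.
apply: filterS (filterI tK (sB _ e3)) => n [[E [mE PE] EA] [F [mF PF] FB]].
exists (E `|` F).
  split; first exact: measurableU.
  rewrite (splitr e); apply: prob_setU_le => //.
  by rewrite (le_trans PF)// lee_fin ge_min lexx.
move=> w /not_orP[/EA Aw /FB Bw]; rewrite normrM.
have -> : e = K * (e / K) by field; rewrite gt_eqF.
by rewrite ler_pM// (le_trans Bw)// ge_min lexx orbT.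
Qed.

Lemma smallZ a A : small A -> small (fun n w => a * A n w).
Proof. exact/small_tightM/tight_prob_cst. Qed.

Lemma tightZ a A : tight A -> tight (fun n w => a * A n w).
Proof. exact/tightM/tight_prob_cst. Qed.

(* First-order stochastic expansion [A_n = a + alpha_n / sqrt n + o_P(1 / sqrt n)]
   with [alpha_n = O_P(1)]. *)
Definition expands A (a : R) alpha := tight alpha /\
  small (fun n w => Num.sqrt n%:R * (A n w - a) - alpha n w).

Lemma expands_tight A a alpha : expands A a alpha ->
  tight (fun n w => Num.sqrt n%:R * (A n w - a)).
Proof.
move=> [ta sA]; have := tightD ta (small_tight sA).
by under eq_fun do under eq_fun do rewrite addrC subrK.
Qed.

(** For [n > 0] the difference is the tight sequence [sqrt n * (A n - a)] times [1 / sqrt n]. *)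
Lemma expands_small A a alpha : expands A a alpha -> small (fun n w => A n w - a).
Proof.
move=> /expands_tight tA.
have si : small (fun n _ => (Num.sqrt n%:R)^-1).
  move=> e e0; near=> n; exists set0; first by rewrite measure0 lee_fin ltW.
  have n0 : (0 < n)%N by near: n; exists 1%N.
  move=> _ _; rewrite ger0_norm ?invr_ge0 ?sqrtr_ge0//.
  rewrite -[leRHS]invrK lef_pV2 ?posrE ?sqrtr_gt0 ?ltr0n ?invr_gt0//.
  rewrite -[leLHS]ger0_norm ?invr_ge0 ?(ltW e0)// -sqrtr_sqr ler_wsqrtr//.
  by near: n; exact: nbhs_infty_ger.
apply: small_near (small_tightM tA si); exists 1%N => // n /= n0 w.
by rewrite mulrAC divff ?mul1r// sqrtr_eq0 -ltNge ltr0n.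
Unshelve. all: by end_near. Qed.

Lemma expands_ext A A' a a' alpha alpha' :
  (\forall n \near \oo, forall w, A n w = A' n w) -> a = a' ->
  (forall n w, alpha n w = alpha' n w) -> expands A a alpha -> expands A' a' alpha'.
Proof.
move=> AA' <- aa'; rewrite (_ : alpha' = alpha); last by apply/funext => n; apply/funext => w.
move=> [ta sA]; split=> //; apply: small_near sA.
by apply: filterS AA' => n H w; rewrite H.
Qed.

Lemma expands_cst (a : R) : expands (fun _ _ => a) a (fun _ _ => 0).
Proof.
split; first exact: tight_prob_cst.
apply: small_near small_cst0; apply: nearW => n w.
by rewrite subrr mulr0 subr0.
Qed.

Lemma expandsD A B a b alpha beta : expands A a alpha -> expands B b beta ->
  expands (fun n w => A n w + B n w) (a + b) (fun n w => alpha n w + beta n w).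
Proof.
move=> [ta sa] [tb sb]; split; first exact: tightD.
by apply: small_near (smallD sa sb); apply: nearW => n w; ring.
Qed.

(** The error of the product is [a (B - b) + b (A - a) + (A - a) (B - b)]; after scaling by [sqrt n]
    the last term is tight times small. *)
Lemma expandsM A B a b alpha beta : expands A a alpha -> expands B b beta ->
  expands (fun n w => A n w * B n w) (a * b) (fun n w => a * beta n w + b * alpha n w).
Proof.
move=> eA eB; have sB := expands_small eB; have tA := expands_tight eA.
case: eA eB => [ta sa] [tb sb]; split.
  by apply: tightD; exact: tightZ.
apply: small_near (smallD (smallD (smallZ a sb) (smallZ b sa)) (small_tightM tA sB)).
by apply: nearW => n w; ring.
Qed.

Lemma expandsZ A a c alpha : expands A a alpha ->
  expands (fun n w => c * A n w) (c * a) (fun n w => c * alpha n w).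
Proof.
move=> eA; apply: expands_ext (expandsM (expands_cst c) eA) => //.
  exact: nearW.
by move=> n w; rewrite mulr0 addr0.
Qed.

Lemma expandsX A a k alpha : expands A a alpha ->
  expands (fun n w => A n w ^+ k.+1) (a ^+ k.+1) (fun n w => k.+1%:R * a ^+ k * alpha n w).
Proof.
move=> eA; elim: k => [|k IHk].
  apply: expands_ext eA; first by apply: nearW => n w; rewrite expr1.
    by rewrite expr1.
  by move=> n w; rewrite expr0 !mul1r.
apply: expands_ext (expandsM eA IHk).
- by apply: nearW => n w; rewrite -exprS.
- by rewrite -exprS.
- by move=> n w; rewrite -[in RHS]natr1 !exprS; ring.
Qed.

Lemma is_derive_remainder (g : R -> R) (a g' e : R) : is_derive a (1 : R) g g' -> 0 < e ->
  exists2 delta : R, 0 < delta & forall x, `|x - a| <= delta ->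
    `|g x - g a - g' * (x - a)| <= e * `|x - a|.
Proof.
move=> [dg g'E] e0.
have /cvgrPdist_le/(_ _ e0)/nbhs_ballP[delta /= d0 H] :
    (fun h : R => h^-1 *: ((g \o shift a) (h *: (1 : R)) - g a)) @ 0^' --> g'.
  by rewrite -g'E; exact: dg.
exists (delta / 2); first by rewrite divr_gt0.
move=> x xa; have [->|xa0] := eqVneq x a; first by rewrite !subrr mulr0 subr0 normr0 mulr0.
have xa1 : x - a != 0 by rewrite subr_eq0.
have := H (x - a); rewrite -ball_normE /= sub0r normrN => /(_ _ xa1).
rewrite /GRing.scale/= mulr1 subrK => H1.
have {}H1 : `|g' - (x - a)^-1 * (g x - g a)| <= e by apply: H1; lra.
rewrite (_ : _ - _ - _ = - ((g' - (x - a)^-1 * (g x - g a)) * (x - a))); last by field.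
by rewrite normrN normrM ler_wpM2r.
Qed.

(** The delta method in one variable, from differentiability at the point [a] alone: the scaled
    remainder is at most [e / K] times [sqrt n * |A n - a|], which is at most [K] off a set of small
    probability. *)
Lemma expands_comp (g : R -> R) A a g' alpha : is_derive a (1 : R) g g' ->
  expands A a alpha -> expands (fun n w => g (A n w)) (g a) (fun n w => g' * alpha n w).
Proof.
move=> dg eA; have tA := expands_tight eA; have sA := expands_small eA.
case: eA => [ta sa]; split; first exact: tightZ.
pose rem n w := Num.sqrt n%:R * (g (A n w) - g a - g' * (A n w - a)).
suff srem : small rem.
  by apply: small_near (smallD (smallZ g' sa) srem); apply: nearW => n w; rewrite /rem; ring.
move=> e e0; have e2 : 0 < e / 2 by rewrite divr_gt0.
have [K K0 tK] := tA _ e2; have eK : 0 < e / K by rewrite divr_gt0.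
have [delta d0 H] := is_derive_remainder dg eK.
have e3 : 0 < Num.min (e / 2) delta by rewrite lt_min divr_gt0.
apply: filterS (filterI tK (sA _ e3)) => n [[E [mE PE] EA] [F [mF PF] FB]].
exists (E `|` F).
  split; first exact: measurableU.
  rewrite (splitr e); apply: prob_setU_le => //.
  by rewrite (le_trans PF)// lee_fin ge_min lexx.
move=> w /not_orP[/EA Aw /FB Bw]; rewrite /rem normrM.
rewrite (le_trans (ler_wpM2l _ (H _ (le_trans Bw _))))//.
  by rewrite ge_min lexx orbT.
rewrite [leRHS](_ : e = (e / K) * K); last by field; rewrite gt_eqF.
by rewrite mulrCA -normrM ler_wpM2l// ltW.
Qed.

Lemma expandsV A a alpha : a != 0 -> expands A a alpha ->
  expands (fun n w => (A n w)^-1) a^-1 (fun n w => - a ^- 2 * alpha n w).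
Proof.
move=> a0; apply: (@expands_comp (fun x => x^-1)).
by rewrite -[- a ^- 2]mulr1; exact: (@is_deriveV _ id).
Qed.

Lemma expands_sqrt A a alpha : 0 < a -> expands A a alpha ->
  expands (fun n w => Num.sqrt (A n w)) (Num.sqrt a)
    (fun n w => (2 * Num.sqrt a)^-1 * alpha n w).
Proof. by move=> a0; apply: expands_comp; exact: is_derive1_sqrt. Qed.

End stochastic_calculus.

(** * Second moments and bivariate normal laws *)

Section second_moment.
Context {d0 d d'} {T0 : measurableType d0} {T : measurableType d}
  {T' : measurableType d'} {R : realType}.
Variables (P0 : probability T0 R) (P : probability T R) (Z0 : T0 -> T') (Z : nat -> T -> T').
Hypothesis mZ0 : measurable_fun setT Z0.
Hypothesis mZ : forall i, measurable_fun setT (Z i).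
Hypothesis iidZ : iid_copies P0 Z0 P Z.
Variable psi : T' -> R.
Hypothesis mpsi : measurable_fun setT psi.
Hypothesis L1psi : L1 P0 (psi \o Z0).
Hypothesis L2psi : L1 P0 (fun w => psi (Z0 w) ^+ 2).
Hypothesis mean0 : \int[P0]_w psi (Z0 w) = 0.

Lemma uncorrelated (i j : nat) :
  L1 P (fun w => psi (Z i w) * psi (Z j w)) /\
  \int[P]_w (psi (Z i w) * psi (Z j w)) =
  if i == j then \int[P0]_w (psi (Z0 w) ^+ 2) else 0.
Proof.
have [ind same] := iidZ.
have msqr : measurable_fun setT (fun z => psi z ^+ 2) by exact: measurable_funX.
have [->|ij] := eqVneq i j.
  by have := same_law_Rintegral mZ0 (mZ j) (same j) msqr L2psi.
have Lpsi k : L1 P (psi \o Z k) := (same_law_Rintegral mZ0 (mZ k) (same k) mpsi L1psi).1.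
have Ipsi k : \int[P]_w psi (Z k w) = 0.
  by rewrite (same_law_Rintegral mZ0 (mZ k) (same k) mpsi L1psi).2.
(* A pair becomes a product over an initial segment of the sequence, with 1 at all places other than
   [i] and [j]. *)
pose g k := if k == i then psi else if k == j then psi else fun=> 1.
pose n := (maxn i j).+1.
have ni : (i < n)%N by rewrite ltnS leq_maxl.
have nj : (j < n)%N by rewrite ltnS leq_maxr.
have prodg (F : nat -> (T' -> R) -> R) : (forall k, F k (fun=> 1) = 1) ->
    \prod_(k < n) F k (g k) = F i psi * F j psi.
  move=> F1; rewrite (bigD1 (Ordinal ni))//= (bigD1 (Ordinal nj))/=; last first.
    by rewrite eq_sym.
  rewrite big1 ?mulr1 => [|k /andP[ki kj]]; first by rewrite /g eqxx [j == i]eq_sym (negbTE ij) eqxx.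
  by rewrite /g !ifF//; [apply/negbTE|apply/negbTE].
have [||L I] := @independent_prod _ _ _ _ _ P Z mZ ind n g.
- by move=> k; rewrite /g; case: ifP => // _; case: ifP.
- move=> k; rewrite /g; case: ifP => // _; case: ifP => // _; exact: L1_cst.
have E w : \prod_(k < n) g k (Z k w) = psi (Z i w) * psi (Z j w).
  exact: (prodg (fun k e => e (Z k w))).
split; first by move: L; under eq_fun do rewrite E.
move: I; under eq_Rintegral do rewrite E.
move=> ->; rewrite (prodg (fun k e => \int[P]_w e (Z k w))).
  by rewrite !Ipsi mulr0.
by move=> k; exact: Rintegral_prob_cst.
Qed.

Lemma second_moment_sum (n : nat) :
  L1 P (fun w => ((Num.sqrt n.+1%:R)^-1 * \sum_(i < n.+1) psi (Z i w)) ^+ 2) /\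
  \int[P]_w (((Num.sqrt n.+1%:R)^-1 * \sum_(i < n.+1) psi (Z i w)) ^+ 2) =
  \int[P0]_w (psi (Z0 w) ^+ 2).
Proof.
have E w : ((Num.sqrt n.+1%:R)^-1 * \sum_(i < n.+1) psi (Z i w)) ^+ 2 =
    n.+1%:R^-1 * \sum_(i < n.+1) \sum_(j < n.+1) psi (Z i w) * psi (Z j w).
  by rewrite exprMn exprVn sqr_sqrtr ?ler0n// expr2 big_distrlr.
have L i : L1 P (fun w => \sum_(j < n.+1) psi (Z i w) * psi (Z j w)).
  by apply: L1_sum => j; exact: (uncorrelated i j).1.
under eq_fun do rewrite E.
split; first by apply: L1Z; apply: L1_sum => i; exact: L.
rewrite RintegralZl//; last by apply: L1_sum => i; exact: L.
rewrite Rintegral_sum; last by move=> i; exact: L.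
transitivity (n.+1%:R^-1 * \sum_(i < n.+1) \int[P0]_w (psi (Z0 w) ^+ 2)).
  congr (_ * _); apply: eq_bigr => i _.
  rewrite Rintegral_sum; last by move=> j; exact: (uncorrelated i j).1.
  rewrite (bigD1 i)//= (uncorrelated i i).2 eqxx big1 ?addr0// => j ji.
  by rewrite (uncorrelated i j).2 ifF//; apply/negbTE; rewrite eq_sym.
by rewrite sumr_const card_ord -[X in _ * X]mulr_natl mulKf// pnatr_eq0.
Qed.

Lemma tight_clt_sum :
  tight P (fun n w => (Num.sqrt n%:R)^-1 * \sum_(i < n) psi (Z i w)).
Proof.
apply: (@tight_second_moment _ _ _ _ _ (\int[P0]_w (psi (Z0 w) ^+ 2))).
  move=> n; apply: measurable_funM => //; apply: measurable_sum => i.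
  exact: measurableT_comp.
by exists 1%N => // -[//|n] _ /=; have [L ->] := second_moment_sum n.
Qed.

End second_moment.

Section bivariate_normal.
Context {R : realType}.
Local Notation N01 := (normal_prob (0 : R) 1).

(** Fubini and two uses of the one-dimensional formula: in the inner integral [s1 * x + c] acts as
    the phase. *)
Lemma Rintegral_normal2_cos (s1 s2 c : R) :
  \int[(N01 \x N01)%E]_z cos (s1 * z.1 + s2 * z.2 + c) =
  expR (- (s1 ^+ 2 + s2 ^+ 2) / 2) * cos c.
Proof.
have mc : measurable_fun setT (fun z : R * R => cos (s1 * z.1 + s2 * z.2 + c)).
  by apply: measurable_cos2; [exact: measurable_fst|exact: measurable_snd].
have Lc : L1 (N01 \x N01)%E (fun z : R * R => cos (s1 * z.1 + s2 * z.2 + c)).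
  by apply: (@L1_bounded _ _ _ (N01 \x N01)%E _ 1) => // z; exact: cos_max.
rewrite /Rintegral -integral12_prod_meas1//.
have L1c (s e : R) : L1 N01 (fun x => cos (s * x + e)).
  apply: (@L1_bounded _ _ _ N01 _ 1); first by have [] := measurable_trig s e.
  by move=> x; exact: cos_max.
transitivity (\int[N01]_x (expR (- s2 ^+ 2 / 2) * cos (s1 * x + c))); last first.
  rewrite RintegralZl// Rintegral_normal_cos mulrA -expRD.
  by congr (expR _ * _); ring.
congr fine; apply: eq_integral => x _; rewrite /fubini_F -Rintegral_normal_cos.
rewrite (L1_EFin (L1c _ _)); apply: eq_integral => y _ /=.
by congr (cos _)%:E; ring.
Qed.

Lemma normal2_of_factor (L : 'M[R]_2) : exists nu : probability (R * R)%type R,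
  is_normal2 0 (L *m L^T) nu /\
  forall t1 t2 c, \int[nu]_z cos (t1 * z.1 + t2 * z.2 + c) =
    expR (- ((t1 * L 0 0 + t2 * L 1 0) ^+ 2 + (t1 * L 0 1 + t2 * L 1 1) ^+ 2) / 2) * cos c.
Proof.
pose phi (z : measurableTypeR R * measurableTypeR R) : R * R :=
  (L 0 0 * z.1 + L 0 1 * z.2, L 1 0 * z.1 + L 1 1 * z.2).
have mphi : measurable_fun setT phi.
  by apply/measurable_fun_pairP; split; apply: measurable_funD; apply: measurable_funM.
pose phiM := isMeasurableFun.Build _ _ _ _ phi mphi.
pose phiP : {mfun (measurableTypeR R * measurableTypeR R)%type >-> (R * R)%type} :=
  MeasurableFun.Pack (MeasurableFun.Class phiM).
pose nu := [the probability (R * R)%type R of distribution (N01 \x N01)%E phiP].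
exists nu; split.
  exists L; first by [].
  move=> B mB; apply: (congr1 (N01 \x N01)%E).
  by apply/seteqP; split => z; rewrite /phi /= !mxE !add0r.
move=> t1 t2 c.
have mc : measurable_fun setT (fun z : R * R => cos (t1 * z.1 + t2 * z.2 + c)).
  by apply: measurable_cos2; [exact: measurable_fst|exact: measurable_snd].
rewrite -Rintegral_normal2_cos; congr fine.
rewrite /nu/= integral_distribution//.
- by apply: eq_integral => z _ /=; congr (cos _)%:E; ring.
- exact/measurable_EFinP.
- apply: (@L1_bounded _ _ _ (N01 \x N01)%E (fun z => cos (t1 * (phi z).1 + t2 * (phi z).2 + c)) 1).
    exact: measurableT_comp mc mphi.
  by move=> z; exact: cos_max.
Qed.

End bivariate_normal.

(** The Cholesky factor, with diagonal entries the roots of [a] and of the Schur complement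
    [c - b ^+ 2 / a]. If [a = 0], positivity forces [b = 0], and division by zero gives the entry 0
    that is wanted. *)
Lemma psd2_factor {R : realType} (S : 'M[R]_2) : S 0 1 = S 1 0 ->
  (forall t1 t2, 0 <= t1 ^+ 2 * S 0 0 + 2 * t1 * t2 * S 0 1 + t2 ^+ 2 * S 1 1) ->
  exists L : 'M[R]_2, L *m L^T = S.
Proof.
move=> sym psd; set a := S 0 0; set b := S 0 1; set c := S 1 1.
have a0 : 0 <= a by have := psd 1 0; rewrite -/a -/b -/c; lra.
have c0 : 0 <= c by have := psd 0 1; rewrite -/a -/b -/c; lra.
have b0 : a = 0 -> b = 0.
  move=> aE; apply/eqP; apply: contraT => bn0.
  (* For [a = 0] this choice of [t1] makes the form equal to -1. *)
  have := psd (- (c + 1) / (2 * b)) 1; rewrite -/a -/b -/c aE.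
  rewrite (_ : _ + _ = -1); last by field.
  by rewrite ler0N1.
have d0 : 0 <= c - b ^+ 2 / a.
  have [aE|an0] := eqVneq a 0; first by rewrite b0// expr0n mul0r subr0.
  (* This [t1] minimizes the form at [t2 = 1]; the minimum is the Schur complement. *)
  have := psd (- b / a) 1; rewrite -/a -/b -/c.
  by rewrite (_ : _ + _ = c - b ^+ 2 / a)//; field.
exists (\matrix_(i, j) if i == 0 then (if j == 0 then Num.sqrt a else 0)
  else (if j == 0 then b / Num.sqrt a else Num.sqrt (c - b ^+ 2 / a))).
have sa : Num.sqrt a * Num.sqrt a = a by rewrite -expr2 sqr_sqrtr.
have sab : Num.sqrt a * (b / Num.sqrt a) = b.
  have [aE|an0] := eqVneq a 0; first by rewrite b0// mul0r mulr0.
  by rewrite mulrC divfK// sqrtr_eq0 -ltNge lt_neqAle eq_sym an0.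
have ord2 (i : 'I_2) : i = 0 \/ i = 1.
  by case: i => [[|[|//]]] H; [left|right]; exact: val_inj.
apply/matrixP => i j; rewrite !mxE !big_ord_recl big_ord0 !mxE /= addr0.
case: (ord2 i) => ->; case: (ord2 j) => -> /=.
- by rewrite mulr0 addr0 sa.
- by rewrite mul0r addr0 sab.
- by rewrite mulr0 addr0 -sym mulrC sab.
- rewrite -!expr2 sqr_sqrtr// exprMn exprVn sqr_sqrtr// -/c; ring.
Qed.

Lemma normal2_exists {R : realType} (S : 'M[R]_2) : S 0 1 = S 1 0 ->
  (forall t1 t2, 0 <= t1 ^+ 2 * S 0 0 + 2 * t1 * t2 * S 0 1 + t2 ^+ 2 * S 1 1) ->
  exists nu : probability (R * R)%type R, is_normal2 0 S nu /\
    forall t1 t2 c, \int[nu]_z cos (t1 * z.1 + t2 * z.2 + c) =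
      expR (- ((t1 ^+ 2 * S 0 0 + 2 * t1 * t2 * S 0 1 + t2 ^+ 2 * S 1 1) / 2)) * cos c.
Proof.
move=> sym psd; have [L LS] := psd2_factor sym psd.
have [nu [nuL nucos]] := normal2_of_factor L.
exists nu; split; first by rewrite -LS.
move=> t1 t2 c; rewrite nucos.
have SE r s : S r s = L r 0 * L s 0 + L r 1 * L s 1.
  rewrite -LS mxE !big_ord_recl big_ord0 addr0 !mxE; congr (_ * _ + _ * _);
  by congr (L _ _); exact: val_inj.
by rewrite !SE; congr (expR _ * _); ring.
Qed.

(** * Moments of the standardized pair *)

Section moments_real.
Context {d} {T : measurableType d} {R : realType} (P : probability T R).
Implicit Types f g : T -> R.

Lemma meanE f : mean P f = \int[P]_w f w.
Proof. by rewrite /mean unlock. Qed.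

Lemma covE f g : cov P f g = \int[P]_w ((f w - mean P f) * (g w - mean P g)).
Proof. by rewrite /cov unlock /= unlock /mean unlock. Qed.

Lemma sdE f : sd P f = Num.sqrt (\int[P]_w ((f w - mean P f) ^+ 2)).
Proof. by rewrite /sd -/(cov P f f) covE; congr Num.sqrt. Qed.

Lemma sd_gt0 f : measurable_fun setT f -> L1 P (fun w => (f w - mean P f) ^+ 2) ->
  ~ ae_constant P f -> 0 < sd P f.
Proof.
move=> mf L2 nc; rewrite sdE sqrtr_gt0 lt_neqAle Rintegral_ge0 ?andbT => [|w _]; last exact: sqr_ge0.
apply/negP => /eqP/esym V0; apply: nc; exists (mean P f).
have mc : measurable_fun setT (fun w => ((f w - mean P f) ^+ 2)%:E).
  by apply/measurable_EFinP; exact: L1_measurable L2.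
have /(ae_eq_integral_abs P measurableT mc) : (\int[P]_w `|((f w - mean P f) ^+ 2)%:E|)%E = 0%E.
  under eq_integral do rewrite /= ger0_norm ?sqr_ge0//.
  by rewrite -(L1_EFin L2) V0.
apply: filterS => w /(_ I) /= [/eqP]; rewrite sqrf_eq0 subr_eq0 => /eqP.
exact.
Qed.

Lemma covE_sub f g : L1 P f -> L1 P g -> L1 P (fun w => f w * g w) ->
  cov P f g = \int[P]_w (f w * g w) - mean P f * mean P g.
Proof.
move=> Lf Lg Lfg; rewrite covE.
have L1' : L1 P (fun w => mean P g * f w) by exact: L1Z.
have L2' : L1 P (fun w => mean P f * g w) by exact: L1Z.
have L3 : L1 P (fun w => mean P f * g w - mean P f * mean P g).
  by apply: L1B => //; exact: L1_cst.
transitivity (\int[P]_w (f w * g w - mean P g * f w -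
    (mean P f * g w - mean P f * mean P g))).
  by apply: eq_Rintegral => w _; ring.
rewrite RintegralB//; last exact: L1B.
rewrite RintegralB// RintegralB//; last exact: L1_cst.
rewrite (Rintegral_prob_cst P (mean P f * mean P g)) !RintegralZl// -!meanE; ring.
Qed.

End moments_real.

(** All factors are bounded by the maximum [m] of 1, [|a|] and [|b|]. Since [m >= 1] the degree may
    be raised to 8, and [m ^+ 8] is one of the three summands. *)
Lemma prod_pow_le {R : realType} (a b : R) (k l : nat) : (k + l <= 8)%N ->
  `|a ^+ k * b ^+ l| <= 1 + a ^+ 8 + b ^+ 8.
Proof.
move=> kl; pose m := Num.max 1 (Num.max `|a| `|b|).
have m1 : 1 <= m by rewrite le_max lexx.
have am : `|a| <= m by rewrite !le_max lexx orbT.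
have bm : `|b| <= m by rewrite !le_max lexx !orbT.
have e8 (x : R) : `|x| ^+ 8 = x ^+ 8 by rewrite (exprM _ 2 4) real_normK ?num_real// -exprM.
have a8 : 0 <= a ^+ 8 by rewrite -e8 exprn_ge0.
have b8 : 0 <= b ^+ 8 by rewrite -e8 exprn_ge0.
apply: (@le_trans _ _ (m ^+ 8)).
  rewrite normrM !normrX (@le_trans _ _ (m ^+ k * m ^+ l))//.
    by rewrite ler_pM ?exprn_ge0// lerXn2r// ?nnegrE// (le_trans ler01).
  by rewrite -exprD ler_weXn2l.
rewrite /m; case: (leP 1 (Num.max `|a| `|b|)) => _; last by rewrite expr1n; lra.
by case: (leP `|a| `|b|) => _; rewrite e8; lra.
Qed.

(** The constant is [2 ^+ 8], as [|x - m|] is at most twice the larger of [|x|] and [|m|]. *)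
Lemma sub_pow8_le {R : realType} (x m : R) : (x - m) ^+ 8 <= 256 * (x ^+ 8 + m ^+ 8).
Proof.
have e8 (y : R) : y ^+ 8 = `|y| ^+ 8 by rewrite (exprM `|_| 2 4) real_normK ?num_real// -exprM.
have max8 : (Num.max `|x| `|m|) ^+ 8 <= x ^+ 8 + m ^+ 8.
  have := exprn_ge0 8 (normr_ge0 x); have := exprn_ge0 8 (normr_ge0 m).
  by rewrite (e8 x) (e8 m); case: (leP `|x| `|m|) => _; lra.
apply: (@le_trans _ _ ((2 * Num.max `|x| `|m|) ^+ 8)).
  rewrite e8 lerXn2r ?nnegrE ?mulr_ge0// ?le_max ?normr_ge0//.
  rewrite (le_trans (ler_normB _ _))// mulr_natl mulr2n lerD// le_max lexx ?orbT//.
rewrite exprMn (_ : 2 ^+ 8 = 256 :> R); last by ring.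
by apply: ler_wpM2l; rewrite ?ler0n.
Qed.

Section std_moments.
Context {d} {T : measurableType d} {R : realType} (P : probability T R).
Variables X Y : T -> R.
Hypothesis mX : measurable_fun setT X.
Hypothesis mY : measurable_fun setT Y.
Hypothesis X8 : L1 P (fun w => X w ^+ 8).
Hypothesis Y8 : L1 P (fun w => Y w ^+ 8).
Hypothesis ncX : ~ ae_constant P X.
Hypothesis ncY : ~ ae_constant P Y.

Let pow8_L1 (f : T -> R) (k : nat) : measurable_fun setT f -> (k <= 8)%N ->
  L1 P (fun w => f w ^+ 8) -> L1 P (fun w => f w ^+ k).
Proof.
move=> mf k8 f8; apply: (@L1_le _ _ _ P _ (fun w => 1 + f w ^+ 8 + 0)).
- exact: measurable_funX.
- move=> w; have := @prod_pow_le _ (f w) 0 k 0; rewrite addn0 expr0 mulr1 => /(_ k8).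
  by rewrite expr0n.
- by apply: L1D; [apply: L1D => //|]; exact: L1_cst.
Qed.

Let sub8_L1 (f : T -> R) (m : R) : measurable_fun setT f ->
  L1 P (fun w => f w ^+ 8) -> L1 P (fun w => (f w - m) ^+ 8).
Proof.
move=> mf f8; apply: (@L1_le _ _ _ P _ (fun w => 256 * (f w ^+ 8 + m ^+ 8))).
- by apply: measurable_funX; exact: measurable_funB.
- move=> w; rewrite ger0_norm; first exact: sub_pow8_le.
  by rewrite (exprM _ 2 4) exprn_ge0 ?sqr_ge0.
- by apply: L1Z; apply: L1D => //; exact: L1_cst.
Qed.

Let sd_pos (f : T -> R) : measurable_fun setT f -> L1 P (fun w => f w ^+ 8) ->
  ~ ae_constant P f -> 0 < sd P f.
Proof.
move=> mf f8 nc; apply: sd_gt0 => //.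
apply: (@pow8_L1 (fun w => f w - mean P f)) => //; first exact: measurable_funB.
exact: sub8_L1.
Qed.

Lemma sdX_gt0 : 0 < sd P X. Proof. exact: sd_pos. Qed.
Lemma sdY_gt0 : 0 < sd P Y. Proof. exact: sd_pos. Qed.

Let mstd (f : T -> R) : measurable_fun setT f -> measurable_fun setT (standardize P f).
Proof. by move=> mf; apply: measurable_funM => //; exact: measurable_funB. Qed.

Let std8_L1 (f : T -> R) : measurable_fun setT f -> L1 P (fun w => f w ^+ 8) ->
  L1 P (fun w => standardize P f w ^+ 8).
Proof.
move=> mf f8; under eq_fun do rewrite exprMn mulrC; apply: L1Z; exact: sub8_L1.
Qed.

Local Notation mono := (std_monomial P X Y).
Local Notation e := (std_moment P X Y).

Lemma L1_std_monomial k l : (k + l <= 8)%N -> L1 P (mono k l).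
Proof.
move=> kl; apply: (@L1_le _ _ _ P _ (fun w => 1 + standardize P X w ^+ 8 + standardize P Y w ^+ 8)).
- by apply: measurable_funM; apply: measurable_funX; exact: mstd.
- by move=> w; exact: prod_pow_le.
- apply: L1D; last exact: std8_L1.
  by apply: L1D; [exact: L1_cst|exact: std8_L1].
Qed.

Lemma std_monomialM k l s r w : mono k l w * mono s r w = mono (k + s) (l + r) w.
Proof. by rewrite /std_monomial mulrACA -!exprD. Qed.

Let std_mean0 (f : T -> R) : L1 P f -> mean P (standardize P f) = 0.
Proof.
move=> Lf; rewrite meanE; under eq_Rintegral do rewrite /standardize mulrC.
rewrite RintegralZl//; last by apply: L1B => //; exact: L1_cst.
rewrite RintegralB//; last exact: L1_cst.
by rewrite Rintegral_prob_cst -meanE subrr mulr0.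
Qed.

Let std_var1 (f : T -> R) : measurable_fun setT f -> L1 P (fun w => f w ^+ 8) ->
  0 < sd P f -> \int[P]_w (standardize P f w ^+ 2) = 1.
Proof.
move=> mf f8 sf; under eq_Rintegral do rewrite /standardize exprMn mulrC.
rewrite RintegralZl//; last first.
  apply: (@pow8_L1 (fun w => f w - mean P f)) => //; first exact: measurable_funB.
  exact: sub8_L1.
rewrite exprVn [X in X^-1](_ : _ = \int[P]_w ((f w - mean P f) ^+ 2)).
  by rewrite mulVf// -(sqr_sqrtr (Rintegral_ge0 _ _)) -?sdE ?gt_eqF ?exprn_gt0// => w _; exact: sqr_ge0.
by rewrite sdE sqr_sqrtr// Rintegral_ge0// => w _; exact: sqr_ge0.
Qed.

Let monoE1 (F : T -> R) k l : (forall w, mono k l w = F w) -> e k l = \int[P]_w F w.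
Proof. by move=> H; rewrite /std_moment meanE; apply: eq_Rintegral => w _; exact: H. Qed.

Let L1X : L1 P X.
Proof. by have := @pow8_L1 X 1 mX isT X8; under eq_fun do rewrite expr1. Qed.

Let L1Y : L1 P Y.
Proof. by have := @pow8_L1 Y 1 mY isT Y8; under eq_fun do rewrite expr1. Qed.

Lemma std_moment10 : e 1 0 = 0.
Proof.
rewrite (@monoE1 (standardize P X)); first by rewrite -meanE std_mean0.
by move=> w; rewrite /std_monomial expr1 expr0 mulr1.
Qed.

Lemma std_moment01 : e 0 1 = 0.
Proof.
rewrite (@monoE1 (standardize P Y)); first by rewrite -meanE std_mean0.
by move=> w; rewrite /std_monomial expr1 expr0 mul1r.
Qed.

Lemma std_moment20 : e 2 0 = 1.
Proof.
rewrite (@monoE1 (fun w => standardize P X w ^+ 2)); first by rewrite std_var1// sdX_gt0.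
by move=> w; rewrite /std_monomial expr0 mulr1.
Qed.

Lemma std_moment02 : e 0 2 = 1.
Proof.
rewrite (@monoE1 (fun w => standardize P Y w ^+ 2)); first by rewrite std_var1// sdY_gt0.
by move=> w; rewrite /std_monomial expr0 mul1r.
Qed.

Lemma rho_l1E : rho_l1 P X Y = e 1 1.
Proof.
have sx := sdX_gt0; have sy := sdY_gt0.
have E w : (X w - mean P X) * (Y w - mean P Y) = sd P X * sd P Y * mono 1 1 w.
  by rewrite /std_monomial !expr1 /standardize; field; rewrite !gt_eqF.
rewrite /rho_l1 /pearson covE.
under eq_Rintegral do rewrite E.
rewrite RintegralZl//; last exact: L1_std_monomial.
rewrite /std_moment meanE; field; by rewrite !gt_eqF.
Qed.

Hypothesis ncX2 : ~ ae_constant P (fun w => standardize P X w ^+ 2).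
Hypothesis ncY2 : ~ ae_constant P (fun w => standardize P Y w ^+ 2).

Let A2 w := standardize P X w ^+ 2.
Let B2 w := standardize P Y w ^+ 2.

Let A2E w : A2 w = mono 2 0 w.
Proof. by rewrite /std_monomial expr0 mulr1. Qed.

Let B2E w : B2 w = mono 0 2 w.
Proof. by rewrite /std_monomial expr0 mul1r. Qed.

Let L1A2 : L1 P A2.
Proof. by rewrite (funext A2E); exact: L1_std_monomial. Qed.

Let L1B2 : L1 P B2.
Proof. by rewrite (funext B2E); exact: L1_std_monomial. Qed.

Let cov_sq (f g : T -> R) k l s r : (k + l + (s + r) <= 8)%N ->
  (forall w, f w = mono k l w) -> (forall w, g w = mono s r w) ->
  cov P f g = e (k + s) (l + r) - e k l * e s r.
Proof.
move=> h Ef Eg; rewrite (funext Ef) (funext Eg) covE_sub//.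
- rewrite /std_moment !meanE; congr (_ - _); apply: eq_Rintegral => w _.
  exact: std_monomialM.
- by apply: L1_std_monomial; rewrite (leq_trans _ h)// leq_addr.
- by apply: L1_std_monomial; rewrite (leq_trans _ h)// leq_addl.
- under eq_fun do rewrite std_monomialM; apply: L1_std_monomial.
  by rewrite (leq_trans _ h)// addnACA.
Qed.

Let sd_cov (f : T -> R) : sd P f = Num.sqrt (cov P f f).
Proof. by rewrite sdE covE. Qed.

Let sdA2 : sd P A2 = Num.sqrt (e 4 0 - 1).
Proof.
by rewrite sd_cov (@cov_sq A2 A2 2 0 2 0)// std_moment20 mulr1.
Qed.

Let sdB2 : sd P B2 = Num.sqrt (e 0 4 - 1).
Proof.
by rewrite sd_cov (@cov_sq B2 B2 0 2 0 2)// std_moment02 mulr1.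
Qed.

Let centered2_L1 (f : T -> R) k l : (k + l <= 4)%N -> (forall w, f w = mono k l w) ->
  L1 P (fun w => (f w - mean P f) ^+ 2).
Proof.
move=> kl E; rewrite (funext E).
rewrite (_ : (fun w => _) = fun w => mono (k + k) (l + l) w - 2 * mean P (mono k l) * mono k l w
  + mean P (mono k l) ^+ 2); last first.
  by apply/funext => w; rewrite -std_monomialM; ring.
have k8 : (k + l <= 8)%N by rewrite (leq_trans kl).
apply: L1D; last exact: L1_cst.
apply: L1B; last by apply: L1Z; exact: L1_std_monomial.
by apply: L1_std_monomial; rewrite addnACA (leq_add kl kl).
Qed.

(** [e 4 0 - 1] is the variance of the squared standardized variable, because [e 2 0 = 1]. It
    vanishes for a fair sign, a case that [ncX2] excludes. *)
Lemma std_moment40_gt1 : 1 < e 4 0.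
Proof.
rewrite -subr_gt0 -sqrtr_gt0 -sdA2; apply: sd_gt0 => //.
  exact: L1_measurable L1A2.
exact: (@centered2_L1 _ 2 0).
Qed.

Lemma std_moment04_gt1 : 1 < e 0 4.
Proof.
rewrite -subr_gt0 -sqrtr_gt0 -sdB2; apply: sd_gt0 => //.
  exact: L1_measurable L1B2.
exact: (@centered2_L1 _ 0 2).
Qed.

Lemma rho_l2E : rho_l2 P X Y =
  (e 2 2 - 1) / Num.sqrt ((e 4 0 - 1) * (e 0 4 - 1)).
Proof.
rewrite /rho_l2 /pearson -/A2 -/B2 sdA2 sdB2 (@cov_sq A2 B2 2 0 0 2)//.
rewrite std_moment20 std_moment02 mulr1 sqrtrM// subr_ge0 ltW//.
exact: std_moment40_gt1.
Qed.

End std_moments.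

(** * Sample moments *)

Section sample_moments.
Context {R : realType} (n : nat).
Hypothesis n0 : (0 < n)%N.
Implicit Types (x y : nat -> R).

Let nR : n%:R != 0 :> R. Proof. by rewrite pnatr_eq0 -lt0n. Qed.

Lemma eq_smean x y : x =1 y -> smean n x = smean n y.
Proof. by move=> xy; rewrite /smean; congr (_ * _); apply: eq_bigr. Qed.

Lemma smeanD x y : smean n (fun i => x i + y i) = smean n x + smean n y.
Proof. by rewrite /smean big_split mulrDr. Qed.

Lemma smeanZ (a : R) x : smean n (fun i => a * x i) = a * smean n x.
Proof. by rewrite /smean -mulr_sumr mulrCA. Qed.

Lemma smean_cst (a : R) : smean n (fun=> a) = a.
Proof. by rewrite /smean sumr_const card_ord -[a *+ n]mulr_natr mulrC mulfK. Qed.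

(** An exact identity, so the expansions of the empirical moments have no remainder for [n > 0]. *)
Lemma sqrt_smean_sub (c : R) x : Num.sqrt n%:R * (smean n x - c) =
  (Num.sqrt n%:R)^-1 * \sum_(i < n) (x i - c).
Proof.
have H (s N S : R) : s != 0 -> N = s ^+ 2 -> s * (N^-1 * S - c) = s^-1 * (S - c * N).
  by move=> s0 ->; field.
rewrite sumrB sumr_const card_ord -[c *+ n]mulr_natr /smean; apply: H.
  by rewrite sqrtr_eq0 -ltNge ltr0n.
by rewrite sqr_sqrtr.
Qed.

Variables (mx my sx sy : R).
Hypotheses (sx0 : 0 < sx) (sy0 : 0 < sy).
Variables (x y : nat -> R).
Let a i := (x i - mx) / sx.
Let b i := (y i - my) / sy.

Let xE i : x i = mx + sx * a i.
Proof. by rewrite /a mulrC divfK ?gt_eqF// addrC subrK. Qed.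

Let yE i : y i = my + sy * b i.
Proof. by rewrite /b mulrC divfK ?gt_eqF// addrC subrK. Qed.

Let smeanx : smean n x = mx + sx * smean n a.
Proof. by rewrite (eq_smean xE) smeanD smean_cst smeanZ. Qed.

Let smeany : smean n y = my + sy * smean n b.
Proof. by rewrite (eq_smean yE) smeanD smean_cst smeanZ. Qed.

Lemma scov_affine : scov n x y = sx * sy * scov n a b.
Proof.
rewrite /scov smeanx smeany.
rewrite (@eq_smean _ (fun i => mx * my + mx * sy * b i + sx * my * a i + sx * sy * (a i * b i))).
  by rewrite !smeanD !smeanZ smean_cst; ring.
by move=> i; rewrite xE yE; ring.
Qed.

End sample_moments.

Section sample_standardization.
Context {R : realType} (n : nat).
Hypothesis n0 : (0 < n)%N.
Implicit Types (x y : nat -> R).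

Lemma ssd_affine (m s : R) x : 0 < s -> ssd n x = s * ssd n (fun i => (x i - m) / s).
Proof.
move=> s0; have E (z : nat -> R) : ssd n z = Num.sqrt (scov n z z).
  by rewrite /ssd /scov -expr2; congr (Num.sqrt (_ - _)); apply: eq_smean => i; rewrite expr2.
by rewrite !E (@scov_affine _ n n0 m m s s)// -expr2 sqrtrM ?sqr_ge0// sqrtr_sqr gtr0_norm.
Qed.

Lemma sstandardize_affine (m s : R) x i : 0 < s ->
  sstandardize n x i = sstandardize n (fun i => (x i - m) / s) i.
Proof.
move=> s0; rewrite /sstandardize (ssd_affine m x s0).
have -> : smean n x = m + s * smean n (fun i => (x i - m) / s).
  rewrite -smeanZ -[X in X + _](smean_cst n0) -smeanD; apply: eq_smean => j.
  by rewrite mulrC divfK ?gt_eqF// addrC subrK.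
rewrite invfM mulrA; congr (_ / _); by field; rewrite gt_eqF.
Qed.

Lemma rho_l1_hat_affine (mx my sx sy : R) x y : 0 < sx -> 0 < sy ->
  rho_l1_hat n x y = rho_l1_hat n (fun i => (x i - mx) / sx) (fun i => (y i - my) / sy).
Proof.
move=> sx0 sy0; rewrite /rho_l1_hat (@scov_affine _ n n0 mx my sx sy)//.
rewrite (ssd_affine mx x sx0) (ssd_affine my y sy0) mulrACA invfM mulrACA.
by rewrite divff ?mul1r// mulf_neq0// gt_eqF.
Qed.

Lemma rho_l2_hat_affine (mx my sx sy : R) x y : 0 < sx -> 0 < sy ->
  rho_l2_hat n x y = rho_l2_hat n (fun i => (x i - mx) / sx) (fun i => (y i - my) / sy).
Proof.
move=> sx0 sy0; have E k l : sstd_moment n x y k l =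
    sstd_moment n (fun i => (x i - mx) / sx) (fun i => (y i - my) / sy) k l.
  apply: eq_smean => i.
  by rewrite (sstandardize_affine mx x i sx0) (sstandardize_affine my y i sy0).
by rewrite /rho_l2_hat !E.
Qed.

Variables a b : nat -> R.
Local Notation m k l := (smean n (fun i => a i ^+ k * b i ^+ l)).

Let m10 : smean n a = m 1 0.
Proof. by apply: eq_smean => i; rewrite expr1 expr0 mulr1. Qed.

Let m01 : smean n b = m 0 1.
Proof. by apply: eq_smean => i; rewrite expr1 expr0 mul1r. Qed.

Lemma ssd_moments_l : ssd n a = Num.sqrt (m 2 0 - m 1 0 ^+ 2).
Proof.
by rewrite /ssd m10; congr (Num.sqrt (_ - _)); apply: eq_smean => i; rewrite expr0 mulr1.
Qed.

Lemma ssd_moments_r : ssd n b = Num.sqrt (m 0 2 - m 0 1 ^+ 2).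
Proof.
by rewrite /ssd m01; congr (Num.sqrt (_ - _)); apply: eq_smean => i; rewrite expr0 mul1r.
Qed.

Lemma scov_moments : scov n a b = m 1 1 - m 1 0 * m 0 1.
Proof. by rewrite /scov m10 m01; congr (_ - _); apply: eq_smean => i; rewrite !expr1. Qed.

Let sstdE k l : sstd_moment n a b k l =
  (ssd n a ^+ k * ssd n b ^+ l)^-1 *
  smean n (fun i => (a i - m 1 0) ^+ k * (b i - m 0 1) ^+ l).
Proof.
rewrite -smeanZ; apply: eq_smean => i; rewrite /sstandardize m10 m01.
by rewrite !exprMn !exprVn invfM; ring.
Qed.

(** Binomial expansion around the sample mean; the coefficients -4 and 1 of the last two terms
    combine to -3. *)
Lemma sstd_moment40 : sstd_moment n a b 4 0 = (ssd n a ^+ 4)^-1 *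
  (m 4 0 - 4 * (m 1 0 * m 3 0) + 6 * (m 1 0 ^+ 2 * m 2 0) - 3 * m 1 0 ^+ 4).
Proof.
rewrite sstdE expr0 mulr1; congr (_ * _).
rewrite (@eq_smean _ n _ (fun i => a i ^+ 4 * b i ^+ 0 + (- 4 * m 1 0) * (a i ^+ 3 * b i ^+ 0)
   + (6 * m 1 0 ^+ 2) * (a i ^+ 2 * b i ^+ 0) + (- 4 * m 1 0 ^+ 3) * (a i ^+ 1 * b i ^+ 0)
   + m 1 0 ^+ 4)).
  by rewrite !smeanD (smean_cst n0) !smeanZ; ring.
by move=> i; rewrite !expr0; ring.
Qed.

Lemma sstd_moment04 : sstd_moment n a b 0 4 = (ssd n b ^+ 4)^-1 *
  (m 0 4 - 4 * (m 0 1 * m 0 3) + 6 * (m 0 1 ^+ 2 * m 0 2) - 3 * m 0 1 ^+ 4).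
Proof.
rewrite sstdE expr0 mul1r; congr (_ * _).
rewrite (@eq_smean _ n _ (fun i => a i ^+ 0 * b i ^+ 4 + (- 4 * m 0 1) * (a i ^+ 0 * b i ^+ 3)
   + (6 * m 0 1 ^+ 2) * (a i ^+ 0 * b i ^+ 2) + (- 4 * m 0 1 ^+ 3) * (a i ^+ 0 * b i ^+ 1)
   + m 0 1 ^+ 4)).
  by rewrite !smeanD (smean_cst n0) !smeanZ; ring.
by move=> i; rewrite !expr0; ring.
Qed.

Lemma sstd_moment22 : sstd_moment n a b 2 2 = (ssd n a ^+ 2 * ssd n b ^+ 2)^-1 *
  (m 2 2 - 2 * (m 1 0 * m 1 2) - 2 * (m 0 1 * m 2 1) + m 1 0 ^+ 2 * m 0 2
   + m 0 1 ^+ 2 * m 2 0 + 4 * (m 1 0 * m 0 1 * m 1 1) - 3 * (m 1 0 ^+ 2 * m 0 1 ^+ 2)).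
Proof.
rewrite sstdE; congr (_ * _).
rewrite (@eq_smean _ n _ (fun i => a i ^+ 2 * b i ^+ 2 + (- 2 * m 1 0) * (a i ^+ 1 * b i ^+ 2)
   + (- 2 * m 0 1) * (a i ^+ 2 * b i ^+ 1) + m 1 0 ^+ 2 * (a i ^+ 0 * b i ^+ 2)
   + m 0 1 ^+ 2 * (a i ^+ 2 * b i ^+ 0) + (4 * (m 1 0 * m 0 1)) * (a i ^+ 1 * b i ^+ 1)
   + (- 2 * (m 1 0 ^+ 2 * m 0 1)) * (a i ^+ 0 * b i ^+ 1)
   + (- 2 * (m 1 0 * m 0 1 ^+ 2)) * (a i ^+ 1 * b i ^+ 0)
   + m 1 0 ^+ 2 * m 0 1 ^+ 2)).
  by rewrite !smeanD (smean_cst n0) !smeanZ; ring.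
by move=> i; rewrite !expr0; ring.
Qed.

End sample_standardization.

(** * Expansions of the estimators *)

Section estimator_expansions.
Context {d} {T : measurableType d} {R : realType} (P : probability T R).
Variables (a b : nat -> T -> R) (e : nat -> nat -> R) (G : nat -> nat -> nat -> T -> R).

Local Notation m k l := (fun n w => smean n (fun i => a i w ^+ k * b i w ^+ l)).
Local Notation expands := (expands P).

Hypothesis expm : forall k l, (k + l <= 4)%N -> expands (m k l) (e k l) (G k l).
Hypotheses (e10 : e 1 0 = 0) (e01 : e 0 1 = 0) (e20 : e 2 0 = 1) (e02 : e 0 2 = 1).
Hypotheses (e40 : 1 < e 4 0) (e04 : 1 < e 0 4).

Let E k l (kl : (k + l <= 4)%N) := expm kl.

(** The squared sample mean has no first-order part because [e 1 0 = 0], and the square root has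
    derivative 1/2 at 1. *)
Lemma expands_ssd_l :
  expands (fun n w => ssd n (a^~ w)) 1 (fun n w => 2^-1 * G 2 0 n w).
Proof.
have Ev : expands (fun n w => m 2 0 n w + -1 * m 1 0 n w ^+ 2) 1 (G 2 0).
  apply: expands_ext (expandsD (E (k := 2) (l := 0) isT)
    (expandsZ (-1) (expandsX 1 (E (k := 1) (l := 0) isT)))).
  - exact: nearW.
  - by rewrite e20 e10; ring.
  - by move=> n w; rewrite e10; ring.
apply: expands_ext (expands_sqrt ltr01 Ev).
- by apply: nearW => n w; rewrite (@ssd_moments_l _ _ _ (b^~ w)) mulN1r.
- exact: sqrtr1.
- by move=> n w; rewrite sqrtr1 mulr1.
Qed.

Lemma expands_ssd_r :
  expands (fun n w => ssd n (b^~ w)) 1 (fun n w => 2^-1 * G 0 2 n w).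
Proof.
have Ev : expands (fun n w => m 0 2 n w + -1 * m 0 1 n w ^+ 2) 1 (G 0 2).
  apply: expands_ext (expandsD (E (k := 0) (l := 2) isT)
    (expandsZ (-1) (expandsX 1 (E (k := 0) (l := 1) isT)))).
  - exact: nearW.
  - by rewrite e02 e01; ring.
  - by move=> n w; rewrite e01; ring.
apply: expands_ext (expands_sqrt ltr01 Ev).
- by apply: nearW => n w; rewrite (@ssd_moments_r _ _ (a^~ w)) mulN1r.
- exact: sqrtr1.
- by move=> n w; rewrite sqrtr1 mulr1.
Qed.

(** The first row of [mxM] arises here: the product of the sample means drops out since both limits
    are 0, and dividing by the two deviations subtracts [e 1 1] times half of each second-moment
    error. *)
Lemma expands_rho_l1 :
  expands (fun n w => rho_l1_hat n (a^~ w) (b^~ w)) (e 1 1)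
    (fun n w => - (e 1 1 / 2) * G 2 0 n w + - (e 1 1 / 2) * G 0 2 n w + G 1 1 n w).
Proof.
have Ec := expandsD (E (k := 1) (l := 1) isT) (expandsZ (-1)
  (expandsM (E (k := 1) (l := 0) isT) (E (k := 0) (l := 1) isT))).
have Es := expandsM expands_ssd_l expands_ssd_r.
have n1 : (1 : R) * 1 != 0 by rewrite mulr1 oner_eq0.
apply: expands_ext (expandsM Ec (expandsV n1 Es)).
- by apply: nearW => n w; rewrite /rho_l1_hat scov_moments mulN1r.
- by rewrite e10; field.
- by move=> n w; rewrite e10 e01; field.
Qed.

(** The fourth row of [mxA]: centring gives [- 4 * e 3 0], and the fourth power of the sample
    deviation, with first-order part [2 * G 2 0], gives [- 2 * e 4 0]. *)
Lemma expands_sstd_moment40 :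
  expands (fun n w => sstd_moment n (a^~ w) (b^~ w) 4 0) (e 4 0)
    (fun n w => G 4 0 n w - 4 * e 3 0 * G 1 0 n w - 2 * e 4 0 * G 2 0 n w).
Proof.
have E10 := E (k := 1) (l := 0) isT; have E20 := E (k := 2) (l := 0) isT.
have E30 := E (k := 3) (l := 0) isT; have E40 := E (k := 4) (l := 0) isT.
have Ec := expandsD (expandsD (expandsD E40 (expandsZ (-4) (expandsM E10 E30)))
  (expandsZ 6 (expandsM (expandsX 1 E10) E20))) (expandsZ (-3) (expandsX 3 E10)).
have n1 : (1 : R) ^+ 4 != 0 by rewrite expr1n oner_eq0.
apply: expands_ext (expandsM (expandsV n1 (expandsX 3 expands_ssd_l)) Ec).
- exists 1%N => // n n0 w; rewrite (@sstd_moment40 _ n n0); congr (_ * _); ring.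
- by rewrite e10; field.
- by move=> n w; rewrite e10; field.
Qed.

Lemma expands_sstd_moment04 :
  expands (fun n w => sstd_moment n (a^~ w) (b^~ w) 0 4) (e 0 4)
    (fun n w => G 0 4 n w - 4 * e 0 3 * G 0 1 n w - 2 * e 0 4 * G 0 2 n w).
Proof.
have E01 := E (k := 0) (l := 1) isT; have E02 := E (k := 0) (l := 2) isT.
have E03 := E (k := 0) (l := 3) isT; have E04 := E (k := 0) (l := 4) isT.
have Ec := expandsD (expandsD (expandsD E04 (expandsZ (-4) (expandsM E01 E03)))
  (expandsZ 6 (expandsM (expandsX 1 E01) E02))) (expandsZ (-3) (expandsX 3 E01)).
have n1 : (1 : R) ^+ 4 != 0 by rewrite expr1n oner_eq0.
apply: expands_ext (expandsM (expandsV n1 (expandsX 3 expands_ssd_r)) Ec).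
- exists 1%N => // n n0 w; rewrite (@sstd_moment04 _ n n0); congr (_ * _); ring.
- by rewrite e01; field.
- by move=> n w; rewrite e01; field.
Qed.

(** The last row of [mxA]: centring each variable gives the coefficients of [G 1 0] and [G 0 1], and
    each of the two squared deviations gives one [- e 2 2]. *)
Lemma expands_sstd_moment22 :
  expands (fun n w => sstd_moment n (a^~ w) (b^~ w) 2 2) (e 2 2)
    (fun n w => G 2 2 n w - 2 * e 1 2 * G 1 0 n w - 2 * e 2 1 * G 0 1 n w
       - e 2 2 * G 2 0 n w - e 2 2 * G 0 2 n w).
Proof.
have E10 := E (k := 1) (l := 0) isT; have E01 := E (k := 0) (l := 1) isT.
have E20 := E (k := 2) (l := 0) isT; have E02 := E (k := 0) (l := 2) isT.
have E11 := E (k := 1) (l := 1) isT; have E22 := E (k := 2) (l := 2) isT.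
have E12 := E (k := 1) (l := 2) isT; have E21 := E (k := 2) (l := 1) isT.
have Ec := expandsD (expandsD (expandsD (expandsD (expandsD (expandsD E22
  (expandsZ (-2) (expandsM E10 E12))) (expandsZ (-2) (expandsM E01 E21)))
  (expandsM (expandsX 1 E10) E02)) (expandsM (expandsX 1 E01) E20))
  (expandsZ 4 (expandsM (expandsM E10 E01) E11)))
  (expandsZ (-3) (expandsM (expandsX 1 E10) (expandsX 1 E01))).
have n1 : (1 : R) ^+ 2 * 1 ^+ 2 != 0 by rewrite !expr1n mulr1 oner_eq0.
apply: expands_ext (expandsM (expandsV n1
  (expandsM (expandsX 1 expands_ssd_l) (expandsX 1 expands_ssd_r))) Ec).
- exists 1%N => // n n0 w; rewrite (@sstd_moment22 _ n n0); congr (_ * _); ring.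
- by rewrite e10 e01; field.
- by move=> n w; rewrite e10 e01 e20 e02; field.
Qed.

Let r2 := (e 2 2 - 1) / Num.sqrt ((e 4 0 - 1) * (e 0 4 - 1)).

Lemma expands_rho_l2 :
  expands (fun n w => rho_l2_hat n (a^~ w) (b^~ w)) r2
    (fun n w =>
      - (r2 / (2 * (e 4 0 - 1))) *
        (G 4 0 n w - 4 * e 3 0 * G 1 0 n w - 2 * e 4 0 * G 2 0 n w)
      + - (r2 / (2 * (e 0 4 - 1))) *
        (G 0 4 n w - 4 * e 0 3 * G 0 1 n w - 2 * e 0 4 * G 0 2 n w)
      + 1 / Num.sqrt ((e 4 0 - 1) * (e 0 4 - 1)) *
        (G 2 2 n w - 2 * e 1 2 * G 1 0 n w - 2 * e 2 1 * G 0 1 n w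
         - e 2 2 * G 2 0 n w - e 2 2 * G 0 2 n w)).
Proof.
have sub1 A x al : expands A x al -> expands (fun n w => A n w - 1) (x - 1) al.
  move=> eA; apply: expands_ext (expandsD eA (expands_cst _ (-1))) => //.
    exact: nearW.
  by move=> n w; rewrite addr0.
have u0 : 0 < e 4 0 - 1 by rewrite subr_gt0.
have v0 : 0 < e 0 4 - 1 by rewrite subr_gt0.
have uv0 : 0 < (e 4 0 - 1) * (e 0 4 - 1) by rewrite mulr_gt0.
have s0 : 0 < Num.sqrt ((e 4 0 - 1) * (e 0 4 - 1)) by rewrite sqrtr_gt0.
have Ed := expands_sqrt uv0 (expandsM (sub1 _ _ _ expands_sstd_moment40)
  (sub1 _ _ _ expands_sstd_moment04)).
have sn0 := lt0r_neq0 s0.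
apply: expands_ext (expandsM (sub1 _ _ _ expands_sstd_moment22) (expandsV sn0 Ed)).
- exact: nearW.
- by [].
- move=> n w; rewrite /r2.
  (* After abstraction the only relation left is [s ^+ 2 = u * v], which resolves the inverse square
     coming from the derivative of [1 / s]. *)
  have := sqr_sqrtr (ltW uv0); move: sn0 (lt0r_neq0 u0) (lt0r_neq0 v0).
  move: (Num.sqrt ((e 4 0 - 1) * (e 0 4 - 1))) => s.
  move: (e 4 0 - 1) (e 0 4 - 1) => u v sn0 un0 vn0 s2.
  move: (G 4 0 n w - _ - _) (G 0 4 n w - _ - _) (G 2 2 n w - _ - _ - _ - _) => x y z.
  by rewrite s2; field; rewrite un0 vn0 sn0.
Qed.

End estimator_expansions.

(** * The matrix [mxM] and the quadratic form of [Sigma_star] *)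

Section asymptotic_matrix.
Context {d} {T : measurableType d} {R : realType} (P : probability T R).
Variables X Y : T -> R.

Local Notation e := (std_moment P X Y).
Local Notation r1 := (rho_l1 P X Y).
Local Notation r2 := (rho_l2 P X Y).
Local Notation M := (mxM P X Y).

(** The array [H] is arbitrary so that the formulas apply pointwise to the normalized sums
    [G k l n w], where they match the linear parts of the two expansions. The list in the proof is
    [mxA] times the vector of moments. *)
Lemma mxM_rows (H : nat -> nat -> R) :
  let h (j : 'I_12) := H (moment_index j).1 (moment_index j).2 in
  \sum_j M 0 j * h j = - (r1 / 2) * H 2 0 + - (r1 / 2) * H 0 2 + H 1 1 /\
  \sum_j M 1 j * h j =
    - (r2 / (2 * (e 4 0 - 1))) * (H 4 0 - 4 * e 3 0 * H 1 0 - 2 * e 4 0 * H 2 0)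
    + - (r2 / (2 * (e 0 4 - 1))) * (H 0 4 - 4 * e 0 3 * H 0 1 - 2 * e 0 4 * H 0 2)
    + 1 / Num.sqrt ((e 4 0 - 1) * (e 0 4 - 1)) *
      (H 2 2 - 2 * e 1 2 * H 1 0 - 2 * e 2 1 * H 0 1 - e 2 2 * H 2 0 - e 2 2 * H 0 2).
Proof.
move=> h.
have sum12 (s : seq R) : \sum_(j < 12) nth 0 s j * h j =
    s`_0 * H 1 0 + s`_1 * H 0 1 + s`_2 * H 2 0 + s`_3 * H 0 2 + s`_4 * H 1 1
    + s`_5 * H 3 0 + s`_6 * H 0 3 + s`_7 * H 2 1 + s`_8 * H 1 2 + s`_9 * H 4 0
    + s`_10 * H 0 4 + s`_11 * H 2 2.
  by rewrite !big_ord_recl big_ord0 /h /moment_index /= addr0 !addrA.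
have MA r : \sum_j M r j * h j = \sum_k mxB P X Y r k * \sum_j mxA P X Y k j * h j.
  under eq_bigr do rewrite mxE mulr_suml.
  rewrite exchange_big; apply: eq_bigr => k _; rewrite mulr_sumr.
  by apply: eq_bigr => j _; rewrite mulrA.
have A_row (k : 'I_6) s : (forall j : 'I_12, mxA P X Y k j = nth 0 s j) ->
    \sum_j mxA P X Y k j * h j = \sum_(j < 12) nth 0 s j * h j.
  by move=> ks; apply: eq_bigr => j _; rewrite ks.
have MB r : \sum_j M r j * h j = \sum_(k < 6) mxB P X Y r k *
    nth 0 [:: H 2 0; H 0 2; H 1 1; H 4 0 - 4 * e 3 0 * H 1 0 - 2 * e 4 0 * H 2 0;
      H 0 4 - 4 * e 0 3 * H 0 1 - 2 * e 0 4 * H 0 2;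
      H 2 2 - 2 * e 1 2 * H 1 0 - 2 * e 2 1 * H 0 1 - e 2 2 * H 2 0 - e 2 2 * H 0 2] k.
  rewrite MA; apply: eq_bigr => k _; congr (_ * _).
  rewrite (@A_row k _ (fun j => mxE _ _ _ _)) sum12.
  by case: k => -[|[|[|[|[|[|//]]]]]] /= _; ring.
split; rewrite MB !big_ord_recl big_ord0 !mxE /=; first by ring.
move: (r2 / _) (r2 / _) (1 / _) => u v s; ring.
Qed.

Lemma Sigma_star_sym : Sigma_star P X Y 0 1 = Sigma_star P X Y 1 0.
Proof.
have SmT : (Sigma_m P X Y)^T = Sigma_m P X Y.
  apply/matrixP => i j; rewrite !mxE !covE.
  by apply: eq_Rintegral => w _; rewrite mulrC.
have : (Sigma_star P X Y)^T = Sigma_star P X Y.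
  rewrite /Sigma_star; move: (mxM P X Y) => A.
  by rewrite !trmx_mul trmxK SmT mulmxA.
by move=> /matrixP/(_ 1 0); rewrite mxE.
Qed.

(** The form is that of [Sigma_m] at the corresponding combination of the rows of [mxM]. It is later
    recognized as the second moment of a combination of centred monomials, which gives both its
    non-negativity and the variance in the limit theorem. *)
Lemma Sigma_star_form (t1 t2 : R) :
  t1 ^+ 2 * Sigma_star P X Y 0 0 + 2 * t1 * t2 * Sigma_star P X Y 0 1
    + t2 ^+ 2 * Sigma_star P X Y 1 1 =
  \sum_j \sum_k (t1 * M 0 j + t2 * M 1 j) * (t1 * M 0 k + t2 * M 1 k) * Sigma_m P X Y j k.
Proof.
have SE r s : Sigma_star P X Y r s = \sum_j \sum_k M r j * M s k * Sigma_m P X Y j k.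
  rewrite mxE; under eq_bigr do rewrite mxE mulr_suml.
  rewrite exchange_big; apply: eq_bigr => j _; apply: eq_bigr => k _.
  by rewrite [M^T _ _]mxE; ring.
rewrite (_ : 2 * t1 * t2 * _ = t1 * t2 * Sigma_star P X Y 0 1 + t1 * t2 * Sigma_star P X Y 1 0);
  last by rewrite Sigma_star_sym; ring.
rewrite !SE !mulr_sumr -!big_split /=; apply: eq_bigr => j _.
rewrite !mulr_sumr -!big_split /=; apply: eq_bigr => k _; ring.
Qed.

End asymptotic_matrix.

Theorem proposition1 (R : realType)
    (d0 : measure_display) (T0 : measurableType d0) (P0 : probability T0 R)
    (X Y : {RV P0 >-> R})
    (d : measure_display) (T : measurableType d) (P : probability T R)
    (Xs Ys : nat -> {RV P >-> R})
    (hiid : iid_copies P0 (fun w => (X w, Y w)) P (fun i w => (Xs i w, Ys i w)))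
    (hX8 : ('E_P0[fun w => (X w ^+ 8)%R] < +oo)%E)
    (hY8 : ('E_P0[fun w => (Y w ^+ 8)%R] < +oo)%E)
    (hX : ~ ae_constant P0 X) (hY : ~ ae_constant P0 Y)
    (* rho_l2 is well defined *)
    (hX2 : ~ ae_constant P0 (fun w => standardize P0 X w ^+ 2))
    (hY2 : ~ ae_constant P0 (fun w => standardize P0 Y w ^+ 2)) :
  exists2 nu : probability (R * R)%type R,
    is_normal2 0 (Sigma_star P0 X Y) nu &
    cvg_in_distribution2 P
      (fun n w =>
         let x := fun i => Xs i w in
         let y := fun i => Ys i w in
         (Num.sqrt n%:R * (rho_l1_hat n x y - rho_l1 P0 X Y),
          Num.sqrt n%:R * (rho_l2_hat n x y - rho_l2 P0 X Y)))
      nu.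
Proof.
have mX : measurable_fun setT X by exact: measurable_funPT.
have mY : measurable_fun setT Y by exact: measurable_funPT.
have pow8_ge0 (x : R) : 0 <= x ^+ 8 by rewrite (exprM _ 2 4) exprn_ge0 ?sqr_ge0.
have X8 : L1 P0 (fun w => X w ^+ 8).
  apply: ge0_L1 => //; first exact: measurable_funX.
  by rewrite unlock in hX8.
have Y8 : L1 P0 (fun w => Y w ^+ 8).
  apply: ge0_L1 => //; first exact: measurable_funX.
  by rewrite unlock in hY8.
pose Z0 w := (X w, Y w); pose Z i w := (Xs i w, Ys i w).
have mZ0 : measurable_fun setT Z0 by exact/measurable_fun_pairP.
have mZ i : measurable_fun setT (Z i).
  by apply/measurable_fun_pairP; split; exact: measurable_funPT.
pose e := std_moment P0 X Y.
pose sx (z : R * R) := (z.1 - mean P0 X) / sd P0 X.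
pose sy (z : R * R) := (z.2 - mean P0 Y) / sd P0 Y.
pose mono k l (z : R * R) := sx z ^+ k * sy z ^+ l.
pose psi k l z := mono k l z - e k l.
have mpsi k l : measurable_fun setT (psi k l).
  by apply: measurable_funB => //; apply: measurable_funM; apply: measurable_funX;
    apply: measurable_funM => //; apply: measurable_funB.
have L1mono k l : (k + l <= 8)%N -> L1 P0 (mono k l \o Z0).
  exact: L1_std_monomial.
have L1psi k l : (k + l <= 8)%N -> L1 P0 (psi k l \o Z0).
  by move=> kl; apply: L1B; [exact: L1mono|exact: L1_cst].
have psi_mean0 k l : (k + l <= 8)%N -> \int[P0]_w psi k l (Z0 w) = 0.
  move=> kl; rewrite RintegralB//; [|exact: L1mono|exact: L1_cst].
  by rewrite Rintegral_prob_cst /e /std_moment meanE subrr.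
(* Here the eighth moments are spent: two monomials of degree at most 4 multiply to degree at most
   8. *)
have L1psi2 k l s r : (k + l <= 4)%N -> (s + r <= 4)%N ->
    L1 P0 (fun w => psi k l (Z0 w) * psi s r (Z0 w)).
  move=> kl sr.
  rewrite (_ : (fun w => _) = fun w => std_monomial P0 X Y (k + s) (l + r) w
    - e k l * std_monomial P0 X Y s r w - e s r * psi k l (Z0 w)); last first.
    by apply/funext => w; rewrite -std_monomialM /psi /mono /std_monomial; ring.
  have kl8 : (k + l <= 8)%N by exact: leq_trans kl _.
  have sr8 : (s + r <= 8)%N by exact: leq_trans sr _.
  apply: L1B; last by apply: L1Z; exact: L1psi.
  apply: L1B; last by apply: L1Z; exact: L1_std_monomial.
  by apply: L1_std_monomial => //; rewrite addnACA (leq_add kl sr).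
pose G k l n w := (Num.sqrt n%:R)^-1 * \sum_(i < n) psi k l (Z i w).
pose a i w := (Xs i w - mean P0 X) / sd P0 X.
pose b i w := (Ys i w - mean P0 Y) / sd P0 Y.
have expm k l : (k + l <= 4)%N ->
    expands P (fun n w => smean n (fun i => a i w ^+ k * b i w ^+ l)) (e k l) (G k l).
  move=> kl; have kl8 : (k + l <= 8)%N by exact: leq_trans kl _.
  split.
    apply: (tight_clt_sum mZ0 mZ hiid (mpsi k l) (L1psi _ _ kl8) _ (psi_mean0 _ _ kl8)).
    by under eq_fun do rewrite expr2; exact: L1psi2.
  apply: small_near (small_cst0 P); exists 1%N => // n /= n0 w.
  by rewrite sqrt_smean_sub// subrr.
have sx0 : 0 < sd P0 X by exact: sdX_gt0.
have sy0 : 0 < sd P0 Y by exact: sdY_gt0.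
have e10 : e 1 0 = 0 by exact: std_moment10.
have e01 : e 0 1 = 0 by exact: std_moment01.
have e20 : e 2 0 = 1 by exact: std_moment20.
have e02 : e 0 2 = 1 by exact: std_moment02.
have e40 : 1 < e 4 0 by exact: std_moment40_gt1.
have e04 : 1 < e 0 4 by exact: std_moment04_gt1.
have r1E : rho_l1 P0 X Y = e 1 1 by exact: rho_l1E.
have r2E : rho_l2 P0 X Y = (e 2 2 - 1) / Num.sqrt ((e 4 0 - 1) * (e 0 4 - 1)) by exact: rho_l2E.
have [tL1 E1] := expands_rho_l1 expm e10 e01 e20 e02.
have [tL2 E2] := expands_rho_l2 expm e10 e01 e20 e02 e40 e04.
pose k_ (j : 'I_12) := (moment_index j).1; pose l_ (j : 'I_12) := (moment_index j).2.
have kl4 j : (k_ j + l_ j <= 4)%N.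
  by rewrite /k_ /l_; case: j => -[|[|[|[|[|[|[|[|[|[|[|[|//]]]]]]]]]]]].
have kl8 j : (k_ j + l_ j <= 8)%N by exact: leq_trans (kl4 j) _.
pose M := mxM P0 X Y.
pose L n w := (\sum_j M 0 j * G (k_ j) (l_ j) n w, \sum_j M 1 j * G (k_ j) (l_ j) n w).
have L1E n w := (mxM_rows P0 X Y (fun k l => G k l n w)).1.
have L2E n w := (mxM_rows P0 X Y (fun k l => G k l n w)).2.
(* The Cramer-Wold reduction: a combination of the two coordinates of [L] is a normalized sum of
   this single function of the observations. *)
pose psit t1 t2 z := \sum_j (t1 * M 0 j + t2 * M 1 j) * psi (k_ j) (l_ j) z.
have mpsit t1 t2 : measurable_fun setT (psit t1 t2).
  by apply: measurable_sum => j; exact: measurable_funM.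
have LE t1 t2 n w : t1 * (L n w).1 + t2 * (L n w).2 =
    (Num.sqrt n%:R)^-1 * \sum_(i < n) psit t1 t2 (Z i w).
  rewrite /psit exchange_big /= !mulr_sumr -big_split /=.
  by apply: eq_bigr => j _; rewrite -mulr_sumr /G; ring.
have L1psit t1 t2 : L1 P0 (psit t1 t2 \o Z0).
  by apply: L1_sum => j; apply: L1Z; exact: L1psi.
have psit_mean0 t1 t2 : \int[P0]_w psit t1 t2 (Z0 w) = 0.
  rewrite Rintegral_sum; last by move=> j; apply: L1Z; exact: L1psi.
  rewrite big1// => j _; rewrite RintegralZl//; last exact: L1psi.
  by rewrite psi_mean0 ?mulr0.
have psit2E t1 t2 w : psit t1 t2 (Z0 w) ^+ 2 =
    \sum_j \sum_k (t1 * M 0 j + t2 * M 1 j) * (t1 * M 0 k + t2 * M 1 k) *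
      (psi (k_ j) (l_ j) (Z0 w) * psi (k_ k) (l_ k) (Z0 w)).
  rewrite expr2 /psit big_distrlr; apply: eq_bigr => j _; apply: eq_bigr => k _.
  exact: mulrACA.
have L1psit2 t1 t2 : L1 P0 (fun w => psit t1 t2 (Z0 w) ^+ 2).
  under eq_fun do rewrite psit2E.
  by apply: L1_sum => j; apply: L1_sum => k; apply: L1Z; exact: L1psi2.
have psit_var t1 t2 : \int[P0]_w (psit t1 t2 (Z0 w) ^+ 2) =
    t1 ^+ 2 * Sigma_star P0 X Y 0 0 + 2 * t1 * t2 * Sigma_star P0 X Y 0 1
    + t2 ^+ 2 * Sigma_star P0 X Y 1 1.
  rewrite Sigma_star_form; under eq_Rintegral do rewrite psit2E.
  rewrite Rintegral_sum; last first.
    by move=> j; apply: L1_sum => k; apply: L1Z; exact: L1psi2.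
  apply: eq_bigr => j _; rewrite Rintegral_sum; last by move=> k; apply: L1Z; exact: L1psi2.
  apply: eq_bigr => k _; rewrite RintegralZl//; last exact: L1psi2.
  by rewrite [Sigma_m _ _ _ _ _]mxE covE.
have [|t1 t2|nu [nuN nucos]] := @normal2_exists _ (Sigma_star P0 X Y).
- exact: Sigma_star_sym.
- by rewrite -psit_var; apply: Rintegral_ge0 => w _; exact: sqr_ge0.
exists nu => //.
have mL r n : measurable_fun setT (fun w => \sum_j M r j * G (k_ j) (l_ j) n w).
  apply: measurable_sum => j; apply: measurable_funM => //; apply: measurable_funM => //.
  by apply: measurable_sum => i; exact: measurableT_comp.
apply: (@cvg_in_distribution2_trig _ _ _ P nu L) => //.
- by move=> n; exact: mL.
- by move=> n; exact: mL.
- move=> t1 t2 c; rewrite nucos -psit_var.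
  under eq_fun do (under eq_Rintegral do rewrite LE).
  by apply: clt_cos.
(* Tightness of the linear part is the first half of its expansion; [mxM_rows] identifies that part
   with a coordinate of [L]. *)
- apply: (eq_ind _ (tight P) tL1); apply/funext => n; apply/funext => w.
  by rewrite -r1E -L1E.
- apply: (eq_ind _ (tight P) tL2); apply/funext => n; apply/funext => w.
  by rewrite -r2E -L2E.
(* The expansions concern observations standardized by the true parameters. Affine invariance,
   stated for [n > 0], returns to the original ones, and smallness only looks at large [n]. *)
- apply: small_near E1; exists 1%N => // n /= n0 w.
  by rewrite -r1E -L1E -(rho_l1_hat_affine n0 _ _ _ _ sx0 sy0).
- apply: small_near E2; exists 1%N => // n /= n0 w.
  by rewrite -r2E -L2E -(rho_l2_hat_affine n0 _ _ _ _ sx0 sy0).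
Qed.
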